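(* Let $d\ge 1$, $L>0$, and let $W,\Phi,B$ satisfy the following assumption: there exists $m\in\mathbb{N}$ with $2m>d$ and $W\in H^m_S(\mathbb{T}^d)$; $\Phi$ is continuous on $\mathbb{R}$, $C^3$ on $\mathbb{R}\setminus\{0\}$, increasing on $\mathbb{R}_+$, and $\Phi\equiv 0$ on $\mathbb{R}_-$; $B>0$; and $W_0=\int_{\mathbb{T}^d}W(y)\,dy<0$. Let $\kappa^*\in\left(\frac{2|W_0|^2}{L^{2d}\pi B^2},+\infty\right)$. Assume that there exists a unique $k^*\in\mathbb{N}^d$ such that $$\frac{\tilde W(k^* )}{\Theta(k^* )}=\frac{1}{L^{d/2}(\Phi_0^{\kappa^*})'\left(\frac1{L^d}-L^d\bar\rho_\infty^{\kappa^*}\left(\bar\rho_\infty^{\kappa^*}-\frac{\Phi_0^{\kappa^*}}{L^d}\right)\kappa^*\right)}.$$ Assume also that $(\Phi_0^{\kappa^*})''\ge 0$. Then $(\bar\rho_\infty^{\kappa^*},\kappa^* )$ is a bifurcation point of $\bar{\mathcal{G}}(\bar\rho,\kappa)=0$. Moreover, in a neighbourhood $U\times(\kappa^*-\varepsilon,\kappa^*+\varepsilon)$ of $(\bar\rho_\infty^{\kappa^*},\kappa^* )$ in $L^2_S(\mathbb{T}^d)\times(0,+\infty)$, the average of the stationary state (i.e. every solution $(\bar\rho,\kappa)$ of $\bar{\mathcal{G}}(\bar\rho,\kappa)=0$) is either of the form $(\bar\rho_\infty^\kappa,\kappa)$ or on the non-homogeneous solution curve $$\{(\bar\rho_{\kappa(z)},\kappa(z))\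 |\ z\in(-\delta,\delta),\ (\bar\rho_{\kappa(0)},\kappa(0))=(\bar\rho_\infty^{\kappa^*},\kappa^* ),\ \delta>0\},$$ with $$\bar\rho_{\kappa(z)}(x)=\bar\rho_\infty^{\kappa(z)}+z\,\omega_{k^*}(x)+o(z),\qquad x\in\mathbb{T}^d.$$
   Context: $\mathbb{N}=\{0,1,\dots\}$ and $\mathbb{T}^d=\mathbb{R}^d/(L\mathbb{Z})^d$. $L^2_S(\mathbb{T}^d)$ is the Hilbert space of $u\in L^2(\mathbb{T}^d)$ that are even in each coordinate separately, and $H^m_S(\mathbb{T}^d)=H^m(\mathbb{T}^d)\cap L^2_S(\mathbb{T}^d)$. The convolution is $u*v(x)=\int_{\mathbb{T}^d}u(x-y)v(y)\,dy$. Fourier basis of $L^2_S(\mathbb{T}^d)$: for $k\in\mathbb{N}^d$, $\Theta(k)=\prod_{i=1}^d\sqrt{2-\delta_{k_i,0}}$ (Kronecker delta), $\omega_k(x)=\frac{\Theta(k)}{L^{d/2}}\prod_{i=1}^d\cos\left(\frac{2\pi k_i}{L}x_i\right)$, and $\tilde W(k)=\int_{\mathbb{T}^d}W(x)\omega_k(x)\,dx$. For $\kappa>0$ (with $\sigma=1/\kappa$), the PDE is $$\tau\partial_t\rho=-\partial_s\Big[\Big(\Phi\Big(\int_{\mathbb{T}^d}W(x-y)\int_0^\infty s\rho(y,s,t)\,ds\,dy+B\Big)-s\Big)\rho\Big]+\sigma\,\partial_s^2\rho,\qquad x\in\mathbb{T}^d,\ s\ge 0,$$ with no-flux boundary condition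 at $s=0$ and $\int_0^\infty\rho(x,s,t)\,ds=L^{-d}$ for all $x$. The average of $\rho$ is $\bar\rho(x)=\int_0^\infty s\rho(x,s)\,ds$. Stationary states are characterised by their averages, which are exactly the zeros of $$\bar{\mathcal{G}}(\bar\rho,\kappa)=\bar\rho-\frac{\int_0^{\infty}s\,e^{-\kappa(s-\Phi(W*\bar\rho+B))^2/2}\,ds}{L^d\int_0^{\infty}e^{-\kappa(s-\Phi(W*\bar\rho+B))^2/2}\,ds}.$$ For each $\kappa>0$ it is known that there is a unique stationary state $\rho_\infty^\kappa(s)$ independent of $x$; $\bar\rho_\infty^\kappa=\int_0^\infty s\rho_\infty^\kappa(s)\,ds$ is the unique constant zero of $\bar{\mathcal{G}}(\cdot,\kappa)$. Notation: $\Phi_0^\kappa=\Phi(W_0\bar\rho_\infty^\kappa+B)$, $(\Phi_0^\kappa)'=\Phi'(W_0\bar\rho_\infty^\kappa+B)$, $(\Phi_0^\kappa)''=\Phi''(W_0\bar\rho_\infty^\kappa+B)$. A bifurcation point is a point of the homogeneous curve $\{(\bar\rho_\infty^\kappa,\kappa)\}$ at which a second, nontrivial, continuously differentiable curve of solutions in $L^2_S(\mathbb{T}^d)\times(0,\infty)$ crosses it. The symbol $o(z)$ denotes a remainder in $L^2_S(\mathbb{T}^d)$ whose norm divided by $|z|$ tends to $0$ as $z\to0$. *)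

(* Defs.v *)
From HB Require Import structures.
From mathcomp Require Import all_boot all_order all_algebra.
From mathcomp Require Import all_classical all_reals all_analysis.

Set Implicit Arguments.
Unset Strict Implicit.
Unset Printing Implicit Defensive.

Import Order.TTheory GRing.Theory Num.Theory.
Import numFieldNormedType.Exports.

Local Open Scope classical_set_scope.
Local Open Scope ring_scope.

(* As for [n.-tuple T], the sigma-algebra of 'rV[R]_n is the one generated by
   the coordinates. *)
Definition rV_display : measure_display. Proof. exact. Qed.

Section measurable_rV.
Context {R : realType} (n : nat).

Let coors : 'I_n -> 'rV[R]_n -> measurableTypeR R := fun i x => x ord0 i.

Let rV_set0 : g_sigma_preimage coors set0.
Proof. exact: sigma_algebra0. Qed.

Let rV_setC A : g_sigma_preimage coors A -> g_sigma_preimage coors (~` A).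
Proof. exact: sigma_algebraC. Qed.

Let rV_bigcup (F : _^nat) : (forall i, g_sigma_preimage coors (F i)) ->
  g_sigma_preimage coors (\bigcup_i (F i)).
Proof. exact: sigma_algebra_bigcup. Qed.

HB.instance Definition _ := @isMeasurable.Build rV_display
  'rV[R]_n (g_sigma_preimage coors) rV_set0 rV_setC rV_bigcup.

End measurable_rV.


Section measurable_fun_rV.
Context {R : realType}.

Lemma measurable_coord n (i : 'I_n) :
  measurable_fun [set: 'rV[R]_n] (fun x : 'rV[R]_n => x ord0 i).
Proof.
move=> _ Y mY; rewrite setTI; apply: sub_sigma_algebra => /=.
rewrite -bigcup_seq/=; exists i => /=; first by rewrite mem_index_enum.
by exists Y => //; rewrite setTI.
Qed.

Lemma measurable_fun_rV d (T : measurableType d) n (f : T -> 'rV[R]_n) :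
  (forall i, measurable_fun setT (fun t => f t ord0 i)) ->
  measurable_fun setT f.
Proof.
move=> mf.
suff H : g_sigma_preimage
    (fun (i : 'I_n) (x : 'rV[R]_n) => x ord0 i : measurableTypeR R)
    `<=` [set A | measurable (f @^-1` A)].
  by move=> _ A mA; rewrite setTI; exact: H.
apply: smallest_sub.
  split => [|A mA|F mF] /=.
  - by rewrite preimage_set0.
  - by rewrite setTD preimage_setC; exact: measurableC.
  - by rewrite preimage_bigcup; exact: bigcupT_measurable.
case: n => [|n] in f mf *; first by rewrite big_ord0.
rewrite -bigcup_mkord_ord; apply: bigcup_sub => i Ii A [B mB <-] /=.
rewrite setTI; have := mf (inord i) measurableT B mB.
by rewrite setTI.
Qed.

Definition cons_rV n (x : R * 'rV[R]_n) : 'rV[R]_n.+1 :=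
  row_mx (x.1%:M : 'rV[R]_1) x.2.

Lemma measurable_cons_rV n :
  measurable_fun [set: measurableTypeR R * 'rV[R]_n] (@cons_rV n).
Proof.
apply: measurable_fun_rV => i; rewrite /cons_rV.
have [j|j] := splitP (i : 'I_(1 + n)) => ij.
- rewrite (_ : (fun _ => _) = fst); first exact: measurable_fst.
  apply/funext => x; rewrite (_ : i = lshift n j); last exact: val_inj.
  by apply: etrans (row_mxEl _ _ _ _) _; rewrite (ord1 j) mxE /= mulr1n.
- rewrite (_ : (fun _ => _) = (fun v : 'rV[R]_n => v ord0 j) \o snd).
    by apply: measurableT_comp; [exact: measurable_coord|exact: measurable_snd].
  apply/funext => x; rewrite (_ : i = rshift 1 j); last exact: val_inj.
  exact: row_mxEr.
Qed.

End measurable_fun_rV.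

Section torus_measure.
Context {R : realType}.
Variable L : R.

Lemma lebesgue_period_lty :
  (@lebesgue_measure R `[0%R, L[%classic < +oo)%E.
Proof. by rewrite lebesgue_measure_itv /=; case: ifP => _; rewrite ?ltry. Qed.

(* Lebesgue measure on a period [0, L[. *)
Definition period_measure :
    {finite_measure set (measurableTypeR R) -> \bar R} :=
  @mfrestr _ (measurableTypeR R) R _ _ (measurable_itv `[0%R, L[) lebesgue_period_lty.

Section cons_measure.
Variables (n : nat) (mu : {finite_measure set 'rV[R]_n -> \bar R}).

Definition cons_measure := pushforward (period_measure \x mu)%E (@cons_rV R n).

Let mcons := @measurable_cons_rV R n.

Let cons_measure0 : cons_measure set0 = 0%E.
Proof. exact: measure0. Qed.

Let cons_measure_ge0 A : (0 <= cons_measure A)%E.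
Proof. exact: measure_ge0. Qed.

Let cons_measure_sigma_additive : semi_sigma_additive cons_measure.
Proof. exact: measure_semi_sigma_additive. Qed.

HB.instance Definition _ := isMeasure.Build _ _ _ cons_measure
  cons_measure0 cons_measure_ge0 cons_measure_sigma_additive.

Let cons_measure_fin : fin_num_fun cons_measure.
Proof.
apply: lty_fin_num_fun; rewrite /= /cons_measure /pushforward preimage_setT.
rewrite -setXTT product_measure1E//; apply: lte_mul_pinfty => //.
- exact: fin_num_measure.
- by rewrite ltey_eq fin_num_measure.
Qed.

HB.instance Definition _ := Measure_isFinite.Build _ _ _ cons_measure cons_measure_fin.

End cons_measure.

Fixpoint torus_measure (d : nat) : {finite_measure set 'rV[R]_d -> \bar R} :=
  if d is n.+1 then cons_measure (torus_measure n) else \d_(0 : 'rV[R]_0).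

End torus_measure.

(* Functions on T^d = R^d / (L Z)^d are L-periodic functions on R^d; integrals
   over T^d are integrals against [torus_measure L d], which is carried by the
   cell [0, L[^d.  Elements of L^2(T^d) are handled through representatives:
   equality in L^2(T^d) is equality almost everywhere. *)
Section torus_functions.
Context {R : realType} (L : R) {d : nat}.
Implicit Types (u v phi : 'rV[R]_d -> R) (x : 'rV[R]_d) (i : 'I_d).

Local Notation mu := (torus_measure L d).

Definition periodic u := forall i x, u (x + L *: delta_mx 0 i) = u x.

Definition reflect_coord i x : 'rV[R]_d :=
  \row_j (if j == i then - x 0 j else x 0 j).

Definition even_coords u := forall i x, u (reflect_coord i x) = u x.

Definition L2 : set ('rV[R]_d -> R) :=
  [set u | periodic u /\ u \in Lfun mu 2%:E].

Definition L2S : set ('rV[R]_d -> R) := L2 `&` [set u | even_coords u].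

Definition L2norm u : R := fine 'N[mu]_2%:E[EFin \o u].

Definition L2eq u v := u = v %[ae mu].

Definition partial i phi : 'rV[R]_d -> R := fun x => 'D_(delta_mx 0 i) phi x.

(* phi is C^infty *)
Definition smooth phi :=
  forall (s : seq 'I_d) x, differentiable (foldr partial phi s) x.

Definition multi_partial (a : {ffun 'I_d -> nat}) phi :=
  foldr (fun i => iter (a i) (partial i)) phi (enum 'I_d).

Definition weak_derivative (a : {ffun 'I_d -> nat}) u v :=
  forall phi, periodic phi -> smooth phi ->
    \int[mu]_x (u x * multi_partial a phi x) =
    (-1) ^+ (\sum_i a i)%N * \int[mu]_x (v x * phi x).

Definition Sobolev (m : nat) : set ('rV[R]_d -> R) :=
  [set u | L2 u /\ forall a : {ffun 'I_d -> nat}, (\sum_i a i <= m)%N ->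
                     exists2 v, L2 v & weak_derivative a u v].

Definition SobolevS (m : nat) : set ('rV[R]_d -> R) := Sobolev m `&` L2S.

Definition conv u v x : R := \int[mu]_y (u (x - y) * v y).

Definition Theta (k : {ffun 'I_d -> nat}) : R :=
  \prod_i Num.sqrt (2 - (k i == 0%N)%:R).

Definition omega (k : {ffun 'I_d -> nat}) x : R :=
  Theta k / L `^ (d%:R / 2) * \prod_i cos (2 * pi * (k i)%:R / L * x 0 i).

Definition cos_coef u (k : {ffun 'I_d -> nat}) : R :=
  \int[mu]_x (u x * omega k x).

(* [drho] is the derivative of the curve [rho] in L^2_S(T^d) and is
   continuous, on ]- delta, delta[. *)
Definition L2S_C1_on (delta : R) (rho drho : R -> 'rV[R]_d -> R) :=
  forall z, `|z| < delta ->
    [/\ L2S (rho z), L2S (drho z),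
        (fun h => L2norm (rho (z + h) \- rho z \- h \*: drho z))
          =o_ (0 : R) (fun h => h) &
        L2norm (drho y \- drho z) @[y --> z] --> (0 : R)].

End torus_functions.

Section model.
Context {R : realType} (L : R) {d : nat}.
Variables (W : 'rV[R]_d -> R) (Phi : R -> R) (B : R).
Implicit Types (rho : 'rV[R]_d -> R) (kappa : R).

Local Notation mu := (torus_measure L d).
Local Notation leb := (@lebesgue_measure R).

Definition gauss kappa (p s : R) : R := expR (- (kappa * (s - p) ^+ 2 / 2)).

Definition Gbar rho kappa : 'rV[R]_d -> R := fun x =>
  let p := Phi (conv L W rho x + B) in
  rho x - (\int[leb]_(s in `[0, +oo[) (s * gauss kappa p s)) /
          (L ^+ d * \int[leb]_(s in `[0, +oo[) gauss kappa p s).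

Definition solution rho kappa :=
  [/\ L2S L rho, 0 < kappa & L2eq L (Gbar rho kappa) (cst 0)].

Definition W0 : R := \int[mu]_y W y.

(* The average of the homogeneous stationary state: the unique constant zero of
   [Gbar] when [0 < kappa]. *)
Definition rho_inf kappa : R := xget 0 [set c : R | solution (cst c) kappa].

Definition homogeneous rho kappa := L2eq L rho (cst (rho_inf kappa)).

(* [Phi], [Phi'], [Phi''] for n = 0, 1, 2 at the homogeneous state *)
Definition Phi0 (n : nat) kappa : R := derive1n n Phi (W0 * rho_inf kappa + B).

Definition bif_denominator kappa : R :=
  L `^ (d%:R / 2) * Phi0 1 kappa *
  ((L ^+ d)^-1 -
   L ^+ d * rho_inf kappa * (rho_inf kappa - Phi0 0 kappa / L ^+ d) * kappa).

(* A regular C^1 curve of solutions, meeting the homogeneous curve exactly at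
   z = 0, where it passes through the point (rho0, kappa0). *)
Definition nontrivial_branch rho0 kappa0 (delta : R)
    (rho : R -> 'rV[R]_d -> R) (kappa : R -> R) :=
  [/\ 0 < delta,
      L2eq L (rho 0) rho0 /\ kappa 0 = kappa0,
      forall z, `|z| < delta -> solution (rho z) (kappa z),
      forall z, `|z| < delta -> z != 0 -> ~ homogeneous (rho z) (kappa z) &
      exists drho : R -> 'rV[R]_d -> R,
        L2S_C1_on L delta rho drho /\
        forall z, `|z| < delta ->
          [/\ derivable kappa z 1, {for z, continuous (derive1 kappa)} &
              ~ (L2norm L (drho z) = 0 /\ derive1 kappa z = 0)]].

Definition bifurcation_point rho0 kappa0 :=
  [/\ 0 < kappa0, homogeneous rho0 kappa0 &
      exists (delta : R) (rho : R -> 'rV[R]_d -> R) (kappa : R -> R),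
        nontrivial_branch rho0 kappa0 delta rho kappa].

End model.

Definition C3_off0 (R : realType) (f : R -> R) :=
  forall x, x != 0 ->
    (forall n, (n < 3)%N -> derivable (derive1n n f) x 1) /\
    {for x, continuous (derive1n 3 f)}.

(* Main.v *)
(* Put [a = sqrt (kappa / 2)]. The stationary equation reads
   [rho = act_a (W * rho)], where [act_a (v) = gmean (a Phi (v + B)) / (L^d a)] and
   [gmean q = q + mills q] is the mean of a Gaussian truncated to a half-line. As
   [gmean' > 0] and [W_0 < 0], there is one constant solution [cc (a)]; it depends in a
   C^1 way on [a], and above the threshold on [kappa*] its argument
   [W_0 cc (a) + B] is positive, where [Phi] is smooth.

   Bifurcating solutions are sought as [rho = cc (a0 + s) + z u] with [u] near the
   cosine mode of index [k*]: dividing by [z], [u = P (s, z, W * u)] with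
   [P (s, z, y) = y int_0^1 act_(a0 + s)' (W_0 cc (a0 + s) + t z y) dt]. At
   [(s, z) = 0] this is [u = K0 (W * u)], whose kernel is spanned by the [k*]-mode,
   because the hypothesis on [k*] says that [K0] times the eigenvalue of the
   convolution on the mode [k] is 1 exactly for [k = k*]. The operator
   [u - K0 (W * u)] is approximately
   inverted through finitely many Fourier modes, the rest of [W] being small in L^2.
   Transversality is [K1 > 0], where [K1 y] is the [s]-derivative of [P] at
   [(0, 0, y)]; it follows from [Phi'' >= 0], [gmean'' > 0] on [0, +oo[ and
   [cc' < 0]. So [u] and [s] are obtained as functions of [z] by a contraction, and
   the fixed point depends in a C^1 way on [z]. Conversely a small solution [v]
   around [cc (a)] satisfies [v = K0 (W * v) + o (W * v)] and hence lies in a narrow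
   cone around the [k*]-mode, so that [v = z u] with [u] in the domain of the
   contraction. *)

Require Import Defs.
From HB Require Import structures.
From mathcomp Require Import all_boot all_order all_algebra.
From mathcomp Require Import all_classical all_reals all_analysis.
From mathcomp Require Import measurable_realfun.
From mathcomp Require Import ring lra.

Set Implicit Arguments.
Unset Strict Implicit.
Unset Printing Implicit Defensive.

Import Order.TTheory GRing.Theory Num.Theory.
Import numFieldNormedType.Exports.

Local Open Scope classical_set_scope.
Local Open Scope ring_scope.

(** * Integration over the torus *)

(** The analysis runs in the uniform norm, on everywhere defined bounded functions ([nice]). Two
    consequences of [W] being in L^2 allow this: an L^2 solution agrees almost everywhere with
    [act_a (W * rho)], which is nice, and L^2 closeness of [rho] is uniform closeness of [W * rho].
    Compositions with scalar functions then only need moduli on compact boxes, and null sets enter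
    only when passing from L^2 classes to representatives and back. The norm is never a number but
    the relation [bounded_by u M]; estimates of the kind [|v| <= c + |v| / 2] are exploited by
    improving a crude bound repeatedly. The inverse of the linearised operator is needed only up to
    a defect of 1/4: a Newton map with this fixed inverse contracts by 1/2, the other 1/4 being left
    to the nonlinearity. Hence mere density of trigonometric polynomials suffices, without rates.
    [Phi] may fail to be differentiable at 0. The boxes are therefore sized so that the argument of
    [Phi] stays at least half of [W_0 cc (a0) + B], which the threshold makes positive. *)

Section period_integral.
Context {R : realType}.
Local Notation leb := (@lebesgue_measure R).

Lemma measurable_shift (s : R) :
  measurable_fun [set: measurableTypeR R] (fun t : measurableTypeR R => t + s : measurableTypeR R).
Proof. by apply: measurable_funD => //; exact: measurable_cst. Qed.

Lemma lebesgue_measure_shift (s : R) (A : set R) : measurable A ->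
  pushforward leb (fun t => t + s : measurableTypeR R) A = leb A.
Proof.
move=> mA; apply/esym/lebesgue_measure_unique => //=.
  exact: measurable_shift.
move=> _ _ [[a b]] _ <-; rewrite /pushforward.
rewrite (_ : _ @^-1` _ = `]a - s, b - s]%classic); last first.
  by apply/seteqP; split => t /=; rewrite !in_itv/= ltrBlDr lerBrDr.
by rewrite !lebesgue_measure_itv/= !lte_fin ltrD2r; case: ifP => // _;
  rewrite -!EFinD; congr (_%:E); ring.
Qed.

Lemma ge0_integral_shift (s : R) (D : set R) (g : R -> \bar R) :
  measurable D -> measurable_fun setT g -> (forall t, (0 <= g t)%E) ->
  (\int[leb]_(t in (fun t : R => (t + s)%R) @^-1` D) g (t + s)%R = \int[leb]_(t in D) g t)%E.
Proof.
move=> mD mg g0.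
rewrite -(@ge0_integral_pushforward _ _ (measurableTypeR R) (measurableTypeR R) R
  (fun t => t + s) (measurable_shift s) leb D g) //; last exact: measurable_funS mg.
apply: eq_measure_integral => //=; first exact: measurable_shift.
by move=> ms A mA AS; exact: lebesgue_measure_shift.
Qed.

Variable L : R.
Hypothesis L0 : 0 < L.
Local Notation pm := (period_measure L).

Lemma ge0_integral_period (g : R -> \bar R) :
  measurable_fun setT g -> (forall t, (0 <= g t)%E) ->
  (\int[pm]_t g t = \int[leb]_(t in `[0%R, L[) g t)%E.
Proof.
move=> mg g0.
rewrite (@ge0_negligible_integral _ (measurableTypeR R) R pm setT (~` `[0, L[%classic)) //=.
- rewrite setTD setCK; apply: eq_measure_integral => A mA AS.
  by rewrite /period_measure /= /mfrestr /mrestr setIidl.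
- exact: measurableC.
- by rewrite /period_measure /= /mfrestr /mrestr setICl measure0.
Qed.

(** Nonnegative test functions keep integrability out of the way; signed integrals follow from
    positive and negative parts. The property is one-dimensional so that the torus is reached by
    induction on the coordinates. *)
Definition period_preserving (psi : R -> R) := forall g : R -> \bar R,
  measurable_fun setT g -> (forall t, (0 <= g t)%E) -> (forall t, g (t + L) = g t) ->
  (\int[pm]_t g (psi t) = \int[pm]_t g t)%E.

Lemma periodic_shiftn (T : Type) (g : R -> T) n t : (forall t, g (t + L) = g t) -> g (t + L *+ n) = g t.
Proof. by move=> gL; elim: n => [|n IH]; rewrite ?mulr0n ?addr0// mulrSr addrA gL IH. Qed.

Lemma periodic_shiftz (T : Type) (g : R -> T) (n : int) t : (forall t, g (t + L) = g t) -> g (t + L *~ n) = g t.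
Proof.
case: n => n gL; first exact: periodic_shiftn.
by rewrite NegzE mulrNz -(@periodic_shiftn _ g n.+1 _ gL) -pmulrn subrK.
Qed.

(** Only the remainder [r] of [s] modulo the period matters. The translated window [[r, L + r[] is
    cut at [L], and its overhang [[L, L + r[] is moved back by one period onto [[0, r[]. *)
Lemma period_preserving_shift s : period_preserving (fun t => t + s).
Proof.
move=> g mg g0 gL.
pose n := Num.floor (s / L); pose r := s - L *~ n.
have r0 : 0 <= r by rewrite subr_ge0 -mulrzr -ler_pdivlMl// mulrC Num.Theory.floor_le.
have rL : r < L.
  rewrite ltrBlDr -[X in X + _]mulr1 -mulrzr -mulrDr -ltr_pdivrMl// mulrC addrC.
  by have := floorD1_gt (s / L); rewrite intrD.
have mgr : measurable_fun setT (fun t : R => g (t + r)).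
  by apply: (@measurableT_comp _ _ _ _ _ _ g) => //; exact: measurable_shift.
have -> : (\int[pm]_t g (t + s)%R = \int[pm]_t g (t + r)%R)%E.
  by apply: eq_integral => t _; rewrite -[RHS](@periodic_shiftz _ g n _ gL) /r addrA subrK.
rewrite !ge0_integral_period//.
rewrite [in LHS](_ : `[0%R, L[%classic = (fun t => t + r) @^-1` `[r, (L + r)%R[%classic); last first.
  by apply/seteqP; split => t /=; rewrite !in_itv/= lerDr ltrD2r.
rewrite ge0_integral_shift//.
have mgD D : measurable_fun D g by exact: measurable_funS mg.
have split3 a b c : a <= b -> b <= c -> (\int[leb]_(t in `[a, c[) g t =
    \int[leb]_(t in `[a, b[) g t + \int[leb]_(t in `[b, c[) g t)%E.
  move=> ab bc; rewrite (@itv_bndbnd_setU _ _ _ (BLeft b)) ?bnd_simp//.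
  rewrite ge0_integral_setU//.
  - exact: mgD.
  - by apply/disj_setPS => y [/=]; rewrite 2!in_itv/= => /andP[_ yx] /andP[]; rewrite leNgt yx.
rewrite (split3 r L (L + r)) ?lerDl ?(ltW rL)// (split3 0 r L) ?(ltW rL)// [RHS]addeC.
congr (_ + _)%E.
rewrite -(@ge0_integral_shift L)//.
have -> : (fun t => t + L) @^-1` `[L, (L + r)%R[%classic = `[0%R, r[%classic.
  by apply/seteqP; split => t /=; rewrite !in_itv/= lerDr (addrC L) ltrD2r.
exact: eq_integral.
Qed.

(** Negation turns the cell into []-L, 0]]; exchanging the closed end costs two null points, and a
    translation by [L] returns to the cell. *)
Lemma period_preserving_opp : period_preserving -%R.
Proof.
move=> g mg g0 gL.
have mgN : measurable_fun setT (fun t : R => g (- t)).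
  by apply: (@measurableT_comp _ _ _ _ _ _ g).
rewrite !ge0_integral_period//.
transitivity (\int[leb]_(t in `](- L)%R, 0%R]) g t)%E.
  have -> : `[0%R, L[%classic = (-%R : R -> measurableTypeR R) @^-1` `](- L), 0]%classic.
    by rewrite opp_preimage_itvbndbnd oppr0 opprK.
  rewrite -(@ge0_integral_pushforward _ _ (measurableTypeR R) (measurableTypeR R) R
    (-%R) _ leb _ g) //; last exact: measurable_funS mg.
  by apply: eq_measure_integral => //= A mA AS; exact: lebesgue_measureN.
rewrite integral_itv_obnd_cbnd; last exact: measurable_funS mg.
rewrite -integral_itv_bndo_bndc; last exact: measurable_funS mg.
rewrite -[RHS](@ge0_integral_shift L)//.
have -> : (fun t => t + L) @^-1` `[0%R, L[%classic = `[(- L)%R, 0%R[%classic.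
  by apply/seteqP; split => t /=; rewrite !in_itv/= -lerBlDr sub0r gtrDr.
exact: eq_integral.
Qed.

Lemma period_preserving_subl s : period_preserving (fun t => s - t).
Proof.
move=> g mg g0 gL.
have mgs : measurable_fun setT (fun t : R => g (t + s)).
  by apply: (@measurableT_comp _ _ _ _ _ _ g) => //; exact: measurable_shift.
rewrite -(period_preserving_shift s mg g0 gL) -(@period_preserving_opp (fun t => g (t + s)))//.
- by apply: eq_integral => t _; rewrite addrC.
- by move=> t; rewrite addrAC gL.
Qed.

End period_integral.

Section torus_integral.
Context {R : realType}.
Variable L : R.
Hypothesis L0 : 0 < L.

Lemma cons_rV0 n (t : R) (v : 'rV[R]_n) : cons_rV (t, v) 0 ord0 = t.
Proof.
rewrite /cons_rV (_ : ord0 = lshift n (@ord0 0)); last exact: val_inj.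
by apply: etrans (row_mxEl _ _ _ _) _; rewrite mxE /= mulr1n.
Qed.

Lemma cons_rVS n (t : R) (v : 'rV[R]_n) j : cons_rV (t, v) 0 (lift ord0 j) = v 0 j.
Proof.
rewrite /cons_rV (_ : lift ord0 j = rshift 1 j); last exact: val_inj.
exact: row_mxEr.
Qed.

Definition cons_rVE := (cons_rV0, cons_rVS).

Definition lattice_periodic d (T : Type) (f : 'rV[R]_d -> T) :=
  forall i x, f (x + L *: delta_mx 0 i) = f x.

(** One construction for the three changes of variable in use: translation along an axis, reflection
    of a coordinate, and [y |-> x - y]. *)
Definition rV_map d (psi : 'I_d -> R -> R) (x : 'rV[R]_d) : 'rV[R]_d :=
  \row_j psi j (x 0 j).

Lemma measurable_rV_map d (psi : 'I_d -> R -> R) :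
  (forall j, measurable_fun setT (psi j)) -> measurable_fun setT (rV_map psi).
Proof.
move=> mpsi; apply: measurable_fun_rV => i.
rewrite (_ : (fun _ => _) = psi i \o (fun x : 'rV[R]_d => x ord0 i)); last first.
  by apply/funext => x; rewrite mxE.
by apply: measurableT_comp => //; exact: measurable_coord.
Qed.

Lemma ge0_integral_torusS n (f : 'rV[R]_n.+1 -> \bar R) :
  measurable_fun setT f -> (forall x, (0 <= f x)%E) ->
  (\int[torus_measure L n.+1]_x f x =
   \int[torus_measure L n]_v \int[period_measure L]_t f (cons_rV (t, v)))%E.
Proof.
move=> mf f0.
rewrite (@ge0_integral_pushforward _ _ (measurableTypeR R * 'rV[R]_n)%type 'rV[R]_n.+1 R
  (@cons_rV R n) (@measurable_cons_rV R n)
  ((period_measure L \x torus_measure L n)%E : {measure set (measurableTypeR R * 'rV[R]_n) -> \bar R})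
  setT f)//=.
rewrite preimage_setT fubini_tonelli2//=.
exact: measurableT_comp (@measurable_cons_rV R n).
Qed.

Lemma measurable_cons_section n (f : 'rV[R]_n.+1 -> \bar R) v :
  measurable_fun setT f -> measurable_fun setT (fun t : R => f (cons_rV (t, v))).
Proof.
move=> mf; apply: (measurableT_comp mf).
apply: (@measurableT_comp _ _ _ (measurableTypeR R) (measurableTypeR R * 'rV[R]_n)%type
  'rV[R]_n.+1 (@cons_rV R n) _ (pair^~ v)); first exact: measurable_cons_rV.
exact: measurable_pair2.
Qed.

Lemma measurable_integral_cons n (f : 'rV[R]_n.+1 -> \bar R) :
  measurable_fun setT f -> (forall x, (0 <= f x)%E) ->
  measurable_fun setT (fun v => \int[period_measure L]_t f (cons_rV (t, v)))%E.
Proof.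
move=> mf f0.
apply: (@measurable_fun_fubini_tonelli_G _ _ (measurableTypeR R) 'rV[R]_n R
  (period_measure L) (f \o @cons_rV R n)) => [|x] /=; last exact: f0.
exact: measurableT_comp (@measurable_cons_rV R n).
Qed.

(** Induction on the dimension by Tonelli: the inner integral absorbs [psi ord0], and what remains
    is again nonnegative, measurable and periodic in the other coordinates. *)
Lemma ge0_integral_torus_map d (psi : 'I_d -> R -> R) (f : 'rV[R]_d -> \bar R) :
  (forall j, measurable_fun setT (psi j)) -> (forall j, period_preserving L (psi j)) ->
  measurable_fun setT f -> (forall x, (0 <= f x)%E) -> lattice_periodic f ->
  (\int[torus_measure L d]_x f (rV_map psi x) = \int[torus_measure L d]_x f x)%E.
Proof.
elim: d => [|d IH] in psi f * => mpsi ppsi mf f0 fL.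
  by apply: eq_integral => x _; rewrite (thinmx0 (rV_map psi x)) (thinmx0 x).
have mfp : measurable_fun setT (fun x => f (rV_map psi x)).
  exact: measurableT_comp (measurable_rV_map mpsi).
rewrite (ge0_integral_torusS mfp (fun x => f0 _)) (ge0_integral_torusS mf f0).
pose psi' j := psi (lift ord0 j).
have consE t v : rV_map psi (cons_rV (t, v)) = cons_rV (psi ord0 t, rV_map psi' v).
  apply/rowP => i; rewrite mxE; case: (unliftP ord0 i) => [j ->|->]; rewrite !cons_rVE//.
  by rewrite mxE.
under eq_integral => v _.
  under eq_integral do rewrite consE.
  rewrite (ppsi ord0 (fun t => f (cons_rV (t, rV_map psi' v))))//; last 2 first.
    exact: measurable_cons_section.
    move=> t; rewrite -[RHS](fL ord0); congr f; apply/rowP => i.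
    rewrite [RHS]mxE [X in _ = _ + X]mxE [X in _ = _ + _ * X]mxE.
    by case: (unliftP ord0 i) => [j ->|->]; rewrite !cons_rVE ?mulr0 ?addr0 ?mulr1.
  over.
rewrite (IH psi' (fun v => \int[period_measure L]_t f (cons_rV (t, v)))%E)//.
- by move=> j; exact: mpsi.
- by move=> j; exact: ppsi.
- exact: measurable_integral_cons.
- by move=> x; apply: integral_ge0.
- move=> i v; apply: eq_integral => t _; rewrite -[RHS](fL (lift ord0 i)); congr f.
  apply/rowP => k; rewrite [RHS]mxE [X in _ = _ + X]mxE [X in _ = _ + _ * X]mxE.
  case: (unliftP ord0 k) => [j ->|->]; rewrite !cons_rVE ?mxE//=.
  by rewrite mulr0 addr0.
Qed.

End torus_integral.

Section torus_change_of_variable.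
Context {R : realType} (L : R) (L0 : 0 < L) {d : nat}.
Local Notation mu := (torus_measure L d).
Implicit Types (f u : 'rV[R]_d -> R) (x y : 'rV[R]_d) (i : 'I_d).

Lemma measurable_funE_comp f (h : 'rV[R]_d -> 'rV[R]_d) :
  measurable_fun setT f -> measurable_fun setT h -> measurable_fun setT (fun x => f (h x)).
Proof. by move=> mf mh; exact: measurableT_comp mf mh. Qed.

Lemma Rintegral_torus_map (psi : 'I_d -> R -> R) f :
  (forall j, measurable_fun setT (psi j)) -> (forall j, period_preserving L (psi j)) ->
  measurable_fun setT f -> Defs.periodic L f ->
  \int[mu]_x f (rV_map psi x) = \int[mu]_x f x.
Proof.
move=> mpsi ppsi mf fL; congr fine.
have mEf : measurable_fun setT (EFin \o f) by exact/measurable_EFinP.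
rewrite integralE [RHS]integralE; congr (_ - _)%E.
- rewrite -(ge0_integral_torus_map mpsi ppsi (f := ((EFin \o f)^\+)%E))//.
  + by apply: eq_integral => x _; rewrite !funeposE.
  + exact: measurable_funepos.
  + by move=> i x; rewrite !funeposE /= fL.
- rewrite -(ge0_integral_torus_map mpsi ppsi (f := ((EFin \o f)^\-)%E))//.
  + by apply: eq_integral => x _; rewrite !funenegE.
  + exact: measurable_funeneg.
  + by move=> i x; rewrite !funenegE /= fL.
Qed.

Lemma integrable_torus_map (psi : 'I_d -> R -> R) f :
  (forall j, measurable_fun setT (psi j)) -> (forall j, period_preserving L (psi j)) ->
  Defs.periodic L f -> mu.-integrable setT (EFin \o f) ->
  mu.-integrable setT (fun x => (f (rV_map psi x))%:E).
Proof.
move=> mpsi ppsi fL /integrableP[mf fi].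
have mrf : measurable_fun setT f by exact/measurable_EFinP.
apply/integrableP; split.
  apply/measurable_EFinP; apply: measurable_funE_comp mrf _; exact: measurable_rV_map.
rewrite (ge0_integral_torus_map mpsi ppsi (f := fun x => `|(f x)%:E|%E))//.
  exact: measurableT_comp.
by move=> i x /=; rewrite fL.
Qed.

Lemma subr_rV_map x y : x - y = rV_map (fun j t => x 0 j - t) y.
Proof. by apply/rowP => j; rewrite !mxE. Qed.

Lemma measurable_subl (s : R) : measurable_fun setT (fun t : R => s - t).
Proof. by apply: measurable_funB => //; exact: measurable_cst. Qed.

Lemma Rintegral_torus_sub x f : measurable_fun setT f -> Defs.periodic L f ->
  \int[mu]_y f (x - y) = \int[mu]_y f y.
Proof.
move=> mf fL; rewrite -(Rintegral_torus_map (psi := fun j t => x 0 j - t) _ _ mf fL).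
- by apply: eq_Rintegral => y _; rewrite subr_rV_map.
- by move=> j; exact: measurable_subl.
- by move=> j; exact: period_preserving_subl.
Qed.

Lemma integrable_torus_sub x f : Defs.periodic L f -> mu.-integrable setT (EFin \o f) ->
  mu.-integrable setT (fun y => (f (x - y))%:E).
Proof.
move=> fL fi; rewrite (_ : (fun y => _) = (fun y => (f (rV_map (fun j t => x 0 j - t) y))%:E)).
  apply: integrable_torus_map => // j; first exact: measurable_subl.
  exact: period_preserving_subl.
by apply/funext => y; rewrite subr_rV_map.
Qed.

Lemma reflect_coord_rV_map i x :
  reflect_coord i x = rV_map (fun j t => if j == i then - t else t) x.
Proof. by apply/rowP => j; rewrite !mxE; case: ifP. Qed.

Lemma Rintegral_torus_reflect i f : measurable_fun setT f -> Defs.periodic L f ->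
  \int[mu]_x f (reflect_coord i x) = \int[mu]_x f x.
Proof.
move=> mf fL.
rewrite -(Rintegral_torus_map (psi := fun j t => if j == i then - t else t) _ _ mf fL).
- by apply: eq_Rintegral => y _; rewrite reflect_coord_rV_map.
- by move=> j; case: (j == i); [exact: oppr_measurable|exact: measurable_id].
- by move=> j; case: (j == i) => //; exact: period_preserving_opp.
Qed.

Lemma addr_rV_map i (t : R) x :
  x + t *: delta_mx 0 i = rV_map (fun j s => if j == i then s + t else s) x.
Proof.
by apply/rowP => j; rewrite !mxE eqxx /=; case: ifP => _; rewrite ?mulr1 ?mulr0 ?addr0.
Qed.

Lemma Rintegral_torus_shift i t f : measurable_fun setT f -> Defs.periodic L f ->
  \int[mu]_x f (x + t *: delta_mx 0 i) = \int[mu]_x f x.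
Proof.
move=> mf fL.
rewrite -(Rintegral_torus_map (psi := fun j s => if j == i then s + t else s) _ _ mf fL).
- by apply: eq_Rintegral => y _; rewrite addr_rV_map.
- by move=> j; case: (j == i); [exact: measurable_shift|exact: measurable_id].
- by move=> j; case: (j == i) => //; exact: period_preserving_shift.
Qed.

End torus_change_of_variable.

Section torus_volume.
Context {R : realType} (L : R) (L0 : 0 < L).

Lemma period_measureT : period_measure L setT = L%:E.
Proof.
rewrite /period_measure /= /mfrestr /mrestr setTI lebesgue_measure_itv/= lte_fin L0.
by rewrite -EFinD subr0.
Qed.

Lemma torus_measureT d : torus_measure L d setT = (L ^+ d)%:E.
Proof.
elim: d => [|d IH]; first by rewrite /= diracT expr0.
rewrite /= /cons_measure /pushforward preimage_setT -setXTT product_measure1E//.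
by rewrite [X in (X * _)%E]period_measureT [X in (_ * X)%E]IH -EFinM exprS.
Qed.

(** Used to discard hyperplanes and the complement of the cell. If the coordinate is not the first
    one, Tonelli brings the integral over the remaining coordinates inside, where the induction
    hypothesis applies. *)
Lemma ge0_integral_coord_eq0 d (i : 'I_d) (g : R -> \bar R) :
  measurable_fun setT g -> (forall t, (0 <= g t)%E) ->
  (\int[period_measure L]_t g t = 0)%E ->
  (\int[torus_measure L d]_x g (x 0%R i) = 0)%E.
Proof.
move=> mg g0 gi; elim: d i => [[]//|d IH] i.
have mgi n (j : 'I_n) : measurable_fun setT (fun x : 'rV[R]_n => g (x 0 j)).
  by apply: (measurableT_comp mg); exact: measurable_coord.
rewrite ge0_integral_torusS; [|exact: mgi|by move=> ?].
case: (unliftP ord0 i) => [j ->|->]; last first.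
  under eq_integral => v _.
    under eq_integral do rewrite cons_rV0.
    rewrite gi; over.
  by rewrite integral0.
under eq_integral => v _ do under eq_integral do rewrite cons_rVS.
rewrite -(fubini_tonelli (m1 := period_measure L) (m2 := torus_measure L d)
  (fun tv : measurableTypeR R * 'rV[R]_d => g (tv.2 0%R j)))//=; last first.
  by apply: (measurableT_comp (mgi _ j)); exact: measurable_snd.
by under eq_integral do rewrite IH; rewrite integral0.
Qed.

End torus_volume.

Section integrable_torus.
Context {R : realType} (L : R) {d : nat}.
Local Notation mu := (torus_measure L d).
Implicit Types (u v : 'rV[R]_d -> R).

(** The uniform norm appears only as this relation. It holds at every point, so pointwise equations
    can be composed without tracking null sets. *)
Definition bounded_by (T : Type) (u : T -> R) (M : R) := forall x, `|u x| <= M.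

Definition integrable1 u := mu.-integrable setT (EFin \o u).

Lemma integrable1_measurable u : integrable1 u -> measurable_fun setT u.
Proof. by move/integrableP => [/measurable_EFinP]. Qed.

Lemma integrable1_bounded u M : measurable_fun setT u -> bounded_by u M -> integrable1 u.
Proof.
move=> mu_ uM; apply: measurable_bounded_integrable => //.
  by rewrite ltey_eq fin_num_measure.
exists M; split; first exact: num_real.
by move=> x xM y _; apply: le_trans (uM y) (ltW xM).
Qed.

Lemma integrable1M u v M : integrable1 u -> measurable_fun setT v -> bounded_by v M ->
  integrable1 (fun x => u x * v x).
Proof.
move=> ui mv vM.
have bv : [bounded v x | x in [set: 'rV[R]_d]].
  exists M; split; first exact: num_real.
  by move=> x xM y _; apply: le_trans (vM y) (ltW xM).
by have := integrableMl measurableT ui mv bv; apply: eq_integrable.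
Qed.

Lemma integrable1D u v : integrable1 u -> integrable1 v -> integrable1 (fun x => u x + v x).
Proof. by move=> iu iv; exact: (integrableD measurableT iu iv). Qed.

Lemma integrable1Z (c : R) u : integrable1 u -> integrable1 (fun x => c * u x).
Proof. by move=> iu; exact: (integrableZl measurableT c iu). Qed.

Lemma integrable1_sum (I : Type) (s : seq I) (P : pred I) (F : I -> 'rV[R]_d -> R) :
  (forall i, integrable1 (F i)) -> integrable1 (fun x => \sum_(i <- s | P i) F i x).
Proof.
move=> iF; apply: (eq_integrable _ (fun x => \sum_(i <- s | P i) (F i x)%:E)%E) => //.
  by move=> x _; rewrite /= sumEFin.
by apply: integrable_sum => // i _; exact: iF.
Qed.

Lemma Rintegral_sum1 (I : Type) (s : seq I) (P : pred I) (F : I -> 'rV[R]_d -> R) :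
  (forall i, integrable1 (F i)) ->
  \int[mu]_x (\sum_(i <- s | P i) F i x) = \sum_(i <- s | P i) \int[mu]_x F i x.
Proof.
move=> iF; elim: s => [|i s IH].
  rewrite big_nil; under eq_Rintegral do rewrite big_nil.
  by rewrite Rintegral_cst// mul0r.
rewrite big_cons; under eq_Rintegral do rewrite big_cons.
case: ifP => Pi; last exact: IH.
by rewrite RintegralD ?IH//; [exact: iF|exact: integrable1_sum].
Qed.

End integrable_torus.

(** * Products of cosines with phases *)

Section monomials.
Context {R : realType} (L : R) (L0 : 0 < L) {d : nat}.
Local Notation mu := (torus_measure L d).
Implicit Types (k l : 'I_d -> int) (th ph : 'I_d -> R) (v : 'rV[R]_d -> R) (x : 'rV[R]_d).

(** The phases make the family contain the sines and its span closed under products; integer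
    frequencies allow the differences [k - l]. *)
Definition mon k th x : R := \prod_i cos (2 * pi * (k i)%:~R / L * x 0 i + th i).

Lemma mon_bounded k th : bounded_by (mon k th) 1.
Proof.
move=> x; rewrite /mon normr_prod; apply: prodr_ile1 => i _.
by rewrite normr_ge0 cos_max.
Qed.

Lemma measurable_mon k th : measurable_fun setT (mon k th).
Proof.
rewrite /mon; apply: measurable_prod => i _.
apply: (measurableT_comp (@continuous_measurable_fun _ cos (@continuous_cos R))).
apply: measurable_funD; last exact: measurable_cst.
apply: measurable_funM; [exact: measurable_cst|exact: measurable_coord].
Qed.

Lemma integrable1_mon k th : integrable1 L (mon k th).
Proof. exact: integrable1_bounded (measurable_mon k th) (mon_bounded k th). Qed.

Lemma cosD2npi (a : R) (n : int) : cos (a + 2 * pi * n%:~R) = cos a.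
Proof.
have cosn (b : R) (m : nat) : cos (b + 2 * pi * m%:R) = cos b.
  rewrite mulr_natr -(periodicn (@cosD2pi R) m b); congr (cos (_ + _ *+ _)).
  by rewrite mulr_natl.
case: n => m; first by rewrite -pmulrn cosn.
by rewrite NegzE mulrNz mulrN -[in RHS](subrK (2 * pi * m.+1%:R) a) cosn.
Qed.

Lemma mon_periodic k th : Defs.periodic L (mon k th).
Proof.
move=> i x; rewrite /mon; apply: eq_bigr => j _; rewrite !mxE eqxx /=.
case: (j == i); rewrite ?mulr0 ?addr0// mulr1 mulrDr addrAC divfK ?gt_eqF//.
by rewrite cosD2npi.
Qed.

(** Translation by half a wavelength [L / (2 k_i)] along axis [i] changes the sign of that factor,
    hence of the integral. *)
Lemma Rintegral_mon_eq0 k th i : k i != 0 -> \int[mu]_x mon k th x = 0.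
Proof.
move=> ki0; pose t := L / (2 * (k i)%:~R).
have kR : (k i)%:~R != 0 :> R by rewrite intr_eq0.
have E : \int[mu]_x mon k th (x + t *: delta_mx 0 i) = \int[mu]_x mon k th x.
  exact: (Rintegral_torus_shift L0 i t) (measurable_mon k th) (mon_periodic k th).
have : \int[mu]_x mon k th (x + t *: delta_mx 0 i) = - \int[mu]_x mon k th x.
  rewrite -mulN1r -RintegralZl//; last exact: integrable1_mon.
  apply: eq_Rintegral => x _; rewrite mulN1r /mon.
  rewrite (bigD1 i)//= [in RHS](bigD1 i)//= -mulNr; congr (_ * _).
    rewrite !mxE !eqxx /= mulr1 mulrDr.
    rewrite (_ : 2 * pi * (k i)%:~R / L * t = pi); first by rewrite addrAC cosDpi.
    by rewrite /t; field; rewrite kR gt_eqF.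
  by apply: eq_bigr => j ji; rewrite !mxE eqxx (negbTE ji) mulr0 addr0.
by rewrite E => /eqP; rewrite -addr_eq0 -mulr2n mulrn_eq0 /= => /eqP.
Qed.

Lemma cos_prod (a b : R) : cos a * cos b = 2^-1 * (cos (a + b) + cos (a - b)).
Proof. by rewrite cosD cosB; field. Qed.

Lemma monM k th l ph x : mon k th x * mon l ph x =
  2^-1 ^+ d * \sum_(b : {ffun 'I_d -> bool})
    mon (fun i => if b i then k i + l i else k i - l i)
        (fun i => if b i then th i + ph i else th i - ph i) x.
Proof.
rewrite /mon -big_split /=.
under eq_bigr do rewrite cos_prod.
rewrite big_split /= prodr_const card_ord; congr (_ * _).
rewrite -(bigA_distr_bigA (fun i (b : bool) =>
  cos (2 * pi * (if b then k i + l i else k i - l i)%:~R / L * x 0 i +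
       if b then th i + ph i else th i - ph i))) /=.
apply: eq_bigr => i _; rewrite big_bool /= intrD intrB.
by congr (cos _ + cos _); field; rewrite gt_eqF.
Qed.

(** Averaging over one reflection uses [cos (t + c) + cos (- t + c) = 2 cos t cos c], so each phase
    comes out as a factor. *)
Lemma Rintegral_even_mon v k th : integrable1 L v -> Defs.periodic L v -> even_coords v ->
  \int[mu]_x (v x * mon k th x) =
  (\prod_i cos (th i)) * \int[mu]_x (v x * mon k (fun=> 0) x).
Proof.
move=> iv vL ve.
have mv := integrable1_measurable iv.
have ivm l ph : integrable1 L (fun x => v x * mon l ph x).
  exact: integrable1M iv (measurable_mon l ph) (mon_bounded l ph).
have step i ph : \int[mu]_x (v x * mon k ph x) =
    cos (ph i) * \int[mu]_x (v x * mon k (fun j => if j == i then 0 else ph j) x).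
  rewrite -RintegralZl//; last exact: ivm.
  have E : \int[mu]_x (v (reflect_coord i x) * mon k ph (reflect_coord i x)) =
           \int[mu]_x (v x * mon k ph x).
    apply: (Rintegral_torus_reflect i (f := fun x => v x * mon k ph x)).
      exact: measurable_funM mv (measurable_mon k ph).
    by move=> j x /=; rewrite vL mon_periodic.
  have D2 (a b : R) : a + a = 2 * b -> a = b by lra.
  apply: D2; rewrite -{1}E -RintegralD//; last first.
    + exact: ivm.
    + have := ivm (fun j => if j == i then - k j else k j) ph.
      apply: eq_integrable => // x _ /=; rewrite ve; congr (_ * _)%:E.
      rewrite /mon; apply: eq_bigr => j _; rewrite mxE; case: ifP => // _.
      by rewrite mulrNz !(mulrN, mulNr).
  rewrite -RintegralZl//; last exact/integrable1Z/ivm.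
  apply: eq_Rintegral => x _ /=; rewrite ve.
  transitivity (v x * (2 * cos (ph i) * mon k (fun j => if j == i then 0 else ph j) x));
    last by ring.
  rewrite -mulrDr; congr (_ * _); rewrite /mon (bigD1 i)//= [in X in _ + X](bigD1 i)//= [in RHS](bigD1 i)//=.
  rewrite eqxx addr0 mxE eqxx.
  rewrite (eq_bigr (fun j => cos (2 * pi * (k j)%:~R / L * x 0 j + ph j))); last first.
    by move=> j ji; rewrite mxE (negbTE ji).
  rewrite [in RHS](eq_bigr (fun j => cos (2 * pi * (k j)%:~R / L * x 0 j + ph j))); last first.
    by move=> j ji; rewrite (negbTE ji).
  rewrite -mulrDl mulrA; congr (_ * _).
  by rewrite mulrN !cosD cosN sinN; ring.
(* Phases are removed one coordinate at a time; [s] lists those already set to 0. *)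
have H (s : seq 'I_d) : uniq s -> \int[mu]_x (v x * mon k th x) =
    (\prod_(i <- s) cos (th i)) * \int[mu]_x (v x * mon k (fun i => if i \in s then 0 else th i) x).
  elim: s => [|i s IH]; first by rewrite big_nil mul1r.
  case/andP => si us; rewrite big_cons IH// (step i) (negbTE si) mulrCA mulrA; congr (_ * _).
  apply: eq_Rintegral => x _; congr (_ * mon _ _ _); apply/funext => j.
  by rewrite inE; case: (j == i).
rewrite (H (index_enum 'I_d)) ?index_enum_uniq//; congr (_ * _).
by apply: eq_Rintegral => x _; congr (_ * mon _ _ _); apply/funext => j; rewrite mem_index_enum.
Qed.

End monomials.

(** * The squared L^2 distance *)

Section square_integrable.
Context {R : realType} (L : R) {d : nat}.
Local Notation mu := (torus_measure L d).
Implicit Types (u v f g : 'rV[R]_d -> R).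

Definition sq_integrable u := measurable_fun setT u /\ integrable1 L (fun x => u x ^+ 2).

Lemma integrable1_le u v : measurable_fun setT u -> (forall x, `|u x| <= v x) ->
  integrable1 L v -> integrable1 L u.
Proof.
move=> mu_ uv iv; apply: le_integrable iv => //; first exact/measurable_EFinP.
move=> x _ /=; rewrite lee_fin; apply: le_trans (uv x) _; exact: ler_norm.
Qed.

Lemma sq_integrableM u v : sq_integrable u -> sq_integrable v ->
  integrable1 L (fun x => u x * v x).
Proof.
move=> [mu_ iu] [mv iv]; apply: (integrable1_le (v := fun x => u x ^+ 2 + v x ^+ 2)).
- exact: measurable_funM.
- move=> x; have := sqr_ge0 (u x - v x); have := sqr_ge0 (u x + v x).
  by move=> h1 h2; rewrite ler_norml; apply/andP; split; nra.
- exact: integrable1D.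
Qed.

Lemma sq_integrableD u v : sq_integrable u -> sq_integrable v ->
  sq_integrable (fun x => u x + v x).
Proof.
move=> su sv; have iuv := sq_integrableM su sv; case: su sv => [mu_ iu] [mv iv].
split; first exact: measurable_funD.
rewrite (_ : (fun _ => _) = (fun x => (u x ^+ 2 + 2 * (u x * v x)) + v x ^+ 2)).
  by apply: integrable1D => //; apply: integrable1D => //; exact: integrable1Z.
by apply/funext => x; ring.
Qed.

Lemma sq_integrableZ (c : R) u : sq_integrable u -> sq_integrable (fun x => c * u x).
Proof.
move=> [mu_ iu]; split; first by apply: measurable_funM => //; exact: measurable_cst.
rewrite (_ : (fun _ => _) = (fun x => c ^+ 2 * u x ^+ 2)); first exact: integrable1Z.
by apply/funext => x; ring.
Qed.

Lemma sq_integrableB u v : sq_integrable u -> sq_integrable v ->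
  sq_integrable (fun x => u x - v x).
Proof.
move=> su sv; rewrite (_ : (fun _ => _) = (fun x => u x + -1 * v x)).
  exact/sq_integrableD/sq_integrableZ.
by apply/funext => x; ring.
Qed.

Lemma sq_integrable_bounded u M : measurable_fun setT u -> bounded_by u M -> sq_integrable u.
Proof.
move=> mu_ uM; split=> //; apply: (@integrable1_bounded _ _ _ _ (M ^+ 2)).
  exact: measurable_funX.
by move=> x; rewrite normrX lerXn2r// ?nnegrE// (le_trans _ (uM x)).
Qed.

Lemma sq_integrable_sum (I : Type) (s : seq I) (F : I -> 'rV[R]_d -> R) :
  (forall i, sq_integrable (F i)) -> sq_integrable (fun x => \sum_(i <- s) F i x).
Proof.
move=> iF; elim: s => [|i s IH].
  rewrite (_ : (fun _ => _) = cst 0); last by apply/funext => x; rewrite big_nil.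
  by apply: (@sq_integrable_bounded _ 0) => [|x]; [exact: measurable_cst|rewrite normr0].
rewrite (_ : (fun _ => _) = (fun x => F i x + \sum_(i <- s) F i x)).
  exact: sq_integrableD.
by apply/funext => x; rewrite big_cons.
Qed.

Lemma sq_integrable1 u : sq_integrable u -> integrable1 L u.
Proof.
move=> su; rewrite (_ : u = fun x => u x * 1); last by apply/funext => x; rewrite mulr1.
apply: sq_integrableM su _; apply: (@sq_integrable_bounded (fun=> 1) 1) => [|x].
  exact: measurable_cst.
by rewrite normr1.
Qed.

(* The L^2 distance enters only through its square. *)
Definition sqdist u v := \int[mu]_x (u x - v x) ^+ 2.

Lemma sqdist_ge0 u v : 0 <= sqdist u v.
Proof. by apply: Rintegral_ge0 => x _; exact: sqr_ge0. Qed.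

Lemma sqdistD u u' v v' : sq_integrable u -> sq_integrable u' -> sq_integrable v -> sq_integrable v' ->
  sqdist (fun x => u x + v x) (fun x => u' x + v' x) <= 2 * sqdist u u' + 2 * sqdist v v'.
Proof.
move=> su su' sv sv'.
have [_ i1] := sq_integrableB su su'; have [_ i2] := sq_integrableB sv sv'.
have [_ i3] := sq_integrableB (sq_integrableD su sv) (sq_integrableD su' sv').
have j1 := integrable1Z 2 i1; have j2 := integrable1Z 2 i2.
rewrite /sqdist -RintegralZl// -RintegralZl// -RintegralD//; apply: le_Rintegral => //.
  exact: integrable1D.
move=> x _; have := sqr_ge0 (u x - u' x - (v x - v' x)); nra.
Qed.

Lemma sqdistZ (c : R) u v : sq_integrable u -> sq_integrable v ->
  sqdist (fun x => c * u x) (fun x => c * v x) = c ^+ 2 * sqdist u v.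
Proof.
move=> su sv; have [_ i1] := sq_integrableB su sv.
by rewrite /sqdist -RintegralZl//; apply: eq_Rintegral => x _; ring.
Qed.

Lemma sqdist_triangle u v w : sq_integrable u -> sq_integrable v -> sq_integrable w ->
  sqdist u w <= 2 * sqdist u v + 2 * sqdist v w.
Proof.
move=> su sv sw.
have [_ i1] := sq_integrableB su sv; have [_ i2] := sq_integrableB sv sw.
have [_ i3] := sq_integrableB su sw.
have j1 := integrable1Z 2 i1; have j2 := integrable1Z 2 i2.
rewrite /sqdist -RintegralZl// -RintegralZl// -RintegralD//; apply: le_Rintegral => //.
  exact: integrable1D.
move=> x _; have := sqr_ge0 (u x - v x - (v x - w x)); nra.
Qed.

(** Dominated convergence for [(f - F n) ^ 2], with majorant [2 f ^ 2 + 2 g ^ 2]. *)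
Lemma sqdist_dominated f (F : nat -> 'rV[R]_d -> R) g :
  sq_integrable f -> (forall n, measurable_fun setT (F n)) -> sq_integrable g ->
  (forall n x, `|F n x| <= g x) -> {ae mu, forall x, F n x @[n --> \oo] --> f x} ->
  forall e, 0 < e -> exists n, sqdist f (F n) <= e.
Proof.
move=> sf mF sg Fg cF e e0.
have [mf if2] := sf; have [mg ig2] := sg.
have mFf n : measurable_fun setT (EFin \o (fun x => (f x - F n x) ^+ 2)).
  by apply/measurable_EFinP; apply: measurable_funX; exact: measurable_funB.
have [||||_ _ cv] := @dominated_convergence _ _ R mu setT measurableT
  (fun n => EFin \o (fun x => (f x - F n x) ^+ 2)) (cst 0%E)
  (EFin \o (fun x => 2 * f x ^+ 2 + 2 * g x ^+ 2)) mFf.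
- exact: measurable_cst.
- apply: filterS cF => x cx _ /=.
  apply/cvg_EFin; first by near=> n.
  have h1 : (fun n => f x - F n x) @ \oo --> f x - f x.
    by apply: cvgB => //; exact: cvg_cst.
  rewrite (_ : fine \o _ = (fun n => (f x - F n x) * (f x - F n x))).
    by move: h1; rewrite subrr => h1; rewrite -[X in _ --> X](mulr0 0); exact: cvgM.
  by apply/funext => n /=; rewrite expr2.
- by apply: integrable1D; exact: integrable1Z.
- apply: aeW => x n _ /=; rewrite lee_fin ger0_norm ?sqr_ge0//.
  have := Fg n x; rewrite ler_norml => /andP[h1 h2].
  have h3 : F n x ^+ 2 <= g x ^+ 2 by nra.
  have := sqr_ge0 (f x + F n x); nra.
move: cv; rewrite integral0 => cv.
have /fine_cvgP[_ cv'] := cv.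
have /cvgrPdist_lt/(_ e e0) [N _ HN] := cv'.
exists N; have := HN N (leqnn N); rewrite /= sub0r normrN => h.
by apply: le_trans (ler_norm _) (ltW _).
Unshelve. all: by end_near.
Qed.

End square_integrable.

(** * Density of trigonometric polynomials *)

Section trigonometric_polynomials.
Context {R : realType} (L : R) (L0 : 0 < L) {d : nat}.
Local Notation mu := (torus_measure L d).
Implicit Types (u v f g Q : 'rV[R]_d -> R).

Definition trig Q := exists (I : finType) (c : I -> R) (k : I -> 'I_d -> int)
  (th : I -> 'I_d -> R), Q = fun x => \sum_j c j * mon L (k j) (th j) x.

Lemma trig_mon k th : trig (mon L k th).
Proof.
exists 'I_1, (fun=> 1), (fun=> k), (fun=> th); apply/funext => x.
by rewrite big_ord1 mul1r.
Qed.

Lemma trig_cst c : trig (cst c).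
Proof.
exists 'I_1, (fun=> c), (fun=> fun=> 0), (fun=> fun=> 0); apply/funext => x.
rewrite big_ord1 /mon big1 ?mulr1// => i _.
by rewrite mulr0z mulr0 mul0r mul0r addr0 cos0.
Qed.

Lemma trigD Q1 Q2 : trig Q1 -> trig Q2 -> trig (fun x => Q1 x + Q2 x).
Proof.
move=> [I [c [k [th ->]]]] [J [c' [k' [th' ->]]]].
exists (I + J)%type, (fun s => match s with inl i => c i | inr j => c' j end),
  (fun s => match s with inl i => k i | inr j => k' j end),
  (fun s => match s with inl i => th i | inr j => th' j end).
by apply/funext => x; rewrite big_sumType.
Qed.

Lemma trigZ (a : R) Q : trig Q -> trig (fun x => a * Q x).
Proof.
move=> [I [c [k [th ->]]]]; exists I, (fun i => a * c i), k, th.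
by apply/funext => x; rewrite mulr_sumr; apply: eq_bigr => i _; rewrite mulrA.
Qed.

Lemma trig_sum (I : Type) (s : seq I) (F : I -> 'rV[R]_d -> R) :
  (forall i, trig (F i)) -> trig (fun x => \sum_(i <- s) F i x).
Proof.
move=> tF; elim: s => [|i s IH].
  by rewrite (_ : (fun _ => _) = cst 0); [exact: trig_cst|apply/funext => x; rewrite big_nil].
rewrite (_ : (fun _ => _) = (fun x => F i x + \sum_(i <- s) F i x)); first exact: trigD.
by apply/funext => x; rewrite big_cons.
Qed.

Lemma trigM Q1 Q2 : trig Q1 -> trig Q2 -> trig (fun x => Q1 x * Q2 x).
Proof.
move=> [I [c [k [th ->]]]] [J [c' [k' [th' ->]]]].
rewrite (_ : (fun _ => _) = (fun x => \sum_i \sum_j (c i * c' j) *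
    (mon L (k i) (th i) x * mon L (k' j) (th' j) x))).
  apply: trig_sum => i; apply: trig_sum => j; apply: trigZ.
  rewrite (_ : (fun _ => _) = (fun x => 2^-1 ^+ d * \sum_(b : {ffun 'I_d -> bool})
    mon L (fun l => if b l then k i l + k' j l else k i l - k' j l)
        (fun l => if b l then th i l + th' j l else th i l - th' j l) x)).
    by apply: trigZ; apply: trig_sum => b; exact: trig_mon.
  by apply/funext => x; rewrite monM.
apply/funext => x; rewrite mulr_suml; apply: eq_bigr => i _.
by rewrite mulr_sumr; apply: eq_bigr => j _; ring.
Qed.

Lemma trigX Q n : trig Q -> trig (fun x => Q x ^+ n).
Proof.
move=> tQ; elim: n => [|n IH]; first exact: (trig_cst 1).
rewrite (_ : (fun _ => _) = (fun x => Q x * Q x ^+ n)); first exact: trigM.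
by apply/funext => x; rewrite exprS.
Qed.

Lemma trig_measurable Q : trig Q -> measurable_fun setT Q.
Proof.
move=> [I [c [k [th ->]]]]; apply: measurable_sum => i.
by apply: measurable_funM; [exact: measurable_cst|exact: measurable_mon].
Qed.

Lemma trig_sq_integrable Q : trig Q -> sq_integrable L Q.
Proof.
move=> [I [c [k [th ->]]]]; apply: sq_integrable_sum => i; apply: sq_integrableZ.
exact: sq_integrable_bounded (measurable_mon L (k i) (th i)) (mon_bounded L (k i) (th i)).
Qed.

(* For i-th coordinates in the cell, [1/2 - (cos (nu (t - b/2)) - cos (nu b/2))/4]
   lies below [1/2] exactly when [t < b]. *)
Definition halfline_trig (b t : R) : R :=
  2^-1 - (cos (2 * pi / L * t - pi * b / L) - cos (pi * b / L)) / 4.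

Lemma halfline_trig_itv b t : 0 <= halfline_trig b t <= 1.
Proof.
rewrite /halfline_trig.
have := cos_max (2 * pi / L * t - pi * b / L); have := cos_max (pi * b / L).
by rewrite !ler_norml => /andP[? ?] /andP[? ?]; apply/andP; split; lra.
Qed.

(** The product form shows the sign: on the open cell [pi t / L] lies in []0, pi[] and
    [pi (b - t) / L] in []-pi, pi[], so only [b - t] decides. *)
Lemma halfline_trigE b t :
  halfline_trig b t = 2^-1 - sin (pi * (t / L)) * sin (pi * ((b - t) / L)) / 2.
Proof.
rewrite /halfline_trig.
have -> : 2 * pi / L * t - pi * b / L = pi * (t / L) - pi * ((b - t) / L).
  by field; rewrite gt_eqF.
have -> : cos (pi * b / L) = cos (pi * (t / L) + pi * ((b - t) / L)).
  by congr cos; field; rewrite gt_eqF.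
by rewrite cosB cosD; field.
Qed.

Lemma sin_pi_gt0 (s : R) : 0 < s < 1 -> 0 < sin (pi * s).
Proof.
move=> /andP[s0 s1]; apply: sin_gt0_pi; rewrite mulr_gt0 ?pi_gt0//=.
by rewrite gtr_pMr ?pi_gt0.
Qed.

Lemma halfline_trig_lt b t : 0 < b < L -> 0 < t < L -> t < b -> halfline_trig b t < 2^-1.
Proof.
move=> /andP[b0 bL] /andP[t0 tL] tb; rewrite halfline_trigE.
have s1 : 0 < sin (pi * (t / L)).
  by apply: sin_pi_gt0; rewrite divr_gt0//= ltr_pdivrMr// mul1r.
have s2 : 0 < sin (pi * ((b - t) / L)).
  by apply: sin_pi_gt0; rewrite divr_gt0 ?subr_gt0//= ltr_pdivrMr// mul1r; lra.
have := mulr_gt0 s1 s2; lra.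
Qed.

Lemma halfline_trig_gt b t : 0 < b < L -> 0 < t < L -> b < t -> 2^-1 < halfline_trig b t.
Proof.
move=> /andP[b0 bL] /andP[t0 tL] tb; rewrite halfline_trigE.
have s1 : 0 < sin (pi * (t / L)).
  by apply: sin_pi_gt0; rewrite divr_gt0//= ltr_pdivrMr// mul1r.
have s2 : 0 < sin (pi * ((t - b) / L)).
  by apply: sin_pi_gt0; rewrite divr_gt0 ?subr_gt0//= ltr_pdivrMr// mul1r; lra.
have -> : pi * ((b - t) / L) = - (pi * ((t - b) / L)) by field; rewrite gt_eqF.
rewrite sinN; have := mulr_gt0 s1 s2; lra.
Qed.

(** The polynomials of the Brosowski-Deutsch proof of the Stone-Weierstrass theorem: on [[0, 1]]
    they tend to 1 below the level [1/2] and to 0 above it. Composed with [halfline_trig] they give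
    trigonometric polynomials approaching an indicator. *)
Definition sharpen n (p : R) : R := (1 - p ^+ n) ^+ (2 ^ n).

Lemma sharpen_itv n p : 0 <= p <= 1 -> 0 <= sharpen n p <= 1.
Proof.
move=> /andP[p0 p1]; rewrite /sharpen.
have h0 : 0 <= 1 - p ^+ n by rewrite subr_ge0 exprn_ile1.
by rewrite exprn_ge0//= exprn_ile1// gerBl exprn_ge0.
Qed.

Lemma bernoulli_ineq (x : R) n : -1 <= x -> 1 + x *+ n <= (1 + x) ^+ n.
Proof.
move=> x1; elim: n => [|n IH]; first by rewrite mulr0n addr0 expr0.
rewrite exprS; apply: le_trans (_ : (1 + x) * (1 + x *+ n) <= _); last first.
  by rewrite ler_wpM2l//; lra.
rewrite -mulr_natr -(mulr_natr x n) mulrS.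
have : 0 <= n%:R :> R by [].
have := sqr_ge0 x; nra.
Qed.

(** Bernoulli bounds the value below by [1 - 2 ^ n p ^ n = 1 - (2 p) ^ n]. *)
Lemma sharpen_cvg1 p : 0 <= p -> p < 2^-1 -> sharpen n p @[n --> \oo] --> (1 : R).
Proof.
move=> p0 p2.
have c0 : (1 - (2 * p) ^+ n) @[n --> \oo] --> (1 : R).
  rewrite -[X in _ --> X]subr0; apply: cvgB; first exact: cvg_cst.
  by apply: cvg_expr; rewrite ger0_norm; lra.
apply: (@squeeze_cvgr _ _ _ _ (fun n => 1 - (2 * p) ^+ n) (fun=> 1)) => //; last exact: cvg_cst.
near=> n.
have pn : 0 <= p ^+ n <= 1 by rewrite exprn_ge0//= exprn_ile1//; lra.
have /andP[_ ->] := @sharpen_itv n p (ltac:(apply/andP; split; lra)).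
rewrite andbT /sharpen.
have := @bernoulli_ineq (- p ^+ n) (2 ^ n)%N (ltac:(case/andP: pn => ? ?; lra)).
apply: le_trans; rewrite exprMn -(mulr_natl _ (2 ^ n)) natrX; lra.
Unshelve. all: by end_near.
Qed.

(** With [q = p ^ n] and [N = 2 ^ n], the inequality [(1 - q) (1 + q) <= 1] bounds the value by the
    inverse of [(1 + q) ^ N], and Bernoulli gives [(1 + q) ^ N >= N q = (2 p) ^ n]. *)
Lemma sharpen_cvg0 p : 2^-1 < p -> p <= 1 -> sharpen n p @[n --> \oo] --> (0 : R).
Proof.
move=> p2 p1.
have q1 : `|(2 * p)^-1| < 1.
  by rewrite ger0_norm ?invr_ge0 ?invf_lt1; lra.
apply: (@squeeze_cvgr _ _ _ _ (fun=> 0) (fun n => (2 * p)^-1 ^+ n)) => //;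
  [|exact: cvg_cst|exact: cvg_expr].
near=> n.
have pn : 0 <= p ^+ n <= 1 by rewrite exprn_ge0 ?exprn_ile1//; lra.
case/andP: pn => pn0 pn1.
have /andP[-> _] := @sharpen_itv n p (ltac:(apply/andP; split; lra)); rewrite /= /sharpen.
have b := @bernoulli_ineq (p ^+ n) (2 ^ n)%N (ltac:(lra)).
have t0 : 0 < (2 * p) ^+ n by apply: exprn_gt0; lra.
have b' : (2 * p) ^+ n <= (1 + p ^+ n) ^+ (2 ^ n).
  by apply: le_trans b; rewrite exprMn -(mulr_natl _ (2 ^ n)) natrX; lra.
have b0 := lt_le_trans t0 b'.
apply: le_trans (_ : (1 + p ^+ n) ^- (2 ^ n) <= _); last by rewrite exprVn lef_pV2 ?posrE.
rewrite -[leRHS]mul1r ler_pdivlMr// -exprMn; apply: exprn_ile1; nra.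
Unshelve. all: by end_near.
Qed.

End trigonometric_polynomials.

Section trigonometric_density.
Context {R : realType} (L : R) (L0 : 0 < L) {d : nat}.
Local Notation mu := (torus_measure L d).
Implicit Types (u v f g Q : 'rV[R]_d -> R) (A : set 'rV[R]_d).

Lemma ae_coord_notin (i : 'I_d) (N : set R) : measurable N ->
  (@lebesgue_measure R (N `&` `[0%R, L[%classic) = 0)%E -> {ae mu, forall x : 'rV[R]_d, ~ N (x 0%R i)}.
Proof.
move=> mN N0.
pose NN := (fun x : 'rV[R]_d => x 0 i) @^-1` N.
have mNN : measurable NN by rewrite -[NN]setTI; exact: measurable_coord.
exists NN; split=> //; last by move=> x /= /contrapT.
have mg : measurable_fun setT (fun t : R => (\1_N t : R)%:E).
  by apply/measurable_EFinP; exact: measurable_indic.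
have g0 : (\int[period_measure L]_t (\1_N t : R)%:E = 0)%E.
  rewrite (integral_indic (period_measure L) measurableT)// setIT.
  by rewrite /period_measure /= /mfrestr /mrestr.
have := ge0_integral_coord_eq0 i mg (fun t => ltac:(by rewrite lee_fin)) g0.
by rewrite (_ : (fun x => _) = (fun x => (\1_NN x : R)%:E))// integral_indic// setIT.
Qed.

(** Trigonometric polynomials form an algebra, so these sets form a pi-system; the bound 1 survives
    products and serves as majorant for dominated convergence. *)
Definition trig_limit A := measurable A /\ exists q : nat -> 'rV[R]_d -> R,
  [/\ forall n, trig L (q n), forall n x, `|q n x| <= 1 &
      {ae mu, forall x, q n x @[n --> \oo] --> (\1_A x : R)}].

Lemma trig_limitI : setI_closed trig_limit.
Proof.
move=> A B [mA [q [tq q1 qA]]] [mB [r [tr r1 rB]]]; split; first exact: measurableI.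
exists (fun n x => q n x * r n x); split=> [n|n x|].
- exact: trigM.
- by rewrite normrM mulr_ile1.
- apply: filterS2 qA rB => x qx rx; rewrite indicI; exact: cvgM.
Qed.

(** Convergence can fail only off the cell and on the hyperplanes where the coordinate is 0 or [b],
    all null. For [b] outside []0, L[] the half-space is almost everywhere empty or full. *)
Lemma trig_limit_lt (i : 'I_d) b : trig_limit [set x | x 0 i < b].
Proof.
have mA (c : R) : measurable [set x : 'rV[R]_d | x 0 i < c].
  rewrite (_ : [set x : 'rV[R]_d | _] = (fun x : 'rV[R]_d => x 0 i) @^-1` `]-oo, c[%classic).
    by rewrite -[X in measurable X]setTI; exact: measurable_coord.
  by apply/seteqP; split => x /=; rewrite in_itv.
have cell : {ae mu, forall x : 'rV[R]_d, ~ (~` `[0, L[%classic) (x 0 i)}.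
  by apply: ae_coord_notin; [exact: measurableC|rewrite setICl measure0].
have point c : {ae mu, forall x : 'rV[R]_d, ~ [set c] (x 0 i)}.
  apply: ae_coord_notin => //; apply/eqP; rewrite eq_le measure_ge0 andbT.
  apply: le_trans (_ : @lebesgue_measure R [set c] <= _)%E; last by rewrite lebesgue_measure_set1.
  by apply: le_measure; rewrite ?inE//; exact: measurableI.
split; first exact: mA.
have [b0|b0] := leP b 0.
  exists (fun=> cst 0); split=> [n|n x|]; [exact: trig_cst|by rewrite normr0|].
  apply: filterS cell => x /contrapT /=; rewrite in_itv/= => /andP[x0 _].
  rewrite indicE memNset/=; first exact: cvg_cst.
  by apply/negP; rewrite -leNgt (le_trans b0).
have [bL|bL] := leP L b.
  exists (fun=> cst 1); split=> [n|n x|]; [exact: trig_cst|by rewrite normr1|].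
  apply: filterS cell => x /contrapT /=; rewrite in_itv/= => /andP[_ xL].
  rewrite indicE mem_set/=; first exact: cvg_cst.
  exact: lt_le_trans bL.
exists (fun n x => sharpen n (halfline_trig L b (x 0 i))); split=> [n|n x|].
- rewrite /sharpen; apply: trigX => //.
  rewrite (_ : (fun _ => _) = (fun x : 'rV[R]_d => 1 + -1 * halfline_trig L b (x 0 i) ^+ n)); last first.
    by apply/funext => x; rewrite mulN1r.
  apply: trigD; first exact: trig_cst.
  apply: trigZ; apply: trigX => //; rewrite /halfline_trig.
  rewrite (_ : (fun _ => _) = (fun x : 'rV[R]_d => (2^-1 + cos (pi * b / L) / 4) +
    (- 4^-1) * mon L (fun j => if j == i then 1 else 0) (fun j => if j == i then - (pi * b / L) else 0) x)).
    by apply: trigD; [exact: trig_cst|apply: trigZ; exact: trig_mon].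
  apply/funext => x; rewrite /mon (bigD1 i)//= eqxx big1 ?mulr1; last first.
    by move=> j ji; rewrite (negbTE ji) mulr0z mulr0 !mul0r addr0 cos0.
  by field.
- by have /andP[h1 h2] := sharpen_itv n (halfline_trig_itv L b (x 0 i)); rewrite ger0_norm.
- apply: filterS3 cell (point 0) (point b) => x /contrapT /=; rewrite in_itv/= => /andP[x0 xL] xn0 xnb.
  have {}x0 : 0 < x 0 i by rewrite lt_neqAle x0 andbT eq_sym; apply/eqP.
  have /andP[h0 h1] := halfline_trig_itv L b (x 0 i).
  have [xb|bx|//] := ltgtP (x 0 i) b.
  + rewrite indicE mem_set//=; apply: sharpen_cvg1 => //.
    by apply: halfline_trig_lt => //; apply/andP.
  + rewrite indicE memNset/=; last by apply/negP; rewrite -leNgt ltW.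
    by apply: sharpen_cvg0 => //; apply: halfline_trig_gt => //; apply/andP.
Qed.

Definition trig_dense f := sq_integrable L f /\
  forall e, 0 < e -> exists Q, trig L Q /\ sqdist L f Q <= e.

Lemma trig_denseD f g : trig_dense f -> trig_dense g -> trig_dense (fun x => f x + g x).
Proof.
move=> [sf df] [sg dg]; split=> [|e e0]; first exact: sq_integrableD.
have [P [tP hP]] := df (e / 4) (ltac:(lra)); have [Q [tQ hQ]] := dg (e / 4) (ltac:(lra)).
exists (fun x => P x + Q x); split; first exact: trigD.
have := sqdistD sf (trig_sq_integrable tP) sg (trig_sq_integrable tQ); lra.
Qed.

Lemma trig_denseZ c f : trig_dense f -> trig_dense (fun x => c * f x).
Proof.
move=> [sf df]; split=> [|e e0]; first exact: sq_integrableZ.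
have c0 : 0 < c ^+ 2 + 1 by rewrite ltr_wpDl ?sqr_ge0.
have [P [tP hP]] := df (e / (c ^+ 2 + 1)) (divr_gt0 e0 c0).
exists (fun x => c * P x); split; first exact: trigZ.
rewrite sqdistZ//; last exact: trig_sq_integrable.
move: hP; rewrite ler_pdivlMr//; have := sqdist_ge0 L f P; nra.
Qed.

Lemma trig_dense_cst c : trig_dense (cst c).
Proof.
split=> [|e e0]; first exact/trig_sq_integrable/trig_cst.
exists (cst c); split; first exact: trig_cst.
rewrite /sqdist; under eq_Rintegral do rewrite subrr expr0n.
by rewrite Rintegral_cst// mul0r ltW.
Qed.

Lemma trig_dense_limit f : sq_integrable L f ->
  (forall e, 0 < e -> exists g, trig_dense g /\ sqdist L f g <= e) -> trig_dense f.
Proof.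
move=> sf H; split=> // e e0.
have [g [[sg dg] fg]] := H (e / 4) (ltac:(lra)).
have [Q [tQ hQ]] := dg (e / 4) (ltac:(lra)).
exists Q; split=> //.
have := sqdist_triangle sf sg (trig_sq_integrable tQ); lra.
Qed.

Lemma sq_integrable_indic A : measurable A -> sq_integrable L (\1_A : 'rV[R]_d -> R).
Proof.
move=> mA; apply: (@sq_integrable_bounded _ _ _ _ 1); first exact: measurable_indic.
by move=> x; rewrite indicE; case: (_ \in _); rewrite ?normr0 ?normr1.
Qed.

Lemma trig_limit_dense A : trig_limit A -> trig_dense (\1_A : 'rV[R]_d -> R).
Proof.
move=> [mA [q [tq q1 qA]]]; apply: trig_dense_limit; first exact: sq_integrable_indic.
move=> e e0.
have [|n hn] := @sqdist_dominated _ L d (\1_A) q (cst 1) (sq_integrable_indic mA)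
  (fun n => trig_measurable (tq n)) _ q1 qA e e0.
  exact/trig_sq_integrable/trig_cst.
exists (q n); split=> //; split=> [|e' e'0]; first exact: trig_sq_integrable.
exists (q n); split=> //; rewrite /sqdist; under eq_Rintegral do rewrite subrr expr0n.
by rewrite Rintegral_cst// mul0r ltW.
Qed.

(** Dynkin's pi-lambda theorem: the sets with approximable indicator form a lambda-system containing
    the pi-system [trig_limit], and half-spaces already generate the sigma-algebra of the
    coordinates. *)
Lemma trig_dense_indic A : measurable A -> trig_dense (\1_A : 'rV[R]_d -> R).
Proof.
pose H := [set B | measurable B /\ trig_dense (\1_B : 'rV[R]_d -> R)].
have dH : dynkin H.
  split.
  - by split=> //; rewrite indicT; exact: trig_dense_cst.
  - move=> B [mB dB]; split; first exact: measurableC.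
    rewrite (_ : \1_(~` B) = (fun x => cst 1 x + -1 * \1_B x)).
      by apply: trig_denseD; [exact: trig_dense_cst|exact: trig_denseZ].
    apply/funext => x; rewrite indicC /= mulN1r indicE.
    by case: (x \in B); rewrite /= ?subrr ?subr0.
  - move=> F tF HF; have mF n : measurable (F n) by have [] := HF n.
    have mU : measurable (\bigcup_n F n) by exact: bigcupT_measurable.
    split=> //; apply: trig_dense_limit; first exact: sq_integrable_indic.
    move=> e e0.
    (* By disjointness the partial sums are indicators of finite unions: bounded by 1 and eventually
       constant at each point. *)
    pose G n : 'rV[R]_d -> R := fun x => \sum_(i < n) \1_(F i) x.
    have GE n x : G n x = \1_(\big[setU/set0]_(i < n) F i) x.
      rewrite /G; elim: n => [|n IH]; first by rewrite !big_ord0 indic0.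
      rewrite !big_ord_recr /= IH !indicE in_setU.
      case: (boolP (x \in F n)) => xF; last by rewrite addr0 orbF.
      rewrite orbT memNset ?add0r// -bigcup_mkord => -[j /= jn Fj].
      move/trivIsetP : tF => /(_ j n I I); rewrite ltn_eqF// => /(_ isT) /seteqP[/(_ x) h _].
      by apply: h; split => //; exact: set_mem.
    have [||||n hn] := @sqdist_dominated _ L d (\1_(\bigcup_n F n)) G (cst 1)
       (sq_integrable_indic mU) _ _ _ _ e e0.
    + by move=> n; apply: measurable_sum => i; exact: measurable_indic.
    + exact/trig_sq_integrable/trig_cst.
    + by move=> n x; rewrite GE indicE; case: (_ \in _); rewrite /= ?normr0 ?normr1.
    + apply: aeW => x; rewrite indicE; case: (boolP (x \in _)) => [/set_mem[m _ Fm]|xF].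
        apply: cvg_near_cst; exists m.+1 => // n /= mn; rewrite GE indicE mem_set//.
        by rewrite -bigcup_mkord; exists m.
      apply: cvg_near_cst; exists 0%N => // n _; rewrite GE indicE memNset//.
      rewrite -bigcup_mkord => -[m _ Fm]; move/negP: xF; apply; rewrite inE; by exists m.
    exists (G n); split=> //; rewrite /G.
    elim: n {hn} => [|n IH].
      rewrite (_ : (fun _ => _) = cst 0); first exact: trig_dense_cst.
      by apply/funext => x; rewrite big_ord0.
    rewrite (_ : (fun _ => _) = (fun x => (\sum_(i < n) \1_(F i) x) + \1_(F n) x)).
      by apply: trig_denseD => //; have [] := HF n.
    by apply/funext => x; rewrite big_ord_recr.
have GH : trig_limit `<=` H.
  by move=> B tB; split; [case: tB|exact: trig_limit_dense].
suff sub : (@measurable _ 'rV[R]_d) `<=` <<s trig_limit >>.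
  move=> mA; have := sub A mA; rewrite -(setI_closed_g_dynkin_g_sigma_algebra trig_limitI).
  by move=> /(_ H) []//.
have sT : sigma_algebra setT <<s trig_limit >> by exact: smallest_sigma_algebra.
apply: smallest_sub => //.
rewrite -bigcup_seq; apply: bigcup_sub => i _ _ [B mB <-]; rewrite setTI.
have : (@ocitv R).-sigma.-measurable B by [].
rewrite RGenInftyO.measurableE; move: B {mB}; apply: smallest_sub.
  case: sT => s0 sD sU; split => [|B|F FH] /=.
  - by rewrite preimage_set0.
  - by rewrite setTD preimage_setC -setTD; exact: sD.
  - by rewrite preimage_bigcup; exact: sU.
move=> _ [b ->] /=; apply: sub_sigma_algebra.
rewrite [X in trig_limit X](_ : _ = [set x : 'rV[R]_d | x 0 i < b]); first exact: trig_limit_lt.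
by apply/seteqP; split => x /=; rewrite in_itv.
Qed.

Import HBNNSimple.

Lemma trig_dense_ge0 f : (forall x, 0 <= f x) -> sq_integrable L f -> trig_dense f.
Proof.
move=> f0 sf; have [mf _] := sf.
have mEf : measurable_fun setT (EFin \o f) by exact/measurable_EFinP.
pose g := nnsfun_approx measurableT mEf.
apply: trig_dense_limit => // e e0.
have cg x : g n x @[n --> \oo] --> f x.
  have := @cvg_nnsfun_approx _ _ _ _ measurableT _ mEf (fun y _ => f0 y) x I.
  by move=> /fine_cvgP[].
have gf n x : g n x <= f x.
  rewrite -(cvg_lim _ (cg x))//; apply: nondecreasing_cvgn_le.
    by move=> a b ab; exact/lefP/nd_nnsfun_approx.
  by apply/cvg_ex; exists (f x); exact: cg.
have [||n hn] := @sqdist_dominated _ L d f (fun n => g n) f sf (fun n => measurable_funPT (g n)) sf _ _ e e0.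
- by move=> n x; rewrite ger0_norm.
- by apply: aeW => x; exact: cg.
exists (g n); split => //.
rewrite (_ : (g n : _ -> R) = (fun x => \sum_(r <- finmap.enum_fset (fset_set (range (g n)))) r * \1_(g n @^-1` [set r]) x)).
  elim: (finmap.enum_fset _) => [|r s IH].
    by rewrite (_ : (fun _ => _) = cst 0); [exact: trig_dense_cst|apply/funext => x; rewrite big_nil].
  rewrite (_ : (fun _ => _) = (fun x => r * \1_(g n @^-1` [set r]) x + \sum_(r <- s) r * \1_(g n @^-1` [set r]) x)).
    by apply: trig_denseD => //; apply: trig_denseZ; exact: trig_dense_indic.
  by apply/funext => x; rewrite big_cons.
by apply/funext => x; rewrite fimfunE fsbig_finite.
Qed.

Lemma trig_dense_sq_integrable f : sq_integrable L f -> trig_dense f.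
Proof.
move=> sf; have [mf if2] := sf.
have H (g : 'rV[R]_d -> R) : measurable_fun setT g -> (forall x, 0 <= g x <= `|f x|) -> trig_dense g.
  move=> mg gf; apply: trig_dense_ge0; first by move=> x; have /andP[] := gf x.
  split=> //; apply: (integrable1_le (v := fun x => f x ^+ 2)) => //.
    exact: measurable_funX.
  move=> x; have /andP[g0 gx] := gf x; rewrite ger0_norm ?exprn_ge0//.
  by rewrite -[leRHS](@real_normK _ (f x)) ?num_real// lerXn2r// nnegrE.
rewrite (_ : f = (fun x => Num.max (f x) 0 + -1 * Num.max (- f x) 0)).
  apply: trig_denseD; [apply: H|apply: trig_denseZ; apply: H].
  - by apply: measurable_maxr => //; exact: measurable_cst.
  - by move=> x; rewrite le_max lexx orbT/= ge_max ler_norm normr_ge0.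
  - apply: measurable_maxr; last exact: measurable_cst.
    exact: measurable_funN.
  - by move=> x; rewrite le_max lexx orbT/= ge_max lerNl -lerNl -normrN ler_norm normr_ge0.
apply/funext => x; rewrite !maxEle oppr_le0.
by case: (lerP (f x) 0); case: (lerP 0 (f x)); lra.
Qed.

End trigonometric_density.

(** * Cosine modes and convolutions *)

Section cosine_modes.
Context {R : realType} (L : R) (L0 : 0 < L) {d : nat}.
Local Notation mu := (torus_measure L d).
Implicit Types (u v w Q : 'rV[R]_d -> R) (k l : {ffun 'I_d -> nat}) (x y : 'rV[R]_d).

(** Left unnormalised, so that 1 is a uniform bound; [omega] is a positive multiple of it
    ([omega_chi]). *)
Definition chi k : 'rV[R]_d -> R := mon L (fun i => (k i)%:Z) (fun=> 0).

Definition mode u k : R := \int[mu]_x (u x * chi k x).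

Definition chi_sqnorm k : R := mode (chi k) k.

Lemma chi_bounded k : bounded_by (chi k) 1.
Proof. exact: mon_bounded. Qed.

Lemma measurable_chi k : measurable_fun setT (chi k).
Proof. exact: measurable_mon. Qed.

Lemma chi_periodic k : Defs.periodic L (chi k).
Proof. exact: mon_periodic. Qed.

Lemma chi_even k : even_coords (chi k).
Proof.
move=> i x; rewrite /chi /mon; apply: eq_bigr => j _; rewrite mxE !addr0.
by case: ifP => // _; rewrite mulrN cosN.
Qed.

Lemma chi_sq_integrable k : sq_integrable L (chi k).
Proof. exact: sq_integrable_bounded (measurable_chi k) (chi_bounded k). Qed.

(** At a coordinate where the indices differ, both their difference and their sum are nonzero, being
    natural numbers; every term of the product expansion then integrates to 0. *)
Lemma chi_ortho k l : k != l -> mode (chi k) l = 0.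
Proof.
move=> kl; rewrite /mode; under eq_Rintegral do rewrite /chi monM//.
rewrite RintegralZl//; last by apply: integrable1_sum => b; exact: integrable1_mon.
rewrite Rintegral_sum1; last by move=> b; exact: integrable1_mon.
rewrite big1 ?mulr0// => b _.
have [i ki] : exists i, k i != l i.
  by apply/existsP; apply: contraNT kl => /existsPn H; apply/eqP/ffunP => i; apply/eqP/negPn.
apply: (@Rintegral_mon_eq0 _ _ L0 _ _ _ i).
case: (b i); last by rewrite subr_eq0 eqz_nat.
rewrite -PoszD; apply: contraNneq ki => -[/eqP]; rewrite addn_eq0 => /andP[/eqP-> /eqP->].
by [].
Qed.

Lemma Rintegral_torus_cst (c : R) : \int[mu]_x c = c * L ^+ d.
Proof. by rewrite Rintegral_cst//; congr (_ * _); exact: (congr1 fine (torus_measureT L0 d)). Qed.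

(** Each term in the expansion of the square integrates to 0 or to the volume, and the term made of
    differences only has frequency 0. *)
Lemma chi_sqnorm_gt0 k : 0 < chi_sqnorm k.
Proof.
rewrite /chi_sqnorm /mode; under eq_Rintegral do rewrite /chi monM//.
rewrite RintegralZl//; last by apply: integrable1_sum => b; exact: integrable1_mon.
rewrite Rintegral_sum1; last by move=> b; exact: integrable1_mon.
rewrite mulr_gt0 ?exprn_gt0 ?invr_gt0// (bigD1 [ffun=> false])//=.
have vol (m : 'I_d -> int) : (forall i, m i = 0) -> \int[mu]_x mon L m (fun=> 0 - 0) x = L ^+ d.
  move=> m0; have E x : mon L m (fun=> 0 - 0) x = 1.
    by rewrite /mon big1// => i _; rewrite m0 mulr0z mulr0 !mul0r add0r subrr cos0.
  under eq_Rintegral do rewrite E.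
  by rewrite Rintegral_torus_cst// mul1r.
apply: ltr_wpDr.
  apply: sumr_ge0 => b _.
  have -> : (fun i => if b i then 0 + 0 else 0 - 0 : R) = (fun=> 0 - 0).
    by apply/funext => i; case: (b i); rewrite subr0 ?addr0.
  have [m0|] := pselect (forall i, (if b i then (k i)%:Z + (k i)%:Z else (k i)%:Z - (k i)%:Z) = 0).
    by rewrite vol// exprn_ge0// ltW.
  by move/existsNP => [i /eqP mi]; rewrite (@Rintegral_mon_eq0 _ _ L0 _ _ _ i).
have -> : (fun i => if [ffun=> false] i then 0 + 0 else 0 - 0 : R) = (fun i : 'I_d => 0 - 0).
  by apply/funext => i; rewrite ffunE.
by rewrite vol ?exprn_gt0// => i; rewrite ffunE subrr.
Qed.

(* Only evenness of [u] is used: averaging over the reflections turns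
   [cos (a (x - y))] into [cos (a x) cos (a y)]. *)
Lemma chi_conv u k x : integrable1 L u -> Defs.periodic L u -> even_coords u ->
  \int[mu]_y (u y * chi k (x - y)) = chi k x * mode u k.
Proof.
move=> iu uL ue.
have E y : chi k (x - y) = mon L (fun i => (k i)%:Z) (fun i => - (2 * pi * (k i)%:R / L * x 0 i)) y.
  rewrite /chi /mon; apply: eq_bigr => i _; rewrite !mxE addr0 mulrBr -cosN opprB.
  by [].
under eq_Rintegral do rewrite E.
rewrite Rintegral_even_mon//; congr (_ * _).
by rewrite /chi /mon; apply: eq_bigr => i _; rewrite cosN addr0.
Qed.

(** Even periodic functions see a trigonometric polynomial only through the cosine modes indexed by
    the absolute values of its frequencies. This converts density into a finite list of Fourier
    modes. *)
Lemma trig_test Q : trig L Q -> exists S : seq {ffun 'I_d -> nat},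
  forall v, sq_integrable L v -> Defs.periodic L v -> even_coords v ->
    (forall k, k \in S -> mode v k = 0) -> \int[mu]_x (v x * Q x) = 0.
Proof.
move=> [I [c [k [th ->]]]].
exists [seq [ffun i => `|k j i|%N] | j <- enum I] => v sv vL ve vS.
have iv := sq_integrable1 sv.
have ivm j : integrable1 L (fun x => c j * (v x * mon L (k j) (th j) x)).
  by apply/integrable1Z/(integrable1M iv (measurable_mon L (k j) (th j)) (mon_bounded L (k j) (th j))).
under eq_Rintegral do rewrite mulr_sumr; rewrite /=.
transitivity (\int[mu]_x (\sum_(j <- index_enum I) c j * (v x * mon L (k j) (th j) x))).
  by apply: eq_Rintegral => x _; apply: eq_bigr => j _; rewrite mulrCA.
rewrite Rintegral_sum1// big1// => j _.
rewrite RintegralZl//; last exact: integrable1M iv (measurable_mon _ _ _) (mon_bounded _ _ _).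
rewrite Rintegral_even_mon// -[RHS](mulr0 (c j * \prod_i cos (th j i))) -mulrA; congr (_ * (_ * _)).
transitivity (mode v [ffun i => `|k j i|%N]); last first.
  by apply: vS; apply/mapP; exists j => //; rewrite mem_enum.
apply: eq_Rintegral => x _; congr (_ * _); rewrite /chi /mon; apply: eq_bigr => i _.
rewrite ffunE !addr0; case: (intP (k j i)) => [|n|n] //.
by rewrite abszN /= mulrNz !(mulrN, mulNr) cosN.
Qed.

End cosine_modes.

(** * Convolution on bounded even functions *)

Section convolution.
Context {R : realType} (L : R) (L0 : 0 < L) {d : nat}.
Local Notation mu := (torus_measure L d).
Implicit Types (u v w Q : 'rV[R]_d -> R) (k l : {ffun 'I_d -> nat}) (x y : 'rV[R]_d).

(** The working function space: an algebra containing constants and modes, closed under uniform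
    limits and under convolution by [W]. *)
Definition nice u := [/\ measurable_fun setT u, exists M, bounded_by u M, Defs.periodic L u & even_coords u].

Lemma nice_measurable u : nice u -> measurable_fun setT u. Proof. by case. Qed.

Lemma nice_integrable1 u : nice u -> integrable1 L u.
Proof. by case=> mu_ [M uM] _ _; exact: integrable1_bounded uM. Qed.

Lemma nice_chi k : nice (chi L k).
Proof.
split; [exact: measurable_chi|by exists 1; exact: chi_bounded|exact: chi_periodic|exact: chi_even].
Qed.

Lemma nice_cst c : nice (cst c).
Proof. by split => //; exists `|c|. Qed.

Lemma niceD u v : nice u -> nice v -> nice (fun x => u x + v x).
Proof.
move=> [mu_ [M uM] uL ue] [mv [N vN] vL ve]; split.
- exact: measurable_funD.
- by exists (M + N) => x; apply: le_trans (ler_normD _ _) (lerD _ _).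
- by move=> i x; rewrite uL vL.
- by move=> i x; rewrite ue ve.
Qed.

Lemma niceM u v : nice u -> nice v -> nice (fun x => u x * v x).
Proof.
move=> [mu_ [M uM] uL ue] [mv [N vN] vL ve]; split.
- exact: measurable_funM.
- by exists (M * N) => x; rewrite normrM ler_pM.
- by move=> i x; rewrite uL vL.
- by move=> i x; rewrite ue ve.
Qed.

Lemma niceZ c u : nice u -> nice (fun x => c * u x).
Proof. exact: (niceM (nice_cst c)). Qed.

Lemma nice_sum (I : Type) (s : seq I) (F : I -> 'rV[R]_d -> R) :
  (forall i, nice (F i)) -> nice (fun x => \sum_(i <- s) F i x).
Proof.
move=> nF; elim: s => [|i s IH].
  by rewrite (_ : (fun _ => _) = cst 0); [exact: nice_cst|apply/funext => x; rewrite big_nil].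
rewrite (_ : (fun _ => _) = (fun x => F i x + \sum_(i <- s) F i x)); first exact: niceD.
by apply/funext => x; rewrite big_cons.
Qed.

(** Approximants with errors [1 / (n + 1)] converge pointwise, so measurability, periodicity and
    evenness pass to the limit. *)
Lemma nice_closed u : (forall e, 0 < e -> exists v, nice v /\ bounded_by (fun x => u x - v x) e) ->
  nice u.
Proof.
move=> H.
have H' n : exists v, nice v /\ bounded_by (fun x => u x - v x) n.+1%:R^-1 by apply: H.
have [v Hv] := choice H'.
have cv x : v n x @[n --> \oo] --> u x.
  apply/cvgrPdist_le => e e0; near=> n.
  have [_ /(_ x) h] := Hv n; apply: le_trans h _; apply: ltW.
  by near: n; exact: near_infty_natSinv_lt (PosNum e0).
split.
- apply: (measurable_fun_cvg (h := v)) => // n; exact: (nice_measurable (proj1 (Hv n))).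
- have [[_ [M vM] _ _] uv] := Hv 0%N; exists (1 + M) => x.
  rewrite -[u x](subrK (v 0%N x)); apply: le_trans (ler_normD _ _) (lerD _ (vM x)).
  by have := uv x; rewrite invr1.
- move=> i x; have E : v ^~ (x + L *: delta_mx 0 i) = v ^~ x.
    by apply/funext => n; have [[_ _ vL _] _] := Hv n; rewrite vL.
  by have c2 := cv (x + L *: delta_mx 0 i); rewrite -(cvg_lim _ c2)// E (cvg_lim _ (cv x)).
- move=> i x; have E : v ^~ (reflect_coord i x) = v ^~ x.
    by apply/funext => n; have [[_ _ _ ve] _] := Hv n; rewrite ve.
  by have c2 := cv (reflect_coord i x); rewrite -(cvg_lim _ c2)// E (cvg_lim _ (cv x)).
Unshelve. all: by end_near.
Qed.

Lemma mode_bounded u k M : nice u -> bounded_by u M -> `|mode L u k| <= L ^+ d * M.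
Proof.
move=> nu uM; have iu := nice_integrable1 (niceM nu (nice_chi k)).
apply: le_trans (le_normr_Rintegral _ iu) _ => //.
rewrite mulrC -(Rintegral_torus_cst L0).
apply: le_Rintegral => //.
- exact: integrable_norm.
- exact: finite_measure_integrable_cst.
- move=> x _; rewrite normrM -[leRHS]mulr1; apply: ler_pM => //; exact: chi_bounded.
Qed.

Lemma modeD u v k : nice u -> nice v -> mode L (fun x => u x + v x) k = mode L u k + mode L v k.
Proof.
move=> nu nv; rewrite /mode -RintegralD//; last 2 first.
  exact: nice_integrable1 (niceM nu (nice_chi k)).
  exact: nice_integrable1 (niceM nv (nice_chi k)).
by apply: eq_Rintegral => x _; rewrite mulrDl.
Qed.

Lemma modeZ c u k : nice u -> mode L (fun x => c * u x) k = c * mode L u k.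
Proof.
move=> nu; rewrite /mode -RintegralZl//; last first.
  exact: nice_integrable1 (niceM nu (nice_chi k)).
by apply: eq_Rintegral => x _; rewrite mulrA.
Qed.

Variable W : 'rV[R]_d -> R.
Hypotheses (sW : sq_integrable L W) (WL : Defs.periodic L W) (We : even_coords W).

Let iW := sq_integrable1 sW.
Let mW : measurable_fun setT W := proj1 sW.

Lemma integrable1_conv u M x : measurable_fun setT u -> bounded_by u M ->
  integrable1 L (fun y => W (x - y) * u y).
Proof.
by move=> mu_ uM; apply: integrable1M mu_ uM; exact: integrable_torus_sub.
Qed.

Lemma convD u v x : nice u -> nice v ->
  Defs.conv L W (fun x => u x + v x) x = Defs.conv L W u x + Defs.conv L W v x.
Proof.
move=> [mu_ [M uM] _ _] [mv [N vN] _ _]; rewrite /Defs.conv -RintegralD//; last 2 first.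
  exact: integrable1_conv mu_ uM.
  exact: integrable1_conv mv vN.
by apply: eq_Rintegral => y _; rewrite mulrDr.
Qed.

Lemma convZ c u x : nice u -> Defs.conv L W (fun x => c * u x) x = c * Defs.conv L W u x.
Proof.
move=> [mu_ [M uM] _ _]; rewrite /Defs.conv -RintegralZl//; last exact: integrable1_conv mu_ uM.
by apply: eq_Rintegral => y _; rewrite mulrCA.
Qed.

Lemma conv_cst c x : Defs.conv L W (cst c) x = W0 L W * c.
Proof.
rewrite /Defs.conv /W0 RintegralZr//; last exact: integrable_torus_sub.
by rewrite Rintegral_torus_sub.
Qed.

Lemma conv_chi k x : Defs.conv L W (chi L k) x = mode L W k * chi L k x.
Proof.
rewrite mulrC -chi_conv// /Defs.conv.
rewrite -(@Rintegral_torus_sub _ _ L0 _ x (fun y => W y * chi L k (x - y)))//; last 2 first.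
- apply: measurable_funM => //; apply: (measurable_funE_comp (measurable_chi L k)).
  apply: measurable_fun_rV => i.
  rewrite (_ : (fun _ => _) = (fun y : 'rV[R]_d => x ord0 i - y ord0 i)).
    by apply: measurable_funB; [exact: measurable_cst|exact: measurable_coord].
  by apply/funext => y; rewrite !mxE.
- move=> i y; rewrite WL; congr (_ * _).
  by rewrite -[LHS](chi_periodic L0 k i) opprD addrA subrK.
by apply: eq_Rintegral => y _; rewrite opprB addrCA subrr addr0.
Qed.

Lemma conv_periodic u : Defs.periodic L (Defs.conv L W u).
Proof.
move=> i x; apply: eq_Rintegral => y _; congr (_ * _).
by rewrite addrAC WL.
Qed.

Lemma measurable_sub x : measurable_fun setT (fun y : 'rV[R]_d => x - y).
Proof.
apply: measurable_fun_rV => i.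
rewrite (_ : (fun _ => _) = (fun y : 'rV[R]_d => x ord0 i - y ord0 i)).
  by apply: measurable_funB; [exact: measurable_cst|exact: measurable_coord].
by apply/funext => y; rewrite !mxE.
Qed.

Lemma conv_even u : measurable_fun setT u -> Defs.periodic L u -> even_coords u ->
  even_coords (Defs.conv L W u).
Proof.
move=> mu_ uL ue i x; rewrite /Defs.conv.
rewrite -(Rintegral_torus_reflect i (f := fun y => W (x - y) * u y)).
- apply: eq_Rintegral => y _; rewrite ue -(We i (x - reflect_coord i y)); congr (W _ * _).
  by apply/rowP => j; rewrite !mxE; case: (j == i); ring.
- by apply: measurable_funM => //; apply: measurable_funE_comp mW _; exact: measurable_sub.
- by move=> j y; rewrite uL -[W (x - (_ + _))](WL j) opprD addrA subrK.
Qed.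

Lemma conv_bounded u M : measurable_fun setT u -> bounded_by u M ->
  bounded_by (Defs.conv L W u) ((\int[mu]_x `|W x|) * M).
Proof.
move=> mu_ uM x; have iWu := integrable1_conv x mu_ uM.
apply: le_trans (le_normr_Rintegral _ iWu) _ => //.
have iWs : integrable1 L (fun y => `|W (x - y)|).
  exact: (integrable_norm (integrable_torus_sub L0 x WL iW)).
rewrite -(@Rintegral_torus_sub _ _ L0 _ x (fun y => `|W y|)); last 2 first.
- by apply: measurableT_comp => //.
- by move=> i y; rewrite WL.
rewrite -RintegralZr//; apply: le_Rintegral => //.
- exact: integrable_norm.
- by apply: eq_integrable (integrable1Z M iWs) => // y _ /=; rewrite mulrC.
- by move=> y _; rewrite normrM ler_wpM2l.
Qed.

(** The hypothesis of Fubini, also used for measurability of the convolution: integrating in [y]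
    first gives at most [M N] times the L^1 norm of [W], whatever [x] is. *)
Lemma integrable_conv_prod u g M N : measurable_fun setT u -> bounded_by u M ->
  measurable_fun setT g -> bounded_by g N ->
  (mu \x mu)%E.-integrable setT (fun xy : 'rV[R]_d * 'rV[R]_d => (W (xy.1 - xy.2) * u xy.2 * g xy.1)%:E).
Proof.
move=> mu_ uM mg gN.
have m1 : measurable_fun setT (fun xy : 'rV[R]_d * 'rV[R]_d => W (xy.1 - xy.2)).
  apply: (measurableT_comp mW); apply: measurable_fun_rV => i.
  rewrite (_ : (fun _ => _) = (fun xy : 'rV[R]_d * 'rV[R]_d => xy.1 ord0 i - xy.2 ord0 i)).
    by apply: measurable_funB; apply: measurableT_comp (measurable_coord i) _.
  by apply/funext => xy; rewrite !mxE.
apply/integrable12ltyP.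
  apply/measurable_EFinP; apply: measurable_funM.
    by apply: measurable_funM => //; exact: measurableT_comp mu_ _.
  exact: measurableT_comp mg _.
pose C := (\int[mu]_x `|W x|) * M * N.
have C0 : (\int[mu]_(x in setT) C%:E < +oo)%E.
  by rewrite integral_cst// ltey_eq fin_numM// fin_num_measure.
apply: le_lt_trans C0; apply: ge0_le_integral => //.
- by move=> x _; exact: integral_ge0.
- apply: (@measurable_fun_fubini_tonelli_F _ _ 'rV[R]_d 'rV[R]_d R mu
    (fun xy : 'rV[R]_d * 'rV[R]_d => `|(W (xy.1 - xy.2) * u xy.2 * g xy.1)%:E|%E)) => //.
  apply: measurableT_comp => //; apply/measurable_EFinP; apply: measurable_funM.
    by apply: measurable_funM => //; exact: measurableT_comp mu_ _.
  exact: measurableT_comp mg _.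
move=> x _; have iWu := integrable1_conv x mu_ uM.
have iWug : integrable1 L (fun y => W (x - y) * u y * g x).
  by apply: eq_integrable (integrable1Z (g x) iWu) => // y _ /=; rewrite mulrC.
rewrite (_ : (\int[mu]_y _)%E = (\int[mu]_y `|W (x - y) * u y * g x|)%:E); last first.
  rewrite /Rintegral fineK//; apply: integrable_fin_num => //; exact: integrable_norm.
rewrite lee_fin /C.
have iWs : integrable1 L (fun y => `|W (x - y)|).
  exact: (integrable_norm (integrable_torus_sub L0 x WL iW)).
rewrite -(@Rintegral_torus_sub _ _ L0 _ x (fun y => `|W y|)); last 2 first.
- by apply: measurableT_comp => //.
- by move=> i y; rewrite WL.
rewrite -mulrA -RintegralZr//; apply: le_Rintegral => //.
- exact: integrable_norm.
- by apply: eq_integrable (integrable1Z (M * N) iWs) => // y _ /=; rewrite mulrC.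
- by move=> y _; rewrite -mulrA !normrM ler_wpM2l// ler_pM.
Qed.

Lemma measurable_conv u M : measurable_fun setT u -> bounded_by u M ->
  measurable_fun setT (Defs.conv L W u).
Proof.
move=> mu_ uM.
have := measurable_fubini_F (integrable_conv_prod mu_ uM (measurable_cst (1 : R)) (fun=> ltac:(by rewrite normr1))).
move=> /(measurableT_comp (@fine_measurable R _ measurableT)); congr measurable_fun.
apply/funext => x; rewrite /Defs.conv /Rintegral /= /fubini_F; congr fine.
by apply: eq_integral => y _ /=; rewrite mulr1.
Qed.

Lemma nice_conv u : nice u -> nice (Defs.conv L W u).
Proof.
move=> [mu_ [M uM] uL ue]; split.
- exact: measurable_conv uM.
- by eexists; exact: conv_bounded uM.
- exact: conv_periodic.
- exact: conv_even.
Qed.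

(** Fubini moves the convolution onto the mode, which [conv_chi] diagonalises; the exchange needs
    [W (- x) = W x]. *)
Lemma mode_conv u k : nice u -> mode L (Defs.conv L W u) k = mode L W k * mode L u k.
Proof.
move=> nu; have [mu_ [M uM] uL ue] := nu.
have iP := integrable_conv_prod mu_ uM (measurable_chi L k) (chi_bounded L k).
have WN x : W (- x) = W x.
  (* Coordinates are reflected one after another along [s]. *)
  have H (s : seq 'I_d) : W (\row_j (if j \in s then - x 0 j else x 0 j)) = W x.
    elim: s => [|i s IH]; first by congr W; apply/rowP => j; rewrite mxE.
    have [si|si] := boolP (i \in s).
      rewrite -[RHS]IH; congr W; apply/rowP => j; rewrite !mxE inE.
      by case: eqP => [->|//]; rewrite si.
    rewrite -[RHS]IH -[RHS](We i); congr W; apply/rowP => j; rewrite !mxE inE.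
    by case: eqP => [->|//]; rewrite (negbTE si).
  rewrite -[RHS](H (enum 'I_d)); congr W; apply/rowP => j.
  by rewrite !mxE mem_enum.
have E1 : mode L (Defs.conv L W u) k = fine (\int[mu]_x \int[mu]_y (W (x - y) * u y * chi L k x)%:E)%E.
  rewrite /mode; congr fine; apply: eq_integral => x _.
  have iWu := integrable1_conv x mu_ uM.
  rewrite -RintegralZr// /Rintegral fineK//; apply: integrable_fin_num => //.
  by apply: eq_integrable (integrable1Z (chi L k x) iWu) => // y _ /=; rewrite mulrC.
rewrite E1 (Fubini iP) -(modeZ _ _ nu).
congr fine; apply: eq_integral => y _ /=.
have iWc := integrable1_conv y (measurable_chi L k) (chi_bounded L k).
transitivity (\int[mu]_x (u y * (W (y - x) * chi L k x))%:E)%E.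
  by apply: eq_integral => x _; rewrite -(WN (x - y)) opprB; congr EFin; ring.
transitivity (\int[mu]_x (u y * (W (y - x) * chi L k x)))%:E.
  rewrite /Rintegral fineK//; apply: integrable_fin_num => //; exact: integrable1Z.
rewrite RintegralZl// -[X in (_ * X)%:E]/(Defs.conv L W (chi L k) y) conv_chi.
by congr EFin; ring.
Qed.

End convolution.

(** * Approximating the convolution by finitely many modes *)

Section finite_rank_approximation.
Context {R : realType} (L : R) (L0 : 0 < L) {d : nat}.
Local Notation mu := (torus_measure L d).
Implicit Types (u v w Q : 'rV[R]_d -> R) (k l : {ffun 'I_d -> nat}) (x y : 'rV[R]_d).

(* AM-GM, with the constants chosen so that both halves are [e / 2]. *)
Lemma Rintegral_abs_le u e : sq_integrable L u -> 0 < e ->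
  \int[mu]_x (u x ^+ 2) <= e ^+ 2 / L ^+ d -> \int[mu]_x `|u x| <= e.
Proof.
move=> su e0 ue; have [mu_ iu2] := su.
have V0 : 0 < L ^+ d by rewrite exprn_gt0.
pose a := L ^+ d / (2 * e); pose b := e / (2 * L ^+ d).
have iu : integrable1 L (fun x => `|u x|) := integrable_norm (sq_integrable1 su).
have ia : integrable1 L (fun x => a * u x ^+ 2 + b).
  apply: integrable1D; first exact: integrable1Z.
  exact: finite_measure_integrable_cst.
apply: le_trans (_ : \int[mu]_x (a * u x ^+ 2 + b) <= _).
  apply: le_Rintegral => // x _.
  rewrite -[X in _ * X](@real_normK _ (u x)) ?num_real//.
  have e2 : 0 < 2 * e by rewrite mulr_gt0.
  rewrite -subr_ge0 (_ : _ - _ = (`|u x| * L ^+ d - e) ^+ 2 / (2 * e * L ^+ d)).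
    by rewrite divr_ge0 ?sqr_ge0// ltW// mulr_gt0.
  by rewrite /a /b; field; rewrite !gt_eqF.
rewrite RintegralD//; last 2 first.
- exact: integrable1Z.
- exact: finite_measure_integrable_cst.
rewrite RintegralZl// (Rintegral_torus_cst L0).
have -> : e = a * (e ^+ 2 / L ^+ d) + b * L ^+ d by rewrite /a /b; field; rewrite !gt_eqF.
by rewrite lerD2r ler_wpM2l// /a divr_ge0 ?ltW// mulr_gt0.
Qed.

Variable W : 'rV[R]_d -> R.
Hypotheses (sW : sq_integrable L W) (WL : Defs.periodic L W) (We : even_coords W).

Definition Fourier_sum (S : seq {ffun 'I_d -> nat}) x : R :=
  \sum_(k <- S) mode L W k / chi_sqnorm L k * chi L k x.

Lemma sq_integrable_Fourier_sum S : sq_integrable L (Fourier_sum S).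
Proof. by apply: sq_integrable_sum => k; apply: sq_integrableZ; exact: chi_sq_integrable. Qed.

Lemma Fourier_sum_periodic S : Defs.periodic L (Fourier_sum S).
Proof. by move=> i x; apply: eq_bigr => k _; rewrite chi_periodic. Qed.

Lemma Fourier_sum_even S : even_coords (Fourier_sum S).
Proof. by move=> i x; apply: eq_bigr => k _; rewrite chi_even. Qed.

Lemma mode_Fourier_remainder S k : uniq S -> k \in S ->
  mode L (fun x => W x - Fourier_sum S x) k = 0.
Proof.
move=> uS kS; have iWc := sq_integrableM sW (chi_sq_integrable L k).
have iFc l : integrable1 L (fun x => mode L W l / chi_sqnorm L l * (chi L l x * chi L k x)).
  by apply: integrable1Z; exact: sq_integrableM (chi_sq_integrable L l) (chi_sq_integrable L k).
rewrite /mode; transitivity (\int[mu]_x (W x * chi L k x -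
   \sum_(l <- S) mode L W l / chi_sqnorm L l * (chi L l x * chi L k x))).
  apply: eq_Rintegral => x _; rewrite mulrBl /Fourier_sum mulr_suml; congr (_ - _).
  by apply: eq_bigr => l _; rewrite mulrA.
rewrite RintegralB//; last by apply: integrable1_sum => l; exact: iFc.
rewrite Rintegral_sum1// (bigD1_seq k)//= big1 ?addr0.
  rewrite RintegralZl//; last exact: sq_integrableM (chi_sq_integrable L k) (chi_sq_integrable L k).
  by rewrite -/(chi_sqnorm L k) -/(mode L W k) divfK ?subrr// gt_eqF// chi_sqnorm_gt0.
move=> l lk; rewrite RintegralZl//; last exact: sq_integrableM (chi_sq_integrable L l) (chi_sq_integrable L k).
by rewrite -/(mode L (chi L l) k) chi_ortho// mulr0.
Qed.

(** The remainder [v] is orthogonal to the Fourier sum and to [Q], since [S] contains every mode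
    that [Q] tests. Hence the integral of [v ^ 2] equals that of [v (W - Q)], and AM-GM bounds it by
    the integral of [(W - Q) ^ 2]. The index [k0] is put in [S] by hand. *)
Lemma Fourier_approx k0 e : 0 < e -> exists S, [/\ uniq S, k0 \in S &
  \int[mu]_x (W x - Fourier_sum S x) ^+ 2 <= e].
Proof.
move=> e0; have [_ /(_ e e0)[Q [tQ WQ]]] := trig_dense_sq_integrable L0 sW.
have [S0 HS0] := trig_test L0 tQ.
pose S := undup (k0 :: S0).
exists S; split; [exact: undup_uniq|by rewrite mem_undup inE eqxx|].
apply: le_trans WQ; rewrite /sqdist.
pose v x := W x - Fourier_sum S x.
have sF := sq_integrable_Fourier_sum S; have sv : sq_integrable L v := sq_integrableB sW sF.
have sQ := trig_sq_integrable tQ.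
have vL : Defs.periodic L v by move=> i x; rewrite /v WL Fourier_sum_periodic.
have ve : even_coords v by move=> i x; rewrite /v We Fourier_sum_even.
have vS k : k \in S -> mode L v k = 0 by exact: mode_Fourier_remainder (undup_uniq _).
have vQ : \int[mu]_x (v x * Q x) = 0.
  by apply: HS0 => // k kS; apply: vS; rewrite mem_undup inE kS orbT.
have vF : \int[mu]_x (v x * Fourier_sum S x) = 0.
  have ivc k := sq_integrableM sv (chi_sq_integrable L k).
  transitivity (\int[mu]_x \sum_(k <- S) (mode L W k / chi_sqnorm L k) * (v x * chi L k x)).
    apply: eq_Rintegral => x _; rewrite /Fourier_sum mulr_sumr.
    by apply: eq_bigr => k _; rewrite mulrCA.
  rewrite Rintegral_sum1; last by move=> k; exact: integrable1Z.
  rewrite big_seq big1// => k kS; rewrite RintegralZl//; last exact: ivc.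
  by rewrite (_ : \int[mu]_x _ = 0) ?mulr0//; exact: vS.
have sWQ := sq_integrableB sW sQ.
have [_ iv2] := sv; have [_ iWQ2] := sWQ.
have ivQ := sq_integrableM sv sQ; have ivF := sq_integrableM sv sF.
have ivWQ := sq_integrableM sv sWQ.
rewrite -/(v _).
have E : \int[mu]_x (v x ^+ 2) = \int[mu]_x (v x * (W x - Q x)).
  transitivity (\int[mu]_x (v x * (W x - Q x) + v x * Q x - v x * Fourier_sum S x)).
    by apply: eq_Rintegral => x _; rewrite /v; ring.
  rewrite RintegralB//; last exact: integrable1D.
  by rewrite vF subr0 RintegralD// vQ addr0.
have H : \int[mu]_x (v x * (W x - Q x)) <=
    2^-1 * \int[mu]_x (v x ^+ 2) + 2^-1 * \int[mu]_x ((W x - Q x) ^+ 2).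
  rewrite -RintegralZl// -RintegralZl// -RintegralD//; last 2 first.
    exact: integrable1Z.
    exact: integrable1Z.
  apply: le_Rintegral => //.
    by apply: integrable1D; exact: integrable1Z.
  move=> x _; have := sqr_ge0 (v x - (W x - Q x)); nra.
lra.
Qed.

(** The difference is convolution by the Fourier remainder of [W], whose norm on bounded functions
    is at most its L^1 norm. The squared L^2 error [e ^ 2 / L ^ d] is the one that
    [Rintegral_abs_le] turns into the L^1 error [e]. *)
Lemma conv_finite_rank k0 e : 0 < e -> exists S : seq {ffun 'I_d -> nat},
  [/\ uniq S, k0 \in S & forall u M, nice L u -> bounded_by u M ->
    bounded_by (fun x => Defs.conv L W u x -
      \sum_(k <- S) mode L W k * (mode L u k / chi_sqnorm L k) * chi L k x) (e * M)].
Proof.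
move=> e0; have V0 : 0 < L ^+ d by rewrite exprn_gt0.
have e1 : 0 < e ^+ 2 / L ^+ d by rewrite divr_gt0// exprn_gt0.
have [S [uS k0S HS]] := Fourier_approx k0 e1.
exists S; split => // u M nu uM x.
have [mu_ _ uL ue] := nu.
have sF := sq_integrable_Fourier_sum S.
have sv := sq_integrableB sW sF.
have vL : Defs.periodic L (fun x => W x - Fourier_sum S x).
  by move=> i y; rewrite WL Fourier_sum_periodic.
have -> : Defs.conv L W u x - \sum_(k <- S) mode L W k * (mode L u k / chi_sqnorm L k) * chi L k x =
    Defs.conv L (fun x => W x - Fourier_sum S x) u x.
  have iWu := integrable1_conv L0 sW WL x mu_ uM.
  have iku k := integrable1_conv L0 (chi_sq_integrable L k) (chi_periodic L0 k) x mu_ uM.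
  have ic k : integrable1 L (fun y => mode L W k / chi_sqnorm L k * (chi L k (x - y) * u y)).
    exact: integrable1Z.
  rewrite [RHS](_ : _ = \int[mu]_y (W (x - y) * u y -
     \sum_(k <- S) mode L W k / chi_sqnorm L k * (chi L k (x - y) * u y))); last first.
    apply: eq_Rintegral => y _; rewrite mulrBl /Fourier_sum mulr_suml; congr (_ - _).
    by apply: eq_bigr => k _; rewrite mulrA.
  rewrite RintegralB//; last by apply: integrable1_sum => k; exact: ic.
  rewrite Rintegral_sum1//; congr (_ - _); apply: eq_bigr => k _.
  rewrite RintegralZl//; last exact: iku.
  rewrite (_ : \int[mu]_y _ = chi L k x * mode L u k); first by ring.
  rewrite -chi_conv//; last exact: nice_integrable1.
  by apply: eq_Rintegral => y _; rewrite mulrC.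
apply: le_trans (conv_bounded L0 sv vL mu_ uM x) _.
have M0 : 0 <= M := le_trans (normr_ge0 _) (uM x).
by rewrite ler_wpM2r//; exact: Rintegral_abs_le.
Qed.

(* The two factors are weighted by AM-GM, so that no square root is needed. *)
Lemma conv_small e : 0 < e -> exists2 r, 0 < r & forall u,
  sq_integrable L u -> \int[mu]_x (u x ^+ 2) <= r -> bounded_by (Defs.conv L W u) e.
Proof.
move=> e0; pose A := \int[mu]_x (W x ^+ 2) + 1.
have A0 : 0 < A by rewrite ltr_wpDl// Rintegral_ge0// => x _; exact: sqr_ge0.
exists (e ^+ 2 / A); first by rewrite divr_gt0// exprn_gt0.
move=> u su ur x; have [mu_ iu2] := su; have [mW iW2] := sW.
have sWx : sq_integrable L (fun y => W (x - y)).
  split; first by apply: measurable_funE_comp mW _; exact: measurable_sub.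
  by apply: (integrable_torus_sub L0 x (f := fun y => W y ^+ 2)) => // i y; rewrite WL.
have iWu := sq_integrableM sWx su; have [_ iWx2] := sWx.
apply: le_trans (le_normr_Rintegral _ iWu) _ => //.
(* With this weight both halves are at most [e / 2]; the 1 added in [A] avoids dividing by 0. *)
pose t := e / A; have t0 : 0 < t by rewrite divr_gt0.
apply: le_trans (_ : \int[mu]_y (t / 2 * W (x - y) ^+ 2 + (2 * t)^-1 * u y ^+ 2) <= _).
  apply: le_Rintegral => //; first exact: integrable_norm.
    by apply: integrable1D; exact: integrable1Z.
  move=> y _; rewrite normrM -(@real_normK _ (W (x - y))) ?num_real// -(@real_normK _ (u y)) ?num_real//.
  rewrite -subr_ge0 (_ : _ - _ = (t * `|W (x - y)| - `|u y|) ^+ 2 / (2 * t)).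
    by rewrite divr_ge0 ?sqr_ge0// ltW// mulr_gt0.
  by field; rewrite gt_eqF.
rewrite RintegralD//; [|exact: integrable1Z|exact: integrable1Z].
rewrite RintegralZl// RintegralZl//.
rewrite (@Rintegral_torus_sub _ _ L0 _ x (fun y => W y ^+ 2)); last 2 first.
- exact: measurable_funX.
- by move=> i y; rewrite WL.
have -> : e = t / 2 * A + (2 * t)^-1 * (e ^+ 2 / A).
  by rewrite /t; field; rewrite !gt_eqF.
apply: lerD; first by rewrite ler_wpM2l ?divr_ge0 ?ltW// /A ltrDl.
by rewrite ler_wpM2l// invr_ge0 mulr_ge0// ltW.
Qed.

End finite_rank_approximation.

(** * Bifurcation from a simple eigenvalue *)

Section uniform_contraction.
Context {R : realType} (T : Type).
Implicit Types (u v h k : T -> R) (M e : R).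

Lemma half_exp_small M e : 0 < e -> exists n, M * 2^-1 ^+ n <= e.
Proof.
move=> e0.
have c : (M * 2^-1 ^+ n) @[n --> \oo] --> (0 : R).
  by rewrite -[X in _ --> X](mulr0 M); apply: cvgMr; apply: cvg_expr; rewrite ger0_norm; lra.
have /cvgrPdist_lt/(_ e e0)[N _ HN] := c.
exists N; have := HN N (leqnn N); rewrite /= sub0r normrN => h.
by apply: le_trans (ler_norm _) (ltW _).
Qed.

Lemma le_half_exp (a M : R) : (forall n, a <= M * 2^-1 ^+ n) -> a <= 0.
Proof.
move=> H; rewrite leNgt; apply/negP => a0.
have [n hn] := @half_exp_small M (a / 2) (ltac:(lra)); have := H n; lra.
Qed.

(** The numbers [a n - M / 2 ^ n] increase, [a n + M / 2 ^ n] decrease, and all the former lie below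
    all the latter; the supremum of the former is the limit, with its error explicit. *)
Lemma half_cauchy_lim (a : nat -> R) M :
  (forall n, `|a n.+1 - a n| <= M * 2^-1 ^+ n.+1) ->
  exists l, forall n, `|l - a n| <= M * 2^-1 ^+ n.
Proof.
move=> H.
have up n m : a (n + m)%N - M * 2^-1 ^+ (n + m) >= a n - M * 2^-1 ^+ n.
  elim: m => [|m IH]; first by rewrite addn0.
  rewrite addnS; apply: le_trans IH _.
  have := H (n + m)%N; rewrite ler_norml => /andP[h _].
  move: h; rewrite exprS; move: (2^-1 ^+ _) => p; lra.
have dn n m : a (n + m)%N + M * 2^-1 ^+ (n + m) <= a n + M * 2^-1 ^+ n.
  elim: m => [|m IH]; first by rewrite addn0.
  rewrite addnS; apply: le_trans IH.
  have := H (n + m)%N; rewrite ler_norml => /andP[_ h].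
  move: h; rewrite exprS; move: (2^-1 ^+ _) => p; lra.
have M0 : 0 <= M.
  have := le_trans (normr_ge0 _) (H 0%N); rewrite pmulr_lge0//; exact: exprn_gt0.
have p0 n : 0 <= M * 2^-1 ^+ n by rewrite mulr_ge0// exprn_ge0.
have ub n m : a m - M * 2^-1 ^+ m <= a n + M * 2^-1 ^+ n.
  apply: le_trans (up m n) _; apply: le_trans (_ : a (n + m)%N + M * 2^-1 ^+ (n + m) <= _).
    by rewrite addnC; have := p0 (n + m)%N; lra.
  exact: dn.
pose A := range (fun n => a n - M * 2^-1 ^+ n).
have A0 : A !=set0 by exists (a 0%N - M * 2^-1 ^+ 0); exists 0%N.
exists (sup A) => n; rewrite ler_norml; apply/andP; split.
  have : a n - M * 2^-1 ^+ n <= sup A.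
    apply: ub_le_sup; last by exists n.
    by exists (a n + M * 2^-1 ^+ n) => _ [m _ <-].
  lra.
suff : sup A <= a n + M * 2^-1 ^+ n by lra.
by apply: ge_sup => // _ [m _ <-].
Qed.

Variable E : set (T -> R).
Hypothesis E0 : E (fun=> 0).
Hypothesis E_closed : forall u,
  (forall e, 0 < e -> exists v, E v /\ bounded_by (fun t => u t - v t) e) -> E u.

(** Picard iteration from 0. The bound [eta (1 - 2 ^ - n)] keeps the n-th iterate in the ball where
    [F] contracts. Limits are taken pointwise, and [E_closed] plays the part of completeness. *)
Lemma contraction_fixpoint (F : (T -> R) -> (T -> R)) eta : 0 < eta ->
  (forall h, E h -> bounded_by h eta -> E (F h)) ->
  (forall h k M, E h -> E k -> bounded_by h eta -> bounded_by k eta ->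
     bounded_by (fun t => h t - k t) M -> bounded_by (fun t => F h t - F k t) (M / 2)) ->
  bounded_by (F (fun=> 0)) (eta / 2) ->
  exists h, [/\ E h, bounded_by h eta & F h = h].
Proof.
move=> eta0 FE Fc F0.
pose a n := iter n F (fun=> 0).
have aP n : [/\ E (a n), bounded_by (a n) (eta * (1 - 2^-1 ^+ n)) &
    bounded_by (fun t => a n.+1 t - a n t) (eta * 2^-1 ^+ n.+1)].
  elim: n => [|n [En bn dn]].
    split=> // t; first by rewrite normr0 expr0 subrr mulr0.
    by rewrite expr1 /a /= subr0; exact: F0.
  have p0 m : 0 < 2^-1 ^+ m :> R by exact: exprn_gt0.
  have bn' : bounded_by (a n) eta.
    by move=> t; apply: le_trans (bn t) _; have := p0 n; nra.
  have bS : bounded_by (a n.+1) (eta * (1 - 2^-1 ^+ n.+1)).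
    move=> t; rewrite -[a n.+1 t](subrK (a n t)); apply: le_trans (ler_normD _ _) _.
    by have := dn t; have := bn t; rewrite exprS; move: (2^-1 ^+ n) => p; nra.
  have bS' : bounded_by (a n.+1) eta.
    by move=> t; apply: le_trans (bS t) _; have := p0 n.+1; nra.
  have ES : E (a n.+1) by exact: FE.
  split=> // t; rewrite exprSr mulrA; exact: (Fc _ _ _ ES En bS' bn' dn).
have L t := @half_cauchy_lim (fun n => a n t) eta (fun n => let: And3 _ _ d := aP n in d t).
have [l Hl] := choice L.
have lb : bounded_by l eta.
  by move=> t; have := Hl t 0%N; rewrite subr0 expr0 mulr1.
have El : E l.
  apply: E_closed => e e0; have [n hn] := half_exp_small eta e0.
  by exists (a n); split=> [|t]; [case: (aP n)|apply: le_trans (Hl t n) hn].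
exists l; split=> //; apply/funext => t; apply/eqP; rewrite -subr_eq0 -normr_le0.
apply: (@le_half_exp _ eta) => n.
have [En bn _] := aP n.
have bn' : bounded_by (a n) eta.
  move=> t'; apply: le_trans (bn t') _.
  have : 0 < 2^-1 ^+ n :> R by exact: exprn_gt0.
  nra.
have h1 := Fc _ _ _ El En lb bn' (fun t => Hl t n) t.
have h2 := Hl t n.+1.
rewrite (_ : F l t - l t = (F l t - F (a n) t) - (l t - a n.+1 t)); last by rewrite /a /=; ring.
apply: le_trans (ler_normB _ _) _; apply: le_trans (lerD h1 h2) _.
rewrite exprS; move: (2^-1 ^+ n) => p; lra.
Qed.

Lemma contraction_unique (F : (T -> R) -> (T -> R)) eta h k :
  (forall h k M, E h -> E k -> bounded_by h eta -> bounded_by k eta ->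
     bounded_by (fun t => h t - k t) M -> bounded_by (fun t => F h t - F k t) (M / 2)) ->
  E h -> E k -> bounded_by h eta -> bounded_by k eta -> F h = h -> F k = k -> h = k.
Proof.
move=> Fc Eh Ek hb kb Fh Fk.
have H n : bounded_by (fun t => h t - k t) ((eta + eta) * 2^-1 ^+ n).
  elim: n => [|n IH].
    by move=> t; rewrite expr0 mulr1; apply: le_trans (ler_normB _ _) (lerD _ _).
  by move=> t; rewrite exprSr mulrA -{1}Fh -{1}Fk; exact: Fc.
apply/funext => t; apply/eqP; rewrite -subr_eq0 -normr_le0.
by apply: (@le_half_exp _ (eta + eta)) => n; exact: H.
Qed.

(** The substitute for moving [|v| / 2] to the left-hand side: a crude bound [N] is improved
    repeatedly, its excess over [2 c] being halved each time. *)
Lemma contraction_absorb (v : T -> R) (c N : R) : bounded_by v N ->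
  (forall M, bounded_by v M -> bounded_by v (c + M / 2)) -> bounded_by v (2 * c).
Proof.
move=> vN H t; rewrite -subr_le0; apply: (@le_half_exp _ (N - 2 * c)) => n.
suff : bounded_by v (2 * c + (N - 2 * c) * 2^-1 ^+ n) by move=> /(_ t); lra.
elim: n => [|n IH]; first by rewrite expr0 mulr1 addrC subrK.
move=> t'; apply: le_trans (H _ IH t') _; rewrite exprS; move: (2^-1 ^+ n) => p; lra.
Qed.

Hypothesis ED : forall u v, E u -> E v -> E (fun t => u t + v t).
Hypothesis EZ : forall c u, E u -> E (fun t => c * u t).

(** The implicit function theorem for a family of fixed points [g z]. [A z] stands for the
    derivative of the fixed-point map in the unknown, [b z] for that in the parameter; the
    derivative of the curve solves [y = A z y + b z]. The map itself does not occur, only the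
    first-order expansion of the increments of [g]. *)
Lemma contraction_C1 (g : R -> T -> R) (A : R -> (T -> R) -> (T -> R)) (b : R -> T -> R)
    (delta C : R) : 0 < C ->
  (forall z, `|z| < delta -> E (g z)) ->
  (forall z h, `|z| < delta -> E h -> E (A z h)) ->
  (forall z h k, `|z| < delta -> E h -> E k ->
     A z (fun t => h t + k t) = (fun t => A z h t + A z k t)) ->
  (forall z c h, `|z| < delta -> E h -> A z (fun t => c * h t) = (fun t => c * A z h t)) ->
  (forall z h M, `|z| < delta -> E h -> bounded_by h M -> bounded_by (A z h) (M / 2)) ->
  (forall z, `|z| < delta -> E (b z) /\ bounded_by (b z) C) ->
  (forall z z', `|z| < delta -> `|z'| < delta ->
     bounded_by (fun t => g z' t - g z t) (C * `|z' - z|)) ->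
  (forall e, 0 < e -> exists2 r, 0 < r & forall z z', `|z| < delta -> `|z'| < delta -> `|z' - z| < r ->
     [/\ bounded_by (fun t => g z' t - g z t - A z (fun t => g z' t - g z t) t - (z' - z) * b z t)
           (e * `|z' - z|),
         forall h M, E h -> bounded_by h M -> bounded_by (fun t => A z' h t - A z h t) (e * M) &
         bounded_by (fun t => b z' t - b z t) e]) ->
  exists y : R -> T -> R, [/\ forall z, `|z| < delta -> E (y z) /\ bounded_by (y z) (2 * C) &
    forall e, 0 < e -> exists2 r, 0 < r & forall z z', `|z| < delta -> `|z'| < delta -> `|z' - z| < r ->
      bounded_by (fun t => g z' t - g z t - (z' - z) * y z t) (e * `|z' - z|) /\
      bounded_by (fun t => y z' t - y z t) e].
Proof.
move=> C0 Eg AE AD AZ Ac Eb gL dif.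
have EB u v : E u -> E v -> E (fun t => u t - v t).
  by move=> Eu Ev; have := ED Eu (EZ (-1) Ev); congr E; apply/funext => t; rewrite mulN1r.
have AB z h k : `|z| < delta -> E h -> E k -> A z (fun t => h t - k t) = (fun t => A z h t - A z k t).
  move=> zd Eh Ek; rewrite (_ : (fun t => h t - k t) = (fun t => h t + -1 * k t)).
    by rewrite AD//; [rewrite AZ//; apply/funext => t; rewrite mulN1r|exact: EZ].
  by apply/funext => t; rewrite mulN1r.
(* The affine map [h |-> A z h + b z] contracts by 1/2 and sends 0 to a function bounded by [C],
   whence the radius [2 C]. *)
have exy z : exists y : T -> R, `|z| < delta -> [/\ E y, bounded_by y (2 * C) & (fun t => A z y t + b z t) = y].
  have [zd|] := boolP (`|z| < delta); last by move=> zd; exists (fun=> 0).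
  have [Ebz bC] := Eb z zd.
  have [|||y yP] := @contraction_fixpoint (fun h t => A z h t + b z t) (2 * C) (ltac:(lra)); last by exists y.
  - by move=> h Eh _; apply: ED => //; exact: AE.
  - move=> h k M Eh Ek _ _ hk t.
    have := Ac z _ M zd (EB _ _ Eh Ek) hk t; rewrite AB//.
    by congr (_ <= _); congr (`|_|); ring.
  - have A0 : A z (fun=> 0) = (fun=> 0).
      have := AZ z 0 (fun=> 0) zd E0; rewrite (_ : (fun t => 0 * 0) = (fun=> 0)).
        by move=> ->; apply/funext => t; rewrite mul0r.
      by apply/funext => t; rewrite mul0r.
    by move=> t; rewrite A0 add0r mulrC mulKf.
have [y yP] := choice exy.
exists y; split=> [z zd|e e0]; first by have [] := yP z zd.
pose e' := e / (2 * (2 * C + 1)).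
have e'0 : 0 < e' by rewrite divr_gt0//; lra.
have e'e : 2 * (e' * (2 * C + 1)) = e by rewrite /e'; field; rewrite gt_eqF//; lra.
have [r r0 Hr] := dif e' e'0; exists r => // z z' zd zd' zr.
have [D1 D2 D3] := Hr z z' zd zd' zr.
have [Ey yb yfix] := yP z zd; have [Ey' yb' yfix'] := yP z' zd'.
have Edg : E (fun t => g z' t - g z t) by apply: EB; exact: Eg.
split.
(* The error [v] equals [A z v] up to [e' |z' - z|], and the half is absorbed. *)
- pose v t := g z' t - g z t - (z' - z) * y z t.
  have Ev : E v by apply: EB => //; exact: EZ.
  have vN : bounded_by v (3 * C * `|z' - z|).
    move=> t; apply: le_trans (ler_normB _ _) _; rewrite normrM.
    have := gL z z' zd zd' t; have := yb t; have := normr_ge0 (z' - z); nra.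
  have : bounded_by v (2 * (e' * `|z' - z|)).
    apply: (contraction_absorb vN) => M vM t.
    have Av : A z v = (fun t => A z (fun t => g z' t - g z t) t - (z' - z) * A z (y z) t).
      by rewrite /v AB//; [rewrite AZ|exact: EZ].
    have := Ac z v M zd Ev vM t; have := D1 t; rewrite Av => h1 h2.
    have yt : y z t = A z (y z) t + b z t by rewrite -[LHS]/(y z t) -{1}yfix.
    have -> : v t = (g z' t - g z t - A z (fun t => g z' t - g z t) t - (z' - z) * b z t) +
       (A z (fun t => g z' t - g z t) t - (z' - z) * A z (y z) t) by rewrite /v yt; ring.
    exact: le_trans (ler_normD _ _) (lerD h1 h2).
  move=> H t; apply: le_trans (H t) _; rewrite -e'e mulrA ler_wpM2r//; nra.
(* Subtracting the two equations for [y], [v] is [A z v] plus the variations of [A] and [b], which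
   are small by assumption. *)
- pose v t := y z' t - y z t.
  have Ev : E v by exact: EB.
  have vN : bounded_by v (4 * C).
    move=> t; apply: le_trans (ler_normB _ _) _; have := yb t; have := yb' t; lra.
  have : bounded_by v (2 * (e' * (2 * C) + e')).
    apply: (contraction_absorb vN) => M vM t.
    have h1 := Ac z v M zd Ev vM t; have h2 := D2 (y z') (2 * C) Ey' yb' t; have h3 := D3 t.
    move: h1; rewrite /v AB// => h1.
    have yt : y z t = A z (y z) t + b z t by rewrite -{1}yfix.
    have yt' : y z' t = A z' (y z') t + b z' t by rewrite -{1}yfix'.
    have -> : y z' t - y z t = (A z' (y z') t - A z (y z') t) + (b z' t - b z t) +
       (A z (y z') t - A z (y z) t) by rewrite {1}yt {1}yt'; ring.
    apply: le_trans (ler_normD _ _) (lerD _ h1).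
    exact: le_trans (ler_normD _ _) (lerD h2 h3).
  move=> H t; apply: le_trans (H t) _; rewrite -e'e; lra.
Qed.

End uniform_contraction.

(** * A Newton map for the divided equation *)

Section simple_eigenvalue.
Context {R : realType} (X : Type).
Implicit Types (u v w r : X -> R) (s z y e M : R) (h k : option X -> R).

(* [D] plays the role of the function space, [G] of the convolution operator,
   [l] of the coordinate along the kernel and [A] of an approximate inverse of
   [1 - K0 G] off the kernel. *)
Variables (D : set (X -> R)) (G A : (X -> R) -> (X -> R)) (l : (X -> R) -> R) (om : X -> R).
Variables (lam K0 K1 CG CA Cl Y r0 : R) (P Ps Pz Py : R -> R -> R -> R).

Hypothesis D0 : D (fun=> 0).
Hypothesis DD : forall u v, D u -> D v -> D (fun x => u x + v x).
Hypothesis DZ : forall c u, D u -> D (fun x => c * u x).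
Hypothesis DM : forall u v, D u -> D v -> D (fun x => u x * v x).
Hypothesis D_closed : forall u,
  (forall e, 0 < e -> exists v, D v /\ bounded_by (fun x => u x - v x) e) -> D u.
Hypothesis D_comp : forall (phi : R -> R) u, D u -> bounded_by u Y ->
  (forall e, 0 < e -> exists2 q, 0 < q & forall a b, `|a| <= Y -> `|b| <= Y -> `|b - a| < q ->
     `|phi b - phi a| <= e) -> D (fun x => phi (u x)).

Hypothesis DG : forall u, D u -> D (G u).
Hypothesis GD : forall u v, D u -> D v -> G (fun x => u x + v x) = (fun x => G u x + G v x).
Hypothesis GZ : forall c u, D u -> G (fun x => c * u x) = (fun x => c * G u x).
Hypothesis Gb : forall u M, D u -> bounded_by u M -> bounded_by (G u) (CG * M).
Hypothesis DA : forall u, D u -> D (A u).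
Hypothesis AD : forall u v, D u -> D v -> A (fun x => u x + v x) = (fun x => A u x + A v x).
Hypothesis AZ : forall c u, D u -> A (fun x => c * u x) = (fun x => c * A u x).
Hypothesis Ab : forall u M, D u -> bounded_by u M -> bounded_by (A u) (CA * M).
Hypothesis lD : forall u v, D u -> D v -> l (fun x => u x + v x) = l u + l v.
Hypothesis lZ : forall c u, D u -> l (fun x => c * u x) = c * l u.
Hypothesis lb : forall u M, D u -> bounded_by u M -> `|l u| <= Cl * M.
Hypotheses (CG0 : 0 < CG) (CA0 : 0 < CA) (Cl0 : 0 < Cl).

Hypothesis Dom : D om.
Hypothesis omb : bounded_by om 1.
Hypothesis lom : l om = 1.
Hypothesis Gom : G om = (fun x => lam * om x).
Hypothesis lG : forall u, D u -> l (G u) = lam * l u.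
Hypothesis lamK0 : lam * K0 = 1.
Hypothesis K10 : K1 != 0.
Hypothesis lA : forall u, D u -> l (A u) = 0.
Hypothesis Aom : A om = (fun=> 0).
Hypothesis A_inj : forall u, D u -> A u = (fun=> 0) -> l u = 0 -> u = (fun=> 0).
Hypothesis A_inv : forall w M, D w -> l w = 0 -> bounded_by w M ->
  bounded_by (fun x => w x - A (fun x => w x - K0 * G w x) x) (M / 4).

Let lam0 : lam != 0.
Proof. by apply: contra_eq_neq lamK0 => ->; rewrite mul0r eq_sym oner_neq0. Qed.

Let DB u v : D u -> D v -> D (fun x => u x - v x).
Proof.
by move=> Du Dv; have := DD Du (DZ (-1) Dv); congr D; apply/funext => x; rewrite mulN1r.
Qed.

Let GB u v : D u -> D v -> G (fun x => u x - v x) = (fun x => G u x - G v x).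
Proof.
move=> Du Dv; rewrite (_ : (fun x => u x - v x) = (fun x => u x + -1 * v x)); last first.
  by apply/funext => x; rewrite mulN1r.
by rewrite GD ?GZ//; [apply/funext => x; rewrite mulN1r|exact: DZ].
Qed.

Let AB u v : D u -> D v -> A (fun x => u x - v x) = (fun x => A u x - A v x).
Proof.
move=> Du Dv; rewrite (_ : (fun x => u x - v x) = (fun x => u x + -1 * v x)); last first.
  by apply/funext => x; rewrite mulN1r.
by rewrite AD ?AZ//; [apply/funext => x; rewrite mulN1r|exact: DZ].
Qed.

Let lB u v : D u -> D v -> l (fun x => u x - v x) = l u - l v.
Proof.
move=> Du Dv; rewrite (_ : (fun x => u x - v x) = (fun x => u x + -1 * v x)); last first.
  by apply/funext => x; rewrite mulN1r.
by rewrite lD ?lZ ?mulN1r//; exact: DZ.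
Qed.

(* Any solution of [v = (K0 + o(1)) G v] is tangent to the kernel. *)
Lemma kernel_cone eta : 0 < eta -> exists2 e, 0 < e & forall v, D v -> (exists N, bounded_by v N) ->
  (forall x, `|v x - K0 * G v x| <= e * `|G v x|) ->
  bounded_by (fun x => v x - l v * om x) (eta * `|l v|).
Proof.
move=> eta0.
(* The residual of [w] is at most [e CG (M + |l v|)]; the two bounds on [e] make its image under [A]
   at most [M / 4 + eta |l v| / 4]. With the [M / 4] of [A_inv] this is half of [M], ready to be
   absorbed. *)
pose e := Num.min (4 * CA * CG)^-1 (eta / (4 * CA * CG)).
have c0 : 0 < CA * CG by rewrite mulr_gt0.
have e0 : 0 < e by rewrite /e lt_min invr_gt0 divr_gt0// -mulrA mulr_gt0.
have e1 : CA * CG * e <= 4^-1.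
  have : e <= (4 * CA * CG)^-1 by rewrite /e ge_min lexx.
  have -> : 4^-1 = CA * CG * (4 * CA * CG)^-1 by field; rewrite !gt_eqF.
  by move=> h; rewrite ler_pM2l.
have e2 : CA * CG * e <= eta / 4.
  have : e <= eta / (4 * CA * CG) by rewrite /e ge_min lexx orbT.
  by rewrite ler_pdivlMr; nra.
exists e => // v Dv [N vN] vK.
pose w x := v x - l v * om x.
have Dw : D w by apply: DB => //; exact: DZ.
have lw : l w = 0 by rewrite /w lB ?lZ ?lom ?mulr1 ?subrr//; exact: DZ.
have wN : bounded_by w (N + `|l v|).
  move=> x; apply: le_trans (ler_normB _ _) (lerD (vN x) _).
  by rewrite normrM ler_piMr.
(* Since [om = K0 G om], removing a multiple of [om] does not change the residual. *)
have wv x : w x - K0 * G w x = v x - K0 * G v x.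
  rewrite /w GB ?GZ ?Gom//; last exact: DZ.
  have : K0 * lam = 1 by rewrite mulrC.
  by move: (om x) => o h; rewrite mulrBr opprB addrA; ring: h.
have DKw : D (fun x => w x - K0 * G w x) by apply: DB => //; apply: DZ; exact: DG.
have := @contraction_absorb _ _ w (eta / 4 * `|l v|) _ wN _.
have H M : bounded_by w M -> bounded_by w (eta / 4 * `|l v| + M / 2).
  move=> wM x.
  have M0 : 0 <= M := le_trans (normr_ge0 _) (wM x).
  have vb : bounded_by v (M + `|l v|).
    move=> x'; rewrite -[v x'](subrK (l v * om x')); apply: le_trans (ler_normD _ _) (lerD (wM x') _).
    by rewrite normrM ler_piMr.
  have Gvb := Gb Dv vb.
  have Kb : bounded_by (fun x => w x - K0 * G w x) (e * (CG * (M + `|l v|))).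
    move=> x'; rewrite wv; apply: le_trans (vK x') _; rewrite ler_wpM2l// ?ltW//; exact: Gvb.
  have h1 := A_inv Dw lw wM x; have h2 := Ab DKw Kb x.
  rewrite -[w x](subrK (A (fun x => w x - K0 * G w x) x)).
  apply: le_trans (ler_normD _ _) (le_trans (lerD h1 h2) _).
  have := normr_ge0 (l v); move: `|l v| => q q0.
  have : CA * CG * e * M <= 4^-1 * M by rewrite ler_wpM2r.
  have : CA * CG * e * q <= eta / 4 * q by rewrite ler_wpM2r.
  nra.
move=> /(_ H) wb x; apply: le_trans (wb x) _; have := normr_ge0 (l v); nra.
Qed.

Hypotheses (Y0 : CG + `|lam| < Y) (r00 : 0 < r0).

(** As [Y] exceeds [CG + |lam|], the argument [y = G (om + h)] stays in range whenever
    [|h| <= 1]. *)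
Definition in_box s z y := [/\ `|s| <= r0, `|z| <= r0 & `|y| <= Y].

Hypothesis P_C1 : forall e, 0 < e -> exists2 q, 0 < q & forall s z y s' z' y',
  in_box s z y -> in_box s' z' y' -> `|s' - s| < q -> `|z' - z| < q -> `|y' - y| < q ->
  [/\ `|P s' z' y' - P s z y - Ps s z y * (s' - s) - Pz s z y * (z' - z) - Py s z y * (y' - y)| <=
        e * (`|s' - s| + `|z' - z| + `|y' - y|),
      `|Ps s' z' y' - Ps s z y| <= e, `|Pz s' z' y' - Pz s z y| <= e &
      `|Py s' z' y' - Py s z y| <= e].
Variable CP : R.
Hypothesis CP0 : 0 <= CP.
Hypothesis P_bounded : forall s z y, in_box s z y ->
  [/\ `|P s z y| <= CP, `|Ps s z y| <= CP, `|Pz s z y| <= CP & `|Py s z y| <= CP].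
Hypothesis P00 : forall y, P 0 0 y = K0 * y.
Hypothesis Ps00 : forall y, Ps 0 0 y = K1 * y.
Hypothesis Py00 : forall y, Py 0 0 y = K0.

(* The unknown [h : option X -> R] encodes the function [om + h (Some _)] together with
   the parameter [s = h None]; the equation is [U h = P s z (G (U h))]. *)
Let U h x := om x + h (Some x).
Let N z h x := P (h None) z (G (U h) x).
Let DN z h k x := Ps (h None) z (G (U h) x) * k None + Py (h None) z (G (U h) x) * G (fun x => k (Some x)) x.
Let bN z h x := Pz (h None) z (G (U h) x).
(** An approximate inverse of the linearised equation in the pair (function, parameter). On
    increments with [l k = 0], applying [l] to the linearised residual leaves [- K1 lam k None], so
    the second branch recovers the parameter exactly; [A] inverts the other directions and
    annihilates [om]. *)
Let Q r (o : option X) := if o is Some x then A r x else - l r / (K1 * lam).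
(** A Newton step with the fixed inverse [Q]. The normalisation [l h = 0] is preserved because [A]
    maps into the kernel of [l]. *)
Let F z h o := h o - Q (fun x => U h x - N z h x) o.
Let DF z h k o := k o - Q (fun x => k (Some x) - DN z h k x) o.
Let bF z h := Q (bN z h).
Let E : set (option X -> R) := [set h | D (fun x => h (Some x)) /\ l (fun x => h (Some x)) = 0].
Let CQ := CA + Cl / `|K1 * lam|.

Let CQ0 : 0 < CQ.
Proof. by rewrite ltr_wpDr// divr_ge0// ltW. Qed.

Let QB r r' : D r -> D r' -> Q (fun x => r x - r' x) = (fun o => Q r o - Q r' o).
Proof.
move=> Dr Dr'; apply/funext => -[x|]; rewrite /Q; first by rewrite AB.
by rewrite lB//; ring.
Qed.

Let QZ c r : D r -> Q (fun x => c * r x) = (fun o => c * Q r o).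
Proof.
move=> Dr; apply/funext => -[x|]; rewrite /Q; first by rewrite AZ.
by rewrite lZ//; ring.
Qed.

Let Qb r M : D r -> bounded_by r M -> bounded_by (Q r) (CQ * M).
Proof.
move=> Dr rM [x|] /=.
  have M0 : 0 <= M := le_trans (normr_ge0 _) (rM x).
  apply: le_trans (Ab Dr rM x) _; rewrite ler_wpM2r// /CQ lerDl divr_ge0// ltW//.
rewrite normrM normrN normrV ?unitfE ?mulf_neq0//.
have lr := lb Dr rM.
have M0 : 0 <= M by rewrite -(pmulr_rge0 _ Cl0) (le_trans _ lr).
apply: le_trans (ler_wpM2r _ lr) _; first by rewrite invr_ge0.
by rewrite /CQ mulrDl mulrAC lerDr mulr_ge0// ltW.
Qed.

Let EQ r : D r -> E (Q r).
Proof. by move=> Dr; split; [exact: DA|exact: lA]. Qed.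

Let EDD h k : E h -> E k -> E (fun o => h o + k o).
Proof. by move=> [Dh lh] [Dk lk]; split; [exact: DD|rewrite /= lD// lh lk addr0]. Qed.

Let EZZ c h : E h -> E (fun o => c * h o).
Proof. by move=> [Dh lh]; split; [exact: DZ|rewrite /= lZ// lh mulr0]. Qed.

Let EBB h k : E h -> E k -> E (fun o => h o - k o).
Proof. by move=> [Dh lh] [Dk lk]; split; [exact: DB|rewrite /= lB// lh lk subr0]. Qed.

Let E00 : E (fun=> 0).
Proof. by split => //=; have := lZ 0 D0; rewrite !mul0r. Qed.

Let E_closed h : (forall e, 0 < e -> exists k, E k /\ bounded_by (fun o => h o - k o) e) -> E h.
Proof.
move=> H.
have Dh : D (fun x => h (Some x)).
  by apply: D_closed => e /H[k [[Dk _] hk]]; exists (fun x => k (Some x)); split=> // x; exact: (hk (Some x)).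
split=> //; apply/eqP; rewrite -normr_le0; apply/ler_addgt0Pl => e e0; rewrite addr0.
have [k [[Dk lk] hk]] := H (e / Cl) (divr_gt0 e0 Cl0).
have := lb (DB Dh Dk) (fun x => hk (Some x)).
by rewrite lB//= lk subr0 mulrC divfK// gt_eqF.
Qed.

Let DU h : E h -> D (U h). Proof. by move=> [Dh _]; exact: DD. Qed.

Let GU h : E h -> G (U h) = (fun x => lam * om x + G (fun x => h (Some x)) x).
Proof. by move=> [Dh _]; rewrite /U GD// Gom. Qed.

Let GUB h k : E h -> E k ->
  (fun x => G (U h) x - G (U k) x) = G (fun x => h (Some x) - k (Some x)).
Proof.
by move=> Eh Ek; rewrite !GU//; case: Eh Ek => [Dh _] [Dk _]; rewrite GB//; apply/funext => x; ring.
Qed.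

(** The derivative of the Newton map at the base point: the parameter component cancels, [Aom]
    removes the term in [om], and the defect of [A_inv] remains. *)
Let linear_part k M : E k -> bounded_by k M ->
  bounded_by (fun o => k o - Q (fun x => k (Some x) -
    (K1 * lam * k None * om x + K0 * G (fun x => k (Some x)) x)) o) (M / 4).
Proof.
move=> [Dk lk] kM.
pose w x := k (Some x).
have DKw : D (fun x => w x - K0 * G w x) by apply: DB => //; apply: DZ; exact: DG.
have Dc : D (fun x => (K1 * lam * k None) * om x) by exact: DZ.
rewrite (_ : (fun x => k (Some x) - _) =
   (fun x => (w x - K0 * G w x) - (K1 * lam * k None) * om x)); last first.
  by apply/funext => x; rewrite /w; ring.
rewrite QB// QZ//.
move=> [x|] /=; first by rewrite Aom mulr0 subr0; exact: (A_inv Dk lk (fun x => kM (Some x))).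
rewrite lB ?lZ// ?lG//; last 2 first.
  exact: DG.
  by apply: DZ; exact: DG.
rewrite -/w in lk *; rewrite lk lom mulr0 mulr0 subr0 oppr0 mul0r sub0r.
rewrite (_ : k None - _ = 0); last by field; rewrite K10 lam0.
by rewrite normr0; have := le_trans (normr_ge0 _) (kM None); lra.
Qed.

(** At [(s, z) = (0, 0)] the partial derivatives of [P] are [K1 y] and [K0], so the linearisation is
    the operator of [linear_part]; nearby, the modulus in [P_C1] controls the deviation. *)
Let near_base e : 0 < e -> exists2 eta, 0 < eta <= r0 & forall z h, `|z| <= eta -> E h -> bounded_by h eta ->
  [/\ forall x, in_box (h None) z (G (U h) x),
     forall k M, E k -> bounded_by k M ->
      bounded_by (fun x => DN z h k x - (K1 * lam * k None * om x + K0 * G (fun x => k (Some x)) x)) (e * M) &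
     forall h' M, E h' -> bounded_by h' eta -> bounded_by (fun o => h o - h' o) M ->
      bounded_by (fun x => N z h x - N z h' x -
        (K1 * lam * (h None - h' None) * om x + K0 * G (fun x => h (Some x) - h' (Some x)) x)) (e * M)].
Proof.
move=> e0; pose e' := e / (2 * (1 + CG)).
have CG1 : 0 < 1 + CG by rewrite addr_gt0.
have e'0 : 0 < e' by rewrite divr_gt0// mulr_gt0.
have e'e : 2 * (e' * (1 + CG)) = e by rewrite /e'; field; rewrite gt_eqF.
have [q q0 Pq] := P_C1 e'0.
(* [eta <= 1] keeps arguments in the box; the last term keeps increments, up to [2 eta] in [h] and
   [2 CG eta] after [G], below [q]. *)
pose eta := Num.min (Num.min 1 r0) (q / (4 * (1 + CG))).
have c1 : 0 < 4 * (1 + CG) by lra.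
have eta0 : 0 < eta by rewrite !lt_min ltr01 r00 divr_gt0.
have eta1 : eta <= 1 by rewrite !ge_min lexx.
have etar : eta <= r0 by rewrite !ge_min lexx orbT.
have etaq : eta * (4 * (1 + CG)) <= q by rewrite -ler_pdivlMr// !ge_min lexx !orbT.
clearbody eta; have ec : 0 < eta * CG by rewrite mulr_gt0.
have q1 : eta < q by lra.
have q2 : CG * eta < q by lra.
have q3 : 2 * eta < q by lra.
have q4 : CG * (2 * eta) < q by lra.
have lamom x : `|lam * om x| <= `|lam| by rewrite normrM ler_piMr.
have box z h x : `|z| <= eta -> E h -> bounded_by h eta -> in_box (h None) z (G (U h) x).
  move=> zb Eh hb; split; [exact: le_trans etar|exact: le_trans etar|].
  rewrite GU//; case: Eh => Dh _.
  apply: le_trans (ler_normD _ _) _.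
  have ce : CG * eta <= CG by rewrite ler_piMr// ltW.
  apply: le_trans (lerD (lamom x) (Gb Dh (fun x => hb (Some x)) x)) (ltW (le_lt_trans _ Y0)).
  by rewrite addrC lerD2r.
have box0 x : in_box 0 0 (lam * om x).
  split; [by rewrite normr0 ltW|by rewrite normr0 ltW|].
  apply: le_trans (lamom x) (ltW (le_lt_trans _ Y0)).
  by rewrite lerDr ltW.
have PPs z h x : `|z| <= eta -> E h -> bounded_by h eta ->
   `|Ps (h None) z (G (U h) x) - K1 * (lam * om x)| <= e' /\ `|Py (h None) z (G (U h) x) - K0| <= e'.
  move=> zb Eh hb; rewrite -(Ps00 (lam * om x)) -(Py00 (lam * om x)).
  have [|||_ h1 _ h2] := Pq _ _ _ _ _ _ (box0 x) (box z h x zb Eh hb); last by [].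
  - by rewrite subr0; apply: le_lt_trans q1.
  - by rewrite subr0; apply: le_lt_trans q1.
  - rewrite GU// (addrC (lam * om x)) addrK; case: Eh => Dh _.
    exact: le_lt_trans (Gb Dh (fun x => hb (Some x)) x) q2.
exists eta; first by rewrite eta0.
move=> z h zb Eh hb; split=> [x|k M Ek kM x|h' M Eh' hb' hM x]; first exact: box.
- have [h1 h2] := PPs z h x zb Eh hb; case: Ek => Dk _.
  have h3 := Gb Dk (fun x => kM (Some x)) x; have h4 := kM None.
  rewrite /DN (_ : _ - _ = (Ps (h None) z (G (U h) x) - K1 * (lam * om x)) * k None +
     (Py (h None) z (G (U h) x) - K0) * G (fun x => k (Some x)) x); last by ring.
  apply: le_trans (ler_normD _ _) _; rewrite !normrM.
  have := ler_pM (normr_ge0 _) (normr_ge0 _) h1 h4.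
  have := ler_pM (normr_ge0 _) (normr_ge0 _) h2 h3.
  have M0 : 0 <= M := le_trans (normr_ge0 _) h4.
  have : 0 <= e' * (1 + CG) * M by exact: mulr_ge0 (mulr_ge0 (ltW e'0) (ltW CG1)) M0.
  rewrite -e'e; lra.
- have b' := box z h' x zb Eh' hb'; have b := box z h x zb Eh hb.
  have Ehh := EBB Eh Eh'; have [Dhh _] := Ehh.
  have GE : G (U h) x - G (U h') x = G (fun x => h (Some x) - h' (Some x)) x.
    by rewrite -GUB.
  have h3 := Gb Dhh (fun x => hM (Some x)) x; have h4 := hM None.
  have M0 : 0 <= M := le_trans (normr_ge0 _) h4.
  have n0 o : `|h o - h' o| <= 2 * eta.
    by apply: le_trans (ler_normB _ _) _; have := hb o; have := hb' o; lra.
  have [|||h5 _ _ _] := Pq _ _ _ _ _ _ b' b.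
  - exact: le_lt_trans (n0 _) q3.
  - by rewrite subrr normr0.
  - by rewrite GE; apply: le_lt_trans (Gb Dhh (fun x => n0 (Some x)) x) q4.
  have [h1 h2] := PPs z h' x zb Eh' hb'.
  rewrite /N -GE in h3 *; rewrite subrr normr0 mulr0 addr0 subr0 in h5.
  set y := G (U h) x in h3 h5 *; set y' := G (U h') x in h1 h2 h3 h5 *.
  rewrite (_ : _ - _ = (P (h None) z y - P (h' None) z y' - Ps (h' None) z y' * (h None - h' None) -
      Py (h' None) z y' * (y - y')) + ((Ps (h' None) z y' - K1 * (lam * om x)) * (h None - h' None) +
      (Py (h' None) z y' - K0) * (y - y'))); last by ring.
  apply: le_trans (ler_normD _ _) (le_trans (lerD h5 (ler_normD _ _)) _); rewrite !normrM.
  have := ler_pM (normr_ge0 _) (normr_ge0 _) h1 h4.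
  have := ler_pM (normr_ge0 _) (normr_ge0 _) h2 h3.
  rewrite -e'e; move: h3 h4; move: (`|h None - h' None|) (`|y - y'|) => p p' h3 h4.
  have : e' * p' <= e' * (CG * M) by rewrite ler_wpM2l// ltW.
  have : e' * p <= e' * M by rewrite ler_wpM2l// ltW.
  lra.
Qed.

Let comp_D (phi : R -> R -> R -> R) s z u : D u -> (forall x, in_box s z (u x)) ->
  (forall e, 0 < e -> exists2 q, 0 < q & forall a b, in_box s z a -> in_box s z b -> `|b - a| < q ->
     `|phi s z b - phi s z a| <= e) -> D (fun x => phi s z (u x)).
Proof.
move=> Du ub H.
(* On an empty [X] the hypothesis says nothing about [s] and [z], but then all functions
   coincide. *)
have [[x0]|nX] := pselect (inhabited X); last first.
  by rewrite (_ : (fun x => _) = u)//; apply/funext => x; exfalso; apply: nX.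
have [b1 b2 _] := ub x0.
apply: (@D_comp (phi s z)) => //; first by move=> x; have [] := ub x.
move=> e /H[q q0 Hq]; exists q => // a b aY bY; exact: Hq.
Qed.

Let P_lip : exists2 q, 0 < q & forall s z z' y y', in_box s z y -> in_box s z' y' ->
  `|z' - z| < q -> `|y' - y| < q -> `|P s z' y' - P s z y| <= (CP + 1) * (`|z' - z| + `|y' - y|).
Proof.
have [q q0 Pq] := P_C1 ltr01; exists q => // s z z' y y' b b' zq yq.
have [|||h _ _ _] := Pq _ _ _ _ _ _ b b' => //; first by rewrite subrr normr0.
have [_ _ h1 h2] := P_bounded b.
rewrite subrr normr0 mulr0 add0r subr0 mul1r in h.
rewrite (_ : P s z' y' - P s z y = (P s z' y' - P s z y - Pz s z y * (z' - z) - Py s z y * (y' - y)) +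
  (Pz s z y * (z' - z) + Py s z y * (y' - y))); last by ring.
apply: le_trans (ler_normD _ _) (le_trans (lerD h (ler_normD _ _)) _); rewrite !normrM.
have := ler_wpM2r (normr_ge0 (z' - z)) h1; have := ler_wpM2r (normr_ge0 (y' - y)) h2.
lra.
Qed.

Let DNm z h : E h -> (forall x, in_box (h None) z (G (U h) x)) ->
  [/\ D (N z h), D (bN z h) & forall k, E k -> D (DN z h k)].
Proof.
move=> Eh hb; have DGU := DG (DU Eh).
have partial_D (phi : R -> R -> R -> R) : (forall e, 0 < e -> exists2 q, 0 < q & forall s z y s' z' y',
    in_box s z y -> in_box s' z' y' -> `|s' - s| < q -> `|z' - z| < q -> `|y' - y| < q ->
    `|phi s' z' y' - phi s z y| <= e) -> D (fun x => phi (h None) z (G (U h) x)).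
  move=> H; apply: comp_D => // e /H[q q0 Hq]; exists q => // a b ab bb d.
  by apply: Hq => //; rewrite subrr normr0.
split.
- apply: comp_D => // e e0; have [q q0 Hq] := P_lip.
  have CP1 : 0 < `|CP| + 1 by [].
  exists (Num.min q (e / (`|CP| + 1))); first by rewrite lt_min q0 divr_gt0.
  move=> a b ab bb; rewrite lt_min => /andP[d1 d2].
  apply: le_trans (Hq _ _ _ _ _ ab bb _ d1) _; first by rewrite subrr normr0.
  rewrite subrr normr0 add0r; move: d2; rewrite ltr_pdivlMr// => d2.
  have := ler_norm CP; have := normr_ge0 (b - a); nra.
- by apply: partial_D => e /P_C1[q q0 Hq]; exists q => // s z0 y s' z' y' b b' d1 d2 d3; have [] := Hq _ _ _ _ _ _ b b' d1 d2 d3.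
- move=> k [Dk _]; apply: DD.
    rewrite (_ : (fun x => _) = (fun x => k None * Ps (h None) z (G (U h) x))); last first.
      by apply/funext => x; rewrite mulrC.
    apply: DZ; apply: partial_D => e /P_C1[q q0 Hq]; exists q => // s z0 y s' z' y' b b' d1 d2 d3.
    by have [] := Hq _ _ _ _ _ _ b b' d1 d2 d3.
  apply: DM; last exact: DG.
  apply: partial_D => e /P_C1[q q0 Hq]; exists q => // s z0 y s' z' y' b b' d1 d2 d3.
  by have [] := Hq _ _ _ _ _ _ b b' d1 d2 d3.
Qed.

Let U0 : U (fun=> 0) = om.
Proof. by apply/funext => x; rewrite /U addr0. Qed.

Let N00 : N 0 (fun=> 0) = om.
Proof. by apply/funext => x; rewrite /N U0 Gom P00 mulrA (mulrC K0) lamK0 mul1r. Qed.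

Let Q0 : Q (fun=> 0) = (fun=> 0).
Proof. by have := QZ 0 D0; rewrite mul0r => ->; apply/funext => o; rewrite mul0r. Qed.

(** Ensures that fixed points of [F] solve the equation itself and not merely its image under [Q]:
    the components give [A r = 0] and [l r = 0]. *)
Let Q_inj r : D r -> Q r = (fun=> 0) -> r = (fun=> 0).
Proof.
move=> Dr Qr; apply: A_inj => //; first by apply/funext => x; exact: (congr1 (@^~ (Some x)) Qr).
have /eqP := congr1 (@^~ None) Qr; rewrite /Q mulf_eq0 oppr_eq0 invr_eq0 mulf_eq0.
by rewrite (negbTE K10) (negbTE lam0) !orbF => /eqP.
Qed.

Let F00 : F 0 (fun=> 0) = (fun=> 0).
Proof.
apply/funext => o; rewrite /F (_ : (fun x => _) = (fun=> 0)) ?Q0 ?subr0//.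
by apply/funext => x; rewrite U0 N00 subrr.
Qed.

(** The Crandall-Rabinowitz theorem for the equation already divided by [z]. [F z] contracts by 1/2
    on normalised pairs, a quarter coming from the defect of [A] and a quarter from the
    nonlinearity; its fixed point gives the curve and its uniqueness, and [contraction_C1] the
    regularity. *)
Theorem simple_eigenvalue_branch :
  exists (delta eta : R) (V V' : R -> X -> R) (S S' : R -> R) (C : R),
  [/\ 0 < delta <= r0, 0 < eta <= r0, V 0 = om /\ S 0 = 0,
    forall z, `|z| < delta -> [/\ D (V z), l (V z) = 1, `|S z| <= eta,
      bounded_by (fun x => V z x - om x) eta &
      (forall x, `|G (V z) x| <= Y) /\ forall x, V z x = P (S z) z (G (V z) x)] &
  [/\ forall z s u, `|z| < delta -> D u -> l u = 1 -> `|s| <= eta ->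
      bounded_by (fun x => u x - om x) eta -> (forall x, u x = P s z (G u x)) ->
      u = V z /\ s = S z,
    forall z, `|z| < delta -> [/\ D (V' z), l (V' z) = 0, bounded_by (V' z) C & `|S' z| <= C],
    forall e, 0 < e -> exists2 q : R, 0 < q & forall z z', `|z| < delta -> `|z'| < delta -> `|z' - z| < q ->
      bounded_by (fun x => V z' x - V z x - (z' - z) * V' z x) (e * `|z' - z|) /\
      bounded_by (fun x => V' z' x - V' z x) e &
    forall e, 0 < e -> exists2 q : R, 0 < q & forall z z', `|z| < delta -> `|z'| < delta -> `|z' - z| < q ->
      `|S z' - S z - (z' - z) * S' z| <= e * `|z' - z| /\ `|S' z' - S' z| <= e]].
Proof.
(* This tolerance becomes the quarter left to the nonlinearity after [Q], whose norm is at most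
   [CQ]. *)
have CQ4 : 0 < (4 * CQ)^-1 by rewrite invr_gt0 mulr_gt0.
have [eta /andP[eta0 etar] nb] := near_base CQ4.
have [q q0 Plip] := P_lip.
have CP1 : 0 < CP + 1 by rewrite ltr_wpDl.
pose C := 2 * CQ * (CP + 1).
have C0 : 0 < C by rewrite !mulr_gt0.
(* [q / 2] makes any two parameters closer than [q]. As [F 0 0 = 0] and [F] has Lipschitz constant
   [C / 2] in [z], [eta / C] gives [|F z 0| <= eta / 2]. *)
pose delta := Num.min eta (Num.min (q / 2) (eta / C)).
have delta0 : 0 < delta by rewrite !lt_min eta0 !divr_gt0.
have deltae : delta <= eta by rewrite ge_min lexx.
have deltaq : delta <= q / 2 by rewrite !ge_min lexx orbT.
have deltaC : delta * C <= eta by rewrite -ler_pdivlMr// !ge_min lexx !orbT.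
clearbody delta.
have zeta z : `|z| < delta -> `|z| <= eta by move=> /ltW/le_trans; exact.
have FB z h h' : `|z| < delta -> E h -> E h' -> bounded_by h eta -> bounded_by h' eta ->
    (fun o => F z h o - F z h' o) = (fun o => (h o - h' o) -
      Q (fun x => (h (Some x) - h' (Some x)) - (N z h x - N z h' x)) o).
  move=> zd Eh Eh' hb hb'.
  have [b _ _] := nb z h (zeta z zd) Eh hb; have [b' _ _] := nb z h' (zeta z zd) Eh' hb'.
  have [Dh _] := Eh; have [Dh' _] := Eh'.
  have [DNh _ _] := DNm Eh b; have [DNh' _ _] := DNm Eh' b'.
  rewrite (_ : (fun x => h (Some x) - h' (Some x) - (N z h x - N z h' x)) =
     (fun x => (U h x - N z h x) - (U h' x - N z h' x))); last first.
    by apply/funext => x; rewrite /U; ring.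
  rewrite QB; last 2 first.
    - exact: DB (DU Eh) DNh.
    - exact: DB (DU Eh') DNh'.
  by apply/funext => o; rewrite /F; ring.
have Dlin k : E k -> D (fun x => K1 * lam * k None * om x + K0 * G (fun x => k (Some x)) x).
  by move=> [Dk _]; apply: DD; apply: DZ => //; exact: DG.
have linQ k T M : E k -> D T -> bounded_by k M ->
    bounded_by (fun x => T x - (K1 * lam * k None * om x + K0 * G (fun x => k (Some x)) x)) ((4 * CQ)^-1 * M) ->
    bounded_by (fun o => k o - Q (fun x => k (Some x) - T x) o) (M / 2).
  move=> Ek DT kM Tb o; have [Dk _] := Ek; have Dl := Dlin k Ek.
  have h1 := linear_part Ek kM o; have h2 := Qb (DB DT Dl) Tb o.
  rewrite QB// in h1; rewrite QB// in h2; rewrite QB//.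
  have CM : CQ * ((4 * CQ)^-1 * M) = M / 4 by field; rewrite gt_eqF.
  rewrite CM in h2.
  rewrite (_ : M / 2 = M / 4 + M / 4); last by field.
  move: h1 h2; set a := Q _ o; set b := Q _ o; set c := Q _ o => h1 h2.
  rewrite (_ : k o - (a - c) = (k o - (a - b)) + (c - b)); last by ring.
  exact: le_trans (ler_normD _ _) (lerD h1 h2).
have FE z h : `|z| < delta -> E h -> bounded_by h eta -> E (F z h).
  move=> zd Eh hb; have [b _ _] := nb z h (zeta z zd) Eh hb; have [DNh _ _] := DNm Eh b.
  by apply: EBB => //; apply: EQ; apply: DB => //; exact: DU.
have Fc z : `|z| < delta -> forall h k M, E h -> E k -> bounded_by h eta -> bounded_by k eta ->
    bounded_by (fun t => h t - k t) M -> bounded_by (fun t => F z h t - F z k t) (M / 2).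
  move=> zd h k M Eh Ek hb kb hkM; rewrite FB//.
  have [b _ bl] := nb z h (zeta z zd) Eh hb; have [b' _ _] := nb z k (zeta z zd) Ek kb.
  have [DNh _ _] := DNm Eh b; have [DNk _ _] := DNm Ek b'.
  apply: (@linQ (fun o => h o - k o)) => //; [exact: EBB|exact: DB|exact: bl].
have DNz z z' h : `|z| < delta -> `|z'| < delta -> E h -> bounded_by h eta ->
    bounded_by (fun o => F z' h o - F z h o) (C / 2 * `|z' - z|).
  move=> zd z'd Eh hb.
  have [b _ _] := nb z h (zeta z zd) Eh hb; have [b' _ _] := nb z' h (zeta z' z'd) Eh hb.
  have [DNh _ _] := DNm Eh b; have [DNh' _ _] := DNm Eh b'.
  have zz : `|z' - z| < q by apply: le_lt_trans (ler_normB _ _) _; lra.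
  rewrite (_ : (fun o => _) = Q (fun x => N z' h x - N z h x)); last first.
    rewrite QB//; apply/funext => o; rewrite /F !QB//; try exact: DU.
    by ring.
  rewrite (_ : C / 2 * `|z' - z| = CQ * ((CP + 1) * `|z' - z|)); last by rewrite /C; field.
  apply: Qb; first exact: DB.
  move=> x; have := Plip _ _ _ _ _ (b x) (b' x) zz; rewrite subrr normr0 addr0; exact.
have F0 z : `|z| < delta -> bounded_by (F z (fun=> 0)) (eta / 2).
  move=> zd o; have e0b : bounded_by (fun _ : option X => 0 : R) eta by move=> o'; rewrite normr0 ltW.
  have d0 : `|0 : R| < delta by rewrite normr0.
  have := DNz 0 z (fun=> 0) d0 zd E00 e0b o; rewrite F00 !subr0 => /le_trans; apply.
  have : `|z| * C <= delta * C by rewrite ler_wpM2r// ltW.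
  lra.
have exg z : exists h, `|z| < delta -> [/\ E h, bounded_by h eta & F z h = h].
  have [zd|_] := boolP (`|z| < delta); last by exists (fun=> 0).
  have [h hP] := contraction_fixpoint E00 E_closed eta0 (FE z ^~ zd) (Fc z zd) (F0 z zd).
  by exists h.
have {exg} [g gP] := choice exg.
have FQ z h : `|z| < delta -> E h -> bounded_by h eta ->
    F z h = h <-> forall x, U h x = N z h x.
  move=> zd Eh hb.
  have [b _ _] := nb z h (zeta z zd) Eh hb; have [DNh _ _] := DNm Eh b.
  split=> [Fh x|UN].
    have /Q_inj H : D (fun x => U h x - N z h x) by apply: DB => //; exact: DU.
    have /H : Q (fun x => U h x - N z h x) = (fun=> 0).
      apply/funext => o; have := congr1 (@^~ o) Fh; rewrite /F => h1.
      by apply/eqP; rewrite -oppr_eq0 -(subrr (h o)) -{1}h1; apply/eqP; ring.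
    by move=> /(congr1 (@^~ x))/eqP; rewrite subr_eq0 => /eqP.
  apply/funext => o; rewrite /F (_ : (fun x => _) = (fun=> 0)) ?Q0 ?subr0//.
  by apply/funext => x; rewrite UN subrr.
(* Changing the parameter costs [C / 2 |z' - z|]; the change of argument is halved by [F z'] and
   absorbed. *)
have gL z z' : `|z| < delta -> `|z'| < delta -> bounded_by (fun o => g z' o - g z o) (C * `|z' - z|).
  move=> zd z'd.
  have [Eg gb Fg] := gP z zd; have [Eg' gb' Fg'] := gP z' z'd.
  rewrite (_ : C * _ = 2 * (C / 2 * `|z' - z|)); last by field.
  apply: (@contraction_absorb _ _ _ _ (eta + eta)).
    by move=> o; apply: le_trans (ler_normB _ _) (lerD _ _).
  move=> M bM o; rewrite -{1}Fg' -{1}Fg.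
  rewrite (_ : F z' (g z') o - F z (g z) o =
     (F z' (g z) o - F z (g z) o) + (F z' (g z') o - F z' (g z) o)); last by ring.
  apply: le_trans (ler_normD _ _) (lerD _ _); first exact: DNz.
  exact: Fc.
have g0 : g 0 = (fun=> 0).
  have d0 : `|0 : R| < delta by rewrite normr0.
  have [Eg gb Fg] := gP 0 d0.
  by apply: (contraction_unique (Fc 0 d0)) => // o; rewrite normr0 ltW.
have box z : `|z| < delta -> forall x, in_box (g z None) z (G (U (g z)) x).
  by move=> zd; have [Eg gb _] := gP z zd; have [] := nb z (g z) (zeta z zd) Eg gb.
have DE z : `|z| < delta -> forall k, E k -> D (DN z (g z) k).
  by move=> zd; have [Eg _ _] := gP z zd; have [] := DNm Eg (box z zd).
have Db z : `|z| < delta -> D (bN z (g z)).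
  by move=> zd; have [Eg _ _] := gP z zd; have [] := DNm Eg (box z zd).
have [||||||||y [yE yC]] := @contraction_C1 _ _ E E00 E_closed EDD EZZ g
  (fun z => DF z (g z)) (fun z => bF z (g z)) delta C C0.
- by move=> z /gP[].
- by move=> z h zd Eh; apply: EBB => //; apply: EQ; apply: DB; [case: Eh|exact: DE].
- move=> z h k zd Eh Ek; have [Dh _] := Eh; have [Dk _] := Ek.
  have Dhk := DB Dh (DE _ zd _ Eh).
  rewrite /DF; apply/funext => o.
  rewrite (_ : (fun x => h (Some x) + k (Some x) - DN z (g z) (fun t => h t + k t) x) =
    (fun x => (h (Some x) - DN z (g z) h x) - (-1 * (k (Some x) - DN z (g z) k x)))); last first.
    by apply/funext => x; rewrite /DN GD//; ring.
  have DKk := DB Dk (DE _ zd _ Ek).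
  by rewrite (QB Dhk (DZ (-1) DKk)) (QZ (-1) DKk); ring.
- move=> z c h zd Eh; have [Dh _] := Eh.
  rewrite /DF; apply/funext => o.
  rewrite (_ : (fun x => c * h (Some x) - DN z (g z) (fun t => c * h t) x) =
    (fun x => c * (h (Some x) - DN z (g z) h x))); last first.
    by apply/funext => x; rewrite /DN GZ//; ring.
  by rewrite (QZ c (DB Dh (DE _ zd _ Eh))); ring.
- move=> z h M zd Eh hM; have [Eg gb _] := gP z zd.
  have [_ bl _] := nb z (g z) (zeta z zd) Eg gb.
  by apply: linQ => //; [exact: DE|exact: bl].
- move=> z zd; split; first by apply: EQ; exact: Db.
  move=> o; have : bounded_by (bN z (g z)) CP by move=> x; have [] := P_bounded (box z zd x).
  move=> /(Qb (Db z zd))/(_ o)/le_trans; apply.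
  by have := CP0; rewrite /C; have := CQ0; nra.
- exact: gL.
(* [m] adds the Lipschitz constants along the curve of the unknown, of [z] and of the argument of
   [P]; [c] covers the three estimates after [Q]. *)
- move=> e e0; pose m := C + 1 + CG * C.
  have CC : 0 < CG * C by rewrite mulr_gt0.
  have m0 : 0 < m by rewrite !addr_gt0.
  have c1 : 0 < m + 1 + CG by rewrite !addr_gt0.
  pose c := CQ * (m + 1 + CG).
  have c0 : 0 < c by rewrite mulr_gt0.
  have ec0 : 0 < e / c by rewrite divr_gt0.
  have [p p0 Pp] := P_C1 ec0.
  pose r := p / m.
  have r0' : 0 < r by rewrite divr_gt0.
  have rle t : t <= m -> t * r <= p by move=> tm; rewrite /r mulrA ler_pdivrMr// mulrC ler_pM2l.
  have rC : C * r <= p by apply: rle; rewrite /m -addrA lerDl addr_ge0// ltW.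
  have r1 : r <= p by rewrite -[r]mul1r rle// /m addrAC lerDr addr_ge0// ltW.
  have rG : CG * C * r <= p by apply: rle; rewrite /m lerDr addr_ge0// ltW.
  have ect M t : 0 <= M -> t <= (m + 1 + CG) * M -> e / c * CQ * t <= e * M.
    move=> M0 tM; rewrite (_ : e / c * CQ * t = e * (t / (m + 1 + CG))).
      by rewrite ler_pM2l// ler_pdivrMr// mulrC.
    by rewrite /c; field; rewrite !gt_eqF.
  exists r => // z z' zd z'd zz.
  have [Eg gb Fg] := gP z zd; have [Eg' gb' Fg'] := gP z' z'd.
  have kb := gL z z' zd z'd.
  have Ek := EBB Eg' Eg; have [Dk _] := Ek.
  have [b b'] := (box z zd, box z' z'd).
  have [DNh _ _] := DNm Eg b; have [DNh' _ _] := DNm Eg' b'.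
  have GE x : G (U (g z')) x - G (U (g z)) x = G (fun x => g z' (Some x) - g z (Some x)) x.
    by rewrite -GUB.
  have Gk x := Gb Dk (fun x => kb (Some x)) x.
  have PP x := Pp _ _ _ _ _ _ (b x) (b' x).
  have lt1 : `|g z' None - g z None| < p by apply: le_lt_trans (kb None) (lt_le_trans _ rC); rewrite ltr_pM2l.
  have lt2 : `|z' - z| < p by exact: lt_le_trans r1.
  have lt3 x : `|G (U (g z')) x - G (U (g z)) x| < p.
    by rewrite GE; apply: le_lt_trans (Gk x) (lt_le_trans _ rG); rewrite mulrA ltr_pM2l.
  have {}PP x := PP x lt1 lt2 (lt3 x).
  split.
  + move=> o.
    have DDk := DE z zd _ Ek; have Dbz := Db z zd.
    (* At fixed points [Q (U (g z)) = Q (N z (g z))], so the remainder is [Q] applied to the Taylor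
       remainder of [P] along the curve. *)
    rewrite (_ : _ - _ = Q (fun x => (N z' (g z') x - N z (g z) x) - (DN z (g z) (fun o => g z' o - g z o) x - (z - z') * bN z (g z) x)) o); last first.
      have Dx := DB DDk (DZ (z - z') Dbz).
      have FE' z1 h : E h -> D (N z1 h) -> F z1 h o = h o - (Q (U h) o - Q (N z1 h) o).
        by move=> Eh DNh1; rewrite /F (QB (DU Eh) DNh1).
      have QU : Q (fun x => g z' (Some x) - g z (Some x)) o = Q (U (g z')) o - Q (U (g z)) o.
        have /(congr1 (@^~ o)) <- := QB (DU Eg') (DU Eg).
        by congr Q; apply/funext => x; rewrite /U; ring.
      rewrite (QB (DB DNh' DNh) Dx) (QB DDk (DZ (z - z') Dbz)) (QZ _ Dbz) (QB DNh' DNh).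
      rewrite /DF /bF (QB Dk DDk) QU.
      have subE (t p1 p2 : R) : t - (p1 - p2) = t -> p1 = p2.
        by move=> /eqP; rewrite -subr_eq0 addrAC subrr add0r oppr_eq0 subr_eq0 => /eqP.
      have := congr1 (@^~ o) Fg; have := congr1 (@^~ o) Fg'; rewrite !FE'//.
      by move=> /subE <- /subE <-; ring.
    have Dall : D (fun x => (N z' (g z') x - N z (g z) x) - (DN z (g z) (fun o => g z' o - g z o) x - (z - z') * bN z (g z) x)).
      by apply: DB; [exact: DB|apply: DB => //; exact: DZ].
    have H : bounded_by (fun x => (N z' (g z') x - N z (g z) x) - (DN z (g z) (fun o => g z' o - g z o) x - (z - z') * bN z (g z) x))
       (e / c * (C * `|z' - z| + `|z' - z| + CG * (C * `|z' - z|))).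
      move=> x; have [h1 _ _ _] := PP x.
      rewrite /DN -GE /N /bN.
      rewrite (_ : _ - _ - _ = P (g z' None) z' (G (U (g z')) x) - P (g z None) z (G (U (g z)) x) -
          Ps (g z None) z (G (U (g z)) x) * (g z' None - g z None) -
          Pz (g z None) z (G (U (g z)) x) * (z' - z) -
          Py (g z None) z (G (U (g z)) x) * (G (U (g z')) x - G (U (g z)) x)); last by ring.
      apply: le_trans h1 _; rewrite ler_wpM2l//; first exact: ltW.
      by apply: lerD; [apply: lerD => //; exact: kb None|rewrite GE].
    apply: le_trans (Qb Dall H o) _.
    rewrite mulrA (mulrC CQ); apply: ect => //.
    rewrite (_ : _ + CG * _ = m * `|z' - z|); last by rewrite /m; ring.
    by rewrite ler_wpM2r// -addrA lerDl addr_ge0// ltW.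
  + move=> h M Eh hM o; have [Dh _] := Eh.
    rewrite (_ : _ - _ = Q (fun x => DN z' (g z') h x - DN z (g z) h x) o); last first.
      have [D1 D2] := (DE z zd _ Eh, DE z' z'd _ Eh).
      by rewrite (QB D2 D1) /DF (QB Dh D1) (QB Dh D2); ring.
    have H : bounded_by (fun x => DN z' (g z') h x - DN z (g z) h x) (e / c * (M + CG * M)).
      move=> x; have [_ h1 _ h2] := PP x.
      rewrite /DN (_ : _ - _ = (Ps (g z' None) z' (G (U (g z')) x) - Ps (g z None) z (G (U (g z)) x)) * h None +
        (Py (g z' None) z' (G (U (g z')) x) - Py (g z None) z (G (U (g z)) x)) * G (fun x => h (Some x)) x); last by ring.
      apply: le_trans (ler_normD _ _) _; rewrite !normrM mulrDr; apply: lerD.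
        by apply: ler_pM.
      by apply: ler_pM => //; exact: (Gb Dh (fun x => hM (Some x))).
    apply: le_trans (Qb (DB (DE z' z'd _ Eh) (DE z zd _ Eh)) H o) _.
    have M0 : 0 <= M := le_trans (normr_ge0 _) (hM None).
    rewrite mulrA (mulrC CQ); apply: ect => //.
    by rewrite -[X in X + _ <= _]mul1r -mulrDl ler_wpM2r// lerD2r lerDr ltW.
  + move=> o; have [Db1 Db2] := (Db z zd, Db z' z'd).
    rewrite (_ : _ - _ = Q (fun x => bN z' (g z') x - bN z (g z) x) o); last by rewrite (QB Db2 Db1).
    have H : bounded_by (fun x => bN z' (g z') x - bN z (g z) x) (e / c).
      by move=> x; have [_ _ h1 _] := PP x.
    apply: le_trans (Qb (DB Db2 Db1) H o) _.
    rewrite mulrC -[leLHS]mulr1 -[leRHS]mulr1; apply: ect => //.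
    by rewrite mulr1 addrAC lerDr addr_ge0// ltW.
exists delta, eta, (fun z => U (g z)), (fun z x => y z (Some x)), (fun z => g z None), (fun z => y z None), (2 * C).
split; [by rewrite delta0 (le_trans deltae)|by rewrite eta0| by rewrite g0 U0| |].
  move=> z zd; have [Eg gb Fg] := gP z zd; split=> //; first exact: DU.
  - by case: Eg => Dg lg; rewrite /U lD// lom lg addr0.
  - by move=> x; rewrite /U addrAC subrr add0r; exact: (gb (Some x)).
  - by split=> x; [have [] := box z zd x|exact: (FQ z _ zd Eg gb).1].
split.
- move=> z s u zd Du lu sb ub uP.
  pose h o := if o is Some x then u x - om x else s.
  have Eh : E h by split; [exact: DB|rewrite /h lB// lu lom subrr].
  have Uh : U h = u by apply/funext => x; rewrite /U /h addrC subrK.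
  have hb : bounded_by h eta by move=> [x|]; [exact: ub|].
  have Fh : F z h = h by apply/FQ => // x; rewrite /N Uh; exact: uP.
  have [Eg gb Fg] := gP z zd.
  have hg : h = g z by apply: (contraction_unique (Fc z zd)).
  by rewrite -hg Uh.
- by move=> z /yE[[Dy ly] yb]; split=> [//|//|x|]; [exact: (yb (Some x))|exact: (yb None)].
- move=> e /yC[r r0' rP]; exists r => // z z' zd z'd zz; have [h1 h2] := rP z z' zd z'd zz.
  split=> x; last exact: (h2 (Some x)).
  by have := h1 (Some x); rewrite /U; congr (`| _ | <= _); ring.
- move=> e /yC[r r0' rP]; exists r => // z z' zd z'd zz; have [h1 h2] := rP z z' zd z'd zz.
  by split; [exact: (h1 None)|exact: (h2 None)].
Qed.

End simple_eigenvalue.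

(** * Truncated Gaussians *)

Section gaussian_tail.
Context {R : realType}.
Implicit Types (a p q x y s t : R).
Local Notation leb := (@lebesgue_measure R).

Lemma is_derive_continuous (f : R -> R) x d : is_derive x 1 f d -> {for x, continuous f}.
Proof. by move=> [df _]; apply: differentiable_continuous; exact/derivable1_diffP. Qed.

Lemma ge0_derive_le (f df : R -> R) x y : x <= y ->
  (forall t, x <= t <= y -> is_derive t 1 f (df t)) -> (forall t, x <= t <= y -> 0 <= df t) ->
  f x <= f y.
Proof.
move=> xy fd df0.
have [||c] := @MVT_segment _ f df x y xy.
- by move=> t; rewrite in_itv /= => /andP[xt ty]; apply: fd; rewrite !ltW.
- apply: derivable_within_continuous => t; rewrite in_itv /= => txy.
  by have [] := fd t txy.
rewrite in_itv /= => cxy e; rewrite -subr_ge0 e mulr_ge0 ?df0// subr_ge0//.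
Qed.

Lemma der_ext (f g : R -> R) x df dg :
  is_derive x 1 f df -> (forall t, f t = g t) -> df = dg -> is_derive x 1 g dg.
Proof. by move=> hf /funext <- <-. Qed.

Lemma der_comp (f g : R -> R) x df dg : is_derive (g x) 1 f df -> is_derive x 1 g dg ->
  is_derive x 1 (fun t => f (g t)) (df * dg).
Proof. by move=> hf hg; exact: is_derive1_comp. Qed.

Lemma der_add (f g : R -> R) x df dg : is_derive x 1 f df -> is_derive x 1 g dg ->
  is_derive x 1 (fun t => f t + g t) (df + dg).
Proof. by move=> hf hg; exact: is_deriveD. Qed.

Lemma der_opp (f : R -> R) x df : is_derive x 1 f df -> is_derive x 1 (fun t => - f t) (- df).
Proof. by move=> hf; exact: is_deriveN. Qed.

Lemma der_sub (f g : R -> R) x df dg : is_derive x 1 f df -> is_derive x 1 g dg ->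
  is_derive x 1 (fun t => f t - g t) (df - dg).
Proof. by move=> hf hg; exact: is_deriveB. Qed.

Lemma der_mul (f g : R -> R) x df dg : is_derive x 1 f df -> is_derive x 1 g dg ->
  is_derive x 1 (fun t => f t * g t) (df * g x + f x * dg).
Proof.
move=> hf hg; have h := is_deriveM hf hg.
by apply: (is_derive_eq h); rewrite /GRing.scale /= addrC mulrC.
Qed.

Lemma der_inv (f : R -> R) x df : f x != 0 -> is_derive x 1 f df ->
  is_derive x 1 (fun t => (f t)^-1) (- (f x) ^- 2 * df).
Proof. by move=> f0 hf; exact: is_deriveV. Qed.

Lemma der_cst (c x : R) : is_derive x 1 (fun=> c) 0.
Proof. exact: is_derive_cst. Qed.

Lemma der_id x : is_derive x 1 (fun t : R => t) 1.
Proof. exact: is_derive_id. Qed.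

(** By reflection this is the mass of [exp (- (s - q) ^ 2)] on [s >= 0]. *)
Definition gtail q : R := \int[leb]_(t in `]-oo, q]) gauss_fun t.

Lemma integrable_gauss_itv (i : interval R) : leb.-integrable [set` i] (EFin \o @gauss_fun R).
Proof. by apply: (integrableS measurableT) => //; exact: integrableT_gauss. Qed.

Lemma is_derive_gtail q : is_derive q 1 gtail (gauss_fun q).
Proof.
have [||||d e] := @continuous_FTC1 R (@gauss_fun R) -oo%O q (q + 1).
- by rewrite ltrDl.
- exact: integrable_gauss_itv.
- by rewrite ltNyr.
- exact: continuous_gauss_fun.
apply: DeriveDef; first exact: d.
by rewrite -derive1E; exact: e.
Qed.

Lemma gtail_ge0 q : 0 <= gtail q.
Proof. by apply: Rintegral_ge0 => t _; exact: gauss_fun_ge0. Qed.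

Lemma gtail_homo : {homo gtail : x y / x <= y}.
Proof.
move=> x y xy; apply: (ge0_derive_le xy) => t _; first exact: is_derive_gtail.
exact: gauss_fun_ge0.
Qed.

(** By monotonicity a zero would propagate to the left, and the mean value theorem would produce a
    zero of the Gaussian. *)
Lemma gtail_gt0 q : 0 < gtail q.
Proof.
rewrite lt_neqAle gtail_ge0 andbT eq_sym; apply/eqP => g0.
have gx x : x <= q -> gtail x = 0.
  by move=> xq; apply/eqP; rewrite eq_le gtail_ge0 andbT -g0 gtail_homo.
have [|||c] := @MVT R gtail (@gauss_fun R) (q - 1) q; first by rewrite ltrBlDr ltrDl.
- by move=> t _; exact: is_derive_gtail.
- apply: derivable_within_continuous => t _; by have [] := is_derive_gtail t.
move=> _; rewrite g0 gx; last by rewrite lerBlDr lerDl.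
rewrite subrr opprB addrC subrK mulr1 => /esym/eqP; rewrite gt_eqF//; exact: expR_gt0.
Qed.

Lemma gtail0 : gtail 0 = Num.sqrt pi / 2.
Proof.
have h := @Rintegral_itvB R (@gauss_fun R) -oo%O +oo%O 0 (integrable_gauss_itv _).
have : \int[leb]_(t in `]-oo, +oo[) gauss_fun t - gtail 0 = \int[leb]_(t in `]0, +oo[) gauss_fun t.
  by apply: h.
rewrite Rintegral_itv_obnd_cbnd; last exact: integrable_gauss_itv.
rewrite /Rintegral set_itvNyy integralT_gauss integral0y_gauss /=.
by move=> e; lra.
Qed.

(** Monotonicity gives a limit [l]; with this primitive the Gaussian integral over [[0, +oo[] is
    [sqrt pi / 2 - l], hence [l = 0]. *)
Lemma cvg_gtailN : gtail (- x) @[x --> +oo] --> (0 : R).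
Proof.
have [l hl] : exists l : R, gtail (- x) @[x --> +oo] --> l.
  exists (- sup (range (fun x => - gtail (- x)))).
  rewrite (_ : (fun x => gtail (- x)) = (fun x => - - gtail (- x))); last by apply/funext => x; rewrite opprK.
  apply: cvgN; apply: (@nondecreasing_cvgr _ (fun x => - gtail (- x))); first by move=> x y xy; rewrite lerN2 gtail_homo// lerN2.
  by exists 0 => _ [x _ <-]; rewrite oppr_le0 gtail_ge0.
have hd x : is_derive x 1 (fun x => - gtail (- x)) (gauss_fun x).
  apply: (der_ext (der_opp (der_comp (is_derive_gtail (- x)) (der_opp (der_id x))))) => //.
  by rewrite /gauss_fun sqrrN; ring.
have := @Rintegral_ge0_continuous_FTC2y R (@gauss_fun R) (fun x => - gtail (- x)) 0 (- l).
rewrite /Rintegral integral0y_gauss /= oppr0 gtail0 => H.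
have {H} : Num.sqrt pi / 2 = - l - - (Num.sqrt pi / 2).
  apply: H.
  - by move=> x _; exact: gauss_fun_ge0.
  - by apply: continuous_subspaceT; exact: continuous_gauss_fun.
  - exact: cvgN.
  - by move=> x _; have [] := hd x.
  - rewrite -gtail0 -[in X in _ --> X]oppr0; apply: cvg_at_right_filter.
    exact: (is_derive_continuous (hd 0)).
  - by move=> x _; rewrite derive1E; have [_] := hd x.
by move=> e; suff <- : l = 0 by []; lra.
Qed.

Lemma gauss_scale a p s : gauss (2 * a ^+ 2) p s = gauss_fun (a * (s - p)).
Proof. by rewrite /gauss /gauss_fun; congr expR; field. Qed.

Lemma is_derive_gtail_scale a p s : a != 0 ->
  is_derive s 1 (fun s => - (a^-1 * gtail (a * (p - s)))) (gauss (2 * a ^+ 2) p s).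
Proof.
move=> a0.
have h0 := der_mul (der_cst a s) (der_sub (der_cst p s) (der_id s)).
apply: (der_ext (der_opp (der_mul (der_cst a^-1 s) (@der_comp gtail (fun s => a * (p - s)) _ _ _ (is_derive_gtail _) h0)))) => //.
rewrite gauss_scale (_ : a * (s - p) = - (a * (p - s))); last by ring.
by rewrite /gauss_fun sqrrN; field.
Qed.

Lemma is_derive_gauss_scale a p s : a != 0 ->
  is_derive s 1 (fun s => - ((2 * a ^+ 2)^-1 * gauss (2 * a ^+ 2) p s)) ((s - p) * gauss (2 * a ^+ 2) p s).
Proof.
move=> a0.
have h := der_sub (der_id s) (der_cst p s).
have h0 : is_derive s 1 (fun s => - (2 * a ^+ 2 * (s - p) ^+ 2 / 2)) (- (2 * a ^+ 2 * (s - p))).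
  by apply: (der_ext (der_opp (der_mul (der_cst (a ^+ 2) s) (der_mul h h)))) => [t|]; field.
apply: (der_ext (der_opp (der_mul (der_cst (2 * a ^+ 2)^-1 s) (@der_comp expR _ _ _ _ (is_derive_expR _) h0)))) => //.
by rewrite -/(gauss (2 * a ^+ 2) p s); field.
Qed.

Lemma cvg_scale_pinfty a p : 0 < a -> a * (s - p) @[s --> +oo] --> +oo.
Proof.
move=> a0; apply/cvgryPge => A; near=> s.
by rewrite -ler_pdivrMl// lerBrDr; near: s; apply: nbhs_pinfty_ge; rewrite num_real.
Unshelve. all: by end_near. Qed.

Lemma cvg_gtail_scale a p : 0 < a -> gtail (a * (p - s)) @[s --> +oo] --> (0 : R).
Proof.
move=> a0; have := @cvg_comp _ _ _ (fun s => a * (s - p)) (fun x => gtail (- x)) _ _ _ (@cvg_scale_pinfty a p a0) cvg_gtailN.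
by rewrite (_ : _ \o _ = (fun s => gtail (a * (p - s))))//; apply/funext => s /=; congr gtail; ring.
Qed.

Lemma cvg_gauss_scale a p : 0 < a -> gauss (2 * a ^+ 2) p s @[s --> +oo] --> (0 : R).
Proof.
move=> a0; have := @cvg_comp _ _ _ (fun s => a * (s - p)) (@gauss_fun R) _ _ _ (@cvg_scale_pinfty a p a0) (@cvg_gauss_fun R).
by rewrite (_ : _ \o _ = gauss (2 * a ^+ 2) p)//; apply/funext => s /=; rewrite gauss_scale.
Qed.

Lemma continuous_gauss a p : continuous (gauss (2 * a ^+ 2) p).
Proof.
move=> s; rewrite (_ : gauss _ _ = @gauss_fun R \o (fun s => a * (s - p))); last first.
  by apply/funext => t /=; rewrite gauss_scale.
apply: continuous_comp; last exact: continuous_gauss_fun.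
by apply: cvgM; [exact: cvg_cst|apply: cvgB; [exact: cvg_id|exact: cvg_cst]].
Qed.

Lemma Rintegral_gauss a p : 0 < a ->
  \int[leb]_(s in `[0%R, +oo[) gauss (2 * a ^+ 2) p s = a^-1 * gtail (a * p).
Proof.
move=> a0; have an0 := lt0r_neq0 a0.
rewrite (@Rintegral_ge0_continuous_FTC2y R _ (fun s => - (a^-1 * gtail (a * (p - s)))) 0 0).
- by rewrite subr0 sub0r opprK.
- by move=> s _; exact: expR_ge0.
- by apply: continuous_subspaceT; exact: continuous_gauss.
- rewrite -[X in _ --> X]oppr0 -(mulr0 a^-1); apply: cvgN; apply: cvgM; first exact: cvg_cst.
  exact: cvg_gtail_scale.
- by move=> s _; have [] := @is_derive_gtail_scale a p s an0.
- by apply: cvg_at_right_filter; exact: (is_derive_continuous (@is_derive_gtail_scale a p 0 an0)).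
- by move=> s _; rewrite derive1E; have [] := @is_derive_gtail_scale a p s an0.
Qed.

(** Write [s = p + (s - p)]; the second part has the Gaussian itself as primitive, up to
    [- 2 a ^ 2]. *)
Lemma Rintegral_id_gauss a p : 0 < a ->
  \int[leb]_(s in `[0%R, +oo[) (s * gauss (2 * a ^+ 2) p s) =
  p * (a^-1 * gtail (a * p)) + gauss_fun (a * p) / (2 * a ^+ 2).
Proof.
move=> a0; have an0 := lt0r_neq0 a0.
pose F s := p * (- (a^-1 * gtail (a * (p - s)))) + (- ((2 * a ^+ 2)^-1 * gauss (2 * a ^+ 2) p s)).
have hF s : is_derive s 1 F (s * gauss (2 * a ^+ 2) p s).
  apply: (der_ext (der_add (der_mul (der_cst p s) (@is_derive_gtail_scale a p s an0)) (@is_derive_gauss_scale a p s an0))) => //.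
  by ring.
rewrite (@Rintegral_ge0_continuous_FTC2y R _ F 0 0).
- rewrite /F subr0 gauss_scale !sub0r (_ : a * - p = - (a * p)); last by ring.
  by rewrite /gauss_fun sqrrN; field.
- by move=> s s0; rewrite mulr_ge0//; exact: expR_ge0.
- apply: continuous_subspaceT => s; apply: cvgM; first exact: cvg_id.
  exact: continuous_gauss.
- rewrite -[X in _ --> X]addr0; apply: cvgD.
    rewrite [X in _ --> X](_ : 0 = p * - (a^-1 * 0)); last by ring.
    apply: cvgM; first exact: cvg_cst.
    by apply: cvgN; apply: cvgM; [exact: cvg_cst|exact: cvg_gtail_scale].
  rewrite [X in _ --> X](_ : 0 = - ((2 * a ^+ 2)^-1 * 0)); last by ring.
  apply: cvgN; apply: cvgM; first exact: cvg_cst.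
  exact: cvg_gauss_scale.
- by move=> s _; have [] := hF s.
- by apply: cvg_at_right_filter; exact: (is_derive_continuous (hF 0)).
- by move=> s _; rewrite derive1E; have [] := hF s.
Qed.

(* [gmean q / a] is the mean of the density proportional to [expR (- (a s - q) ^+ 2)]
   on [s >= 0]; [gvar] and [gdvar] are the first two derivatives of [gmean]. *)
Definition mills q : R := gauss_fun q / (2 * gtail q).
Definition gmean q : R := q + mills q.
Definition gvar q : R := 1 - 2 * mills q * gmean q.
Definition gdvar q : R := 2 * mills q * (2 * gmean q * (2 * gmean q - q) - 1).

Lemma gauss_mean a p : 0 < a ->
  (\int[leb]_(s in `[0%R, +oo[) (s * gauss (2 * a ^+ 2) p s)) /
  (\int[leb]_(s in `[0%R, +oo[) gauss (2 * a ^+ 2) p s) = gmean (a * p) / a.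
Proof.
move=> a0; rewrite Rintegral_gauss// Rintegral_id_gauss// /gmean /mills.
by field; rewrite !gt_eqF// gtail_gt0.
Qed.

Lemma mills_gt0 q : 0 < mills q.
Proof. by rewrite divr_gt0 ?expR_gt0// mulr_gt0// gtail_gt0. Qed.

Lemma is_derive_gauss_fun q : is_derive q 1 (@gauss_fun R) (- (2 * q) * gauss_fun q).
Proof.
have h0 : is_derive q 1 (fun s : R => - (s ^+ 2)) (- (2 * q)).
  by apply: (der_ext (der_opp (der_mul (der_id q) (der_id q)))) => [t|]; ring.
apply: (der_ext (@der_comp expR _ _ _ _ (is_derive_expR _) h0)) => //.
by rewrite /gauss_fun; ring.
Qed.

Lemma is_derive_mills q : is_derive q 1 mills (- (2 * mills q * gmean q)).
Proof.
have g0 : 2 * gtail q != 0 by rewrite mulf_neq0 ?pnatr_eq0// gt_eqF// gtail_gt0.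
have hZ := der_mul (der_cst 2 q) (is_derive_gtail q).
apply: (der_ext (der_mul (is_derive_gauss_fun q) (@der_inv (fun q => 2 * gtail q) _ _ g0 hZ))) => //.
by rewrite /gmean /mills; field; rewrite gt_eqF// gtail_gt0.
Qed.

Lemma is_derive_gmean q : is_derive q 1 gmean (gvar q).
Proof. exact: der_add (der_id q) (is_derive_mills q). Qed.

Lemma is_derive_gvar q : is_derive q 1 gvar (gdvar q).
Proof.
apply: (der_ext (der_sub (der_cst 1 q) (der_mul (der_mul (der_cst 2 q) (is_derive_mills q)) (is_derive_gmean q)))) => //.
by rewrite /gdvar /gvar /gmean; ring.
Qed.

(** The origin of [pi] in the threshold on [kappa]. *)
Lemma mills0 : mills 0 ^+ 2 = pi^-1.
Proof.
rewrite /mills gtail0 /gauss_fun expr0n /= oppr0 expR0 mulrCA divff// mulr1 div1r exprVn sqr_sqrtr//.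
exact: pi_ge0.
Qed.

Let gD q : R := 2 * gmean q * (2 * gmean q - q) - 1.

(* [gD gtail^3 exp(2 q^2)] has derivative [8 gmean^3 gtail^3 exp(2 q^2) > 0]. *)
Let is_derive_gD q : is_derive q 1 (fun q => gD q * (gtail q ^+ 3 * (gauss_fun q)^-1 ^+ 2))
  (8 * gmean q ^+ 3 * (gtail q ^+ 3 * (gauss_fun q)^-1 ^+ 2)).
Proof.
have g0 : gauss_fun q != 0 by rewrite gt_eqF// expR_gt0.
have hV := der_inv g0 (is_derive_gauss_fun q).
have hM := der_mul (der_cst 2 q) (is_derive_gmean q).
have hg := is_derive_gtail q.
have h1 := der_sub (der_mul hM (der_sub hM (der_id q))) (der_cst 1 q).
apply: (der_ext (der_mul h1 (der_mul (der_mul hg (der_mul hg hg)) (der_mul hV hV)))) => [t|].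
  by rewrite /gD; ring.
rewrite /gD /gvar /gmean /mills.
by field; rewrite g0 gt_eqF// gtail_gt0.
Qed.

(** The weighted quantity grows on [[0, +oo[] and starts with the sign of [4 / pi - 1]. *)
Let gD_gt0 q : 0 <= q -> 0 < gD q.
Proof.
move=> q0.
have w0 t : 0 < gtail t ^+ 3 * (gauss_fun t)^-1 ^+ 2.
  by rewrite mulr_gt0 ?exprn_gt0 ?gtail_gt0// invr_gt0 expR_gt0.
have h := @ge0_derive_le _ _ 0 q q0 (fun t _ => is_derive_gD t).
rewrite -(pmulr_lgt0 _ (w0 q)); apply: lt_le_trans (h _) => /=.
  rewrite pmulr_lgt0// /gD /gmean add0r subr0.
  rewrite (_ : _ - 1 = 4 * mills 0 ^+ 2 - 1); last by ring.
  by rewrite mills0 subr_gt0 ltr_pdivlMr ?mul1r ?pi_gt0//; have := @pihalf_lt2 R; lra.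
move=> t /andP[t0 _]; rewrite mulr_ge0 ?(ltW (w0 t))// mulr_ge0// exprn_ge0// addr_ge0//.
by rewrite ltW// mills_gt0.
Qed.

Lemma gdvar_gt0 q : 0 <= q -> 0 < gdvar q.
Proof. by move=> q0; rewrite mulr_gt0 ?gD_gt0// mulr_gt0// mills_gt0. Qed.

(** The value at 0 is [1 - 2 / pi], and the derivative [gdvar] is positive from there on. *)
Lemma gvar_ge0 q : 0 <= q -> 0 <= gvar q.
Proof.
move=> q0; apply: le_trans (_ : gvar 0 <= _).
  rewrite /gvar /gmean add0r -mulrA -expr2 mills0 subr_ge0 ler_pdivrMr ?pi_gt0// mul1r.
  exact: pi_ge2.
by apply: (@ge0_derive_le gvar gdvar 0 q q0) => t /andP[t0 _]; [exact: is_derive_gvar|exact: ltW (gdvar_gt0 t0)].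
Qed.

End gaussian_tail.

(** * Uniformly continuously differentiable functions *)

Section uniform_C1.
Context {R : realType}.
Implicit Types (e q M y : R).

(** One modulus serves the whole set, so the estimates survive substitution of functions on the
    torus, where the argument varies with [x]. *)
Definition C1on (J : set R) (g dg : R -> R) :=
  (exists2 M : R, 0 <= M & forall y, J y -> `|g y| <= M /\ `|dg y| <= M) /\
  forall e, 0 < e -> exists2 q : R, 0 < q & forall y y', J y -> J y' -> `|y' - y| < q ->
    `|g y' - g y - dg y * (y' - y)| <= e * `|y' - y| /\ `|dg y' - dg y| <= e.

Lemma minr_lel (a b : R) : Num.min a b <= a. Proof. by rewrite ge_min lexx. Qed.

Lemma minr_ler (a b : R) : Num.min a b <= b. Proof. by rewrite ge_min lexx orbT. Qed.

(** Continuity is two-sided at each point of the segment, so [y'] need not lie in it. *)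
Lemma Heine_Cantor (a b : R) (f : R -> R) : (forall y, a <= y <= b -> {for y, continuous f}) ->
  forall e, 0 < e -> exists2 q : R, 0 < q & forall y y', a <= y <= b -> `|y' - y| < q -> `|f y' - f y| < e.
Proof.
move=> cf e e0.
have /compact_near_coveringP H := @segment_compact R a b.
have [y /= yab|q /= q0 Hq] := H _ (nbhs (0 : R)) (fun q y => forall y', `|y' - y| < q -> `|f y' - f y| < e).
- have e2 : 0 < e / 2 by rewrite divr_gt0.
  have /cvgrPdist_lt/(_ _ e2)[r /= r0 Hr] := cf y (ltac:(by move: yab; rewrite in_itv)).
  have r2 : 0 < r / 2 by rewrite divr_gt0.
  near=> y1 q => y' /= y'y1.
  have h1 : `|y1 - y| < r / 2 by near: y1; exists (r / 2) => // t /=; rewrite distrC.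
  have h2 : q < r / 2.
    by near: q; exists (r / 2) => // t /=; rewrite sub0r normrN; apply: le_lt_trans; exact: ler_norm.
  have k1 : `|f y - f y1| < e / 2 by apply: Hr; rewrite /= distrC; lra.
  have k2 : `|f y - f y'| < e / 2.
    apply: Hr; rewrite /= distrC (_ : y' - y = (y' - y1) + (y1 - y)); last by ring.
    by apply: le_lt_trans (ler_normD _ _) _; lra.
  rewrite (_ : f y' - f y1 = (f y - f y1) - (f y - f y')); last by ring.
  by apply: le_lt_trans (ler_normB _ _) _; lra.
exists (q / 2); first by rewrite divr_gt0.
move=> y y' yab yy; apply: (Hq (q / 2)) yy => //=.
by rewrite sub0r normrN gtr0_norm ?divr_gt0//; lra.
Unshelve. all: by end_near. Qed.

Lemma MVT_between (g dg : R -> R) (y y' : R) :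
  (forall t, (y <= t <= y') || (y' <= t <= y) -> is_derive t 1 g (dg t)) ->
  exists c, [/\ (y <= c <= y') || (y' <= c <= y), `|c - y| <= `|y' - y| & g y' - g y = dg c * (y' - y)].
Proof.
have MV (z z' : R) : z <= z' -> (forall t, z <= t <= z' -> is_derive t 1 g (dg t)) ->
    exists2 c : R, z <= c <= z' & g z' - g z = dg c * (z' - z).
  move=> zz gd; have [||c] := @MVT_segment _ g dg z z' zz.
  - by move=> t; rewrite in_itv /= => /andP[zt tz]; apply: gd; rewrite !ltW.
  - by apply: derivable_within_continuous => t; rewrite in_itv /= => tz; have [] := gd t tz.
  - by rewrite in_itv /= => cz e; exists c.
move=> gd; have [yy|/ltW yy] := leP y y'.
  have [t tyy|c cy e] := MV y y' yy; first by apply: gd; rewrite tyy.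
  exists c; split=> //; first by rewrite cy.
  by case/andP: cy => c1 c2; rewrite !ger0_norm ?subr_ge0// lerB.
have [t tyy|c cy e] := MV y' y yy; first by apply: gd; rewrite tyy orbT.
exists c; split=> //; first by rewrite cy orbT.
  by case/andP: cy => c1 c2; rewrite distrC (distrC y') !ger0_norm ?subr_ge0// lerB.
by rewrite -opprB e -mulrN opprB.
Qed.

Lemma C1on_derive (a b : R) (g dg : R -> R) :
  (forall y, a <= y <= b -> is_derive y 1 g (dg y) /\ {for y, continuous dg}) ->
  C1on [set y | a <= y <= b] g dg.
Proof.
move=> H.
have H1 y : a <= y <= b -> is_derive y 1 g (dg y) by move=> /H[].
have H2 y : a <= y <= b -> {for y, continuous dg} by move=> /H[].
have H3 y : a <= y <= b -> {for y, continuous g} by move=> /H1; exact: is_derive_continuous.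
split.
  have bd (f : R -> R) : (forall y, a <= y <= b -> {for y, continuous f}) ->
      exists2 M : R, 0 <= M & forall y, a <= y <= b -> `|f y| <= M.
    move=> cf; have [ab|ab] := leP a b; last first.
      by exists 0 => // y /andP[ay yb]; have := le_lt_trans (le_trans ay yb) ab; rewrite ltxx.
    have cf' : {within `[a, b], continuous (fun y => `|f y|)}.
      apply: continuous_in_subspaceT => y; rewrite inE /= in_itv /= => yab.
      by apply: cvg_norm; exact: cf.
    have [c cab Hc] := EVT_max ab cf'.
    by exists `|f c| => // y yab; apply: Hc; rewrite in_itv.
  have [M M0 gM] := bd _ H3; have [N N0 gN] := bd _ H2.
  exists (M + N); first exact: addr_ge0.
  move=> y yab; split; first by apply: le_trans (gM y yab) _; rewrite lerDl.
  by apply: le_trans (gN y yab) _; rewrite lerDr.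
move=> e e0; have [q q0 Hq] := Heine_Cantor H2 e0.
exists q => // y y' yab y'ab yy; split; last exact: ltW (Hq _ _ yab yy).
have [|c [cb cy ->]] := @MVT_between g dg y y'.
  by move=> t tyy; apply: H1; case/orP: tyy => /andP[t1 t2]; case/andP: yab => ? ?; case/andP: y'ab => ? ?;
     apply/andP; split; lra.
rewrite -mulrBl normrM ler_wpM2r// ltW// Hq//; exact: le_lt_trans yy.
Qed.

Section UC1.
Variables (n : nat) (box : set ('I_n -> R)).
Implicit Types (f g : ('I_n -> R) -> R) (Df Dg : ('I_n -> R) -> 'I_n -> R) (x d : 'I_n -> R).

Definition UC1 f Df :=
  (exists2 M : R, 0 <= M & forall x, box x -> `|f x| <= M /\ forall i, `|Df x i| <= M) /\
  forall e, 0 < e -> exists2 q : R, 0 < q & forall x x', box x -> box x' ->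
    (forall i, `|x' i - x i| < q) ->
    `|f x' - f x - \sum_i Df x i * (x' i - x i)| <= e * \sum_i `|x' i - x i| /\
    forall i, `|Df x' i - Df x i| <= e.

Let dot_le x d M : 0 <= M -> (forall i, `|x i| <= M) -> `|\sum_i x i * d i| <= M * \sum_i `|d i|.
Proof.
move=> M0 xM; apply: le_trans (ler_norm_sum _ _ _) _; rewrite mulr_sumr.
by apply: ler_sum => i _; rewrite normrM ler_wpM2r.
Qed.

Let sum_ge0 d : 0 <= \sum_i `|d i|.
Proof. by apply: sumr_ge0. Qed.

Lemma UC1_cst (c : R) : UC1 (fun=> c) (fun _ _ => 0).
Proof.
split; first by exists `|c| => // x _; split=> // i; rewrite normr0.
move=> e e0; exists 1 => // x x' _ _ _; split=> [|i]; last by rewrite subrr normr0 ltW.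
rewrite big1; first by rewrite !subrr normr0 mulr_ge0 ?sum_ge0// ltW.
by move=> i _; rewrite mul0r.
Qed.

Lemma UC1_coord j M : 0 <= M -> (forall x, box x -> `|x j| <= M) -> UC1 (fun x => x j) (fun _ i => (i == j)%:R).
Proof.
move=> M0 xM; split.
  exists (M + 1); first by rewrite addr_ge0.
  move=> x bx; split=> [|i]; first by apply: le_trans (xM x bx) _; rewrite lerDl.
  by case: eqP => _; rewrite ?normr1 ?normr0 ?lerDr ?addr_ge0.
move=> e e0; exists 1 => // x x' _ _ _; split=> [|i]; last by rewrite subrr normr0 ltW.
rewrite (bigD1 j)//= eqxx mul1r big1 ?addr0; first by rewrite subrr normr0 mulr_ge0 ?sum_ge0// ltW.
by move=> i /negPf ->; rewrite mul0r.
Qed.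

Lemma UC1_D f Df g Dg : UC1 f Df -> UC1 g Dg -> UC1 (fun x => f x + g x) (fun x i => Df x i + Dg x i).
Proof.
move=> [[M M0 fM] Hf] [[N N0 gN] Hg]; split.
  exists (M + N); first exact: addr_ge0.
  move=> x bx; have [f1 f2] := fM x bx; have [g1 g2] := gN x bx.
  by split=> [|i]; apply: le_trans (ler_normD _ _) (lerD _ _).
move=> e e0; have e2 : 0 < e / 2 by rewrite divr_gt0.
have [q q0 Hq] := Hf _ e2; have [r r0 Hr] := Hg _ e2.
exists (Num.min q r); first by rewrite lt_min q0.
move=> x x' bx bx' d.
have [f1 f2] := Hq x x' bx bx' (fun i => lt_le_trans (d i) (minr_lel _ _)).
have [g1 g2] := Hr x x' bx bx' (fun i => lt_le_trans (d i) (minr_ler _ _)).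
split=> [|i].
  rewrite (_ : \sum_i (Df x i + Dg x i) * (x' i - x i) =
     \sum_i Df x i * (x' i - x i) + \sum_i Dg x i * (x' i - x i)); last first.
    by rewrite -big_split; apply: eq_bigr => i _; rewrite mulrDl.
  rewrite (_ : _ - _ - _ = (f x' - f x - \sum_i Df x i * (x' i - x i)) +
     (g x' - g x - \sum_i Dg x i * (x' i - x i))); last by ring.
  by apply: le_trans (ler_normD _ _) (le_trans (lerD f1 g1) _); rewrite -mulrDl -splitr.
rewrite (_ : _ - _ = (Df x' i - Df x i) + (Dg x' i - Dg x i)); last by ring.
by apply: le_trans (ler_normD _ _) (le_trans (lerD (f2 i) (g2 i)) _); rewrite -splitr.
Qed.

Lemma UC1_lipschitz f Df : UC1 f Df -> exists2 C : R, 0 < C & exists2 q : R, 0 < q & forall x x', box x -> box x' ->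
  (forall i, `|x' i - x i| < q) -> `|f x' - f x| <= C * \sum_i `|x' i - x i|.
Proof.
move=> [[M M0 fM] Hf]; exists (M + 1); first by rewrite ltr_wpDl.
have [q q0 Hq] := Hf _ ltr01; exists q => // x x' bx bx' d.
have [f1 _] := Hq x x' bx bx' d; have [_ f2] := fM x bx.
rewrite -[f x' - f x](subrK (\sum_i Df x i * (x' i - x i))) mulrDl addrC.
by apply: le_trans (ler_normD _ _) (lerD _ f1); exact: dot_le.
Qed.

Lemma UC1_unif f Df : UC1 f Df -> forall e, 0 < e -> exists2 q : R, 0 < q & forall x x', box x -> box x' ->
  (forall i, `|x' i - x i| < q) -> `|f x' - f x| <= e.
Proof.
move=> /UC1_lipschitz[C C0 [q q0 H]] e e0.
have c0 : 0 < C * (n%:R + 1) by rewrite mulr_gt0// ltr_wpDl.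
exists (Num.min q (e / (C * (n%:R + 1)))); first by rewrite lt_min q0 divr_gt0.
move=> x x' bx bx' d.
apply: le_trans (H x x' bx bx' (fun i => lt_le_trans (d i) (minr_lel _ _))) _.
apply: le_trans (_ : C * ((n%:R + 1) * (e / (C * (n%:R + 1)))) <= _); last first.
  rewrite (_ : C * _ = e)//; field; rewrite gt_eqF//= gt_eqF//; exact: ltr_wpDl.
rewrite ler_pM2l//; apply: le_trans (_ : \sum_(i < n) (e / (C * (n%:R + 1))) <= _).
  by apply: ler_sum => i _; exact: ltW (lt_le_trans (d i) (minr_ler _ _)).
by rewrite sumr_const card_ord -[leLHS]mulr_natl ler_wpM2r ?lerDl// divr_ge0 ?ltW.
Qed.

Lemma UC1_M f Df g Dg : UC1 f Df -> UC1 g Dg ->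
  UC1 (fun x => f x * g x) (fun x i => Df x i * g x + f x * Dg x i).
Proof.
move=> Uf Ug; have [[[M0 M00 fM0] Hf] [[N0 N00 gN0] Hg]] := (Uf, Ug).
pose M := M0 + N0.
have Mp : 0 <= M by exact: addr_ge0.
have fM x : box x -> `|f x| <= M /\ forall i, `|Df x i| <= M.
  by move=> /fM0[h1 h2]; split=> [|i]; [apply: le_trans h1 _|apply: le_trans (h2 i) _]; rewrite lerDl.
have gM x : box x -> `|g x| <= M /\ forall i, `|Dg x i| <= M.
  by move=> /gN0[h1 h2]; split=> [|i]; [apply: le_trans h1 _|apply: le_trans (h2 i) _]; rewrite lerDr.
split.
  exists (M * M + M * M); first by rewrite addr_ge0// mulr_ge0.
  move=> x bx; have [f1 f2] := fM x bx; have [g1 g2] := gM x bx.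
  split=> [|i]; first by rewrite normrM; apply: le_trans (ler_pM _ _ f1 g1) _ => //; rewrite lerDl mulr_ge0.
  by apply: le_trans (ler_normD _ _) (lerD _ _); rewrite normrM ler_pM.
(* [4 M] pays for the four products in the variation of the derivative; the 1 keeps the denominator
   positive. *)
move=> e e0; pose e' := e / (4 * M + 1).
have e'0 : 0 < e' by rewrite divr_gt0// ltr_wpDl// mulr_ge0.
have e'e : e' * (4 * M + 1) = e by rewrite divfK// gt_eqF// ltr_wpDl// mulr_ge0.
have [q1 q10 H1] := Hf _ e'0; have [q2 q20 H2] := Hg _ e'0.
have [q3 q30 H3] := UC1_unif Uf e'0; have [q4 q40 H4] := UC1_unif Ug e'0.
exists (Num.min (Num.min q1 q2) (Num.min q3 q4)); first by rewrite !lt_min q10 q20 q30.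
move=> x x' bx bx' d.
have {}H1 := H1 x x' bx bx' (fun i => lt_le_trans (d i) (le_trans (minr_lel _ _) (minr_lel _ _))).
have {}H2 := H2 x x' bx bx' (fun i => lt_le_trans (d i) (le_trans (minr_lel _ _) (minr_ler _ _))).
have {}H3 := H3 x x' bx bx' (fun i => lt_le_trans (d i) (le_trans (minr_ler _ _) (minr_lel _ _))).
have {}H4 := H4 x x' bx bx' (fun i => lt_le_trans (d i) (le_trans (minr_ler _ _) (minr_ler _ _))).
have [h1 k1] := H1; have [h2 k2] := H2.
have [f1 f2] := fM x bx; have [f1' f2'] := fM x' bx'.
have [g1 g2] := gM x bx; have [g1' g2'] := gM x' bx'.
split=> [|i].
  have hs := sum_ge0 (fun i => x' i - x i).
  have hD := @dot_le (Dg x) (fun i => x' i - x i) M Mp g2.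
  rewrite (_ : \sum_i (Df x i * g x + f x * Dg x i) * (x' i - x i) =
     g x * (\sum_i Df x i * (x' i - x i)) + f x * \sum_i Dg x i * (x' i - x i)); last first.
    by rewrite !mulr_sumr -big_split; apply: eq_bigr => i _ /=; ring.
  move: h1 h2 hD hs; move: (\sum_i Df x i * (x' i - x i)) (\sum_i Dg x i * (x' i - x i)) (\sum_i `|x' i - x i|) => a b s h1 h2 hD s0.
  rewrite (_ : _ - _ - _ = f x' * (g x' - g x - b) + (f x' - f x) * b + g x * (f x' - f x - a)); last by ring.
  apply: le_trans (ler_normD _ _) _.
  apply: le_trans (lerD (ler_normD _ _) (lexx _)) _.
  rewrite !normrM.
  have t1 := ler_pM (normr_ge0 _) (normr_ge0 _) f1' h2.
  have t2 := ler_pM (normr_ge0 _) (normr_ge0 _) H3 hD.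
  have t3 := ler_pM (normr_ge0 _) (normr_ge0 _) g1 h1.
  apply: le_trans (lerD (lerD t1 t2) t3) _; rewrite -e'e.
  have : 0 <= e' * M * s by exact: mulr_ge0 (mulr_ge0 (ltW e'0) Mp) s0.
  have : 0 <= e' * s by exact: mulr_ge0 (ltW e'0) s0.
  lra.
rewrite (_ : _ - _ = (Df x' i - Df x i) * g x' + Df x i * (g x' - g x) + ((f x' - f x) * Dg x' i + f x * (Dg x' i - Dg x i))); last by ring.
apply: le_trans (ler_normD _ _) _.
apply: le_trans (lerD (ler_normD _ _) (ler_normD _ _)) _.
rewrite !normrM.
have t1 := ler_pM (normr_ge0 _) (normr_ge0 _) (k1 i) g1'.
have t2 := ler_pM (normr_ge0 _) (normr_ge0 _) (f2 i) H4.
have t3 := ler_pM (normr_ge0 _) (normr_ge0 _) H3 (g2' i).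
have t4 := ler_pM (normr_ge0 _) (normr_ge0 _) f1 (k2 i).
apply: le_trans (lerD (lerD t1 t2) (lerD t3 t4)) _; rewrite -e'e; lra.
Qed.

Lemma UC1_comp (J : set R) (g dg : R -> R) f Df : C1on J g dg -> UC1 f Df -> (forall x, box x -> J (f x)) ->
  UC1 (fun x => g (f x)) (fun x i => dg (f x) * Df x i).
Proof.
move=> [[N0 N00 gN0] Hg] Uf fJ; have [[M0 M00 fM0] Hf] := Uf.
pose M := M0 + N0.
have Mp : 0 <= M by exact: addr_ge0.
have fM x : box x -> `|f x| <= M /\ forall i, `|Df x i| <= M.
  by move=> /fM0[h1 h2]; split=> [|i]; [apply: le_trans h1 _|apply: le_trans (h2 i) _]; rewrite lerDl.
have gM x : box x -> `|g (f x)| <= M /\ `|dg (f x)| <= M.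
  by move=> /fJ/gN0[h1 h2]; split=> [|]; [apply: le_trans h1 _|apply: le_trans h2 _]; rewrite lerDr.
split.
  exists (M + M * M); first by rewrite addr_ge0// mulr_ge0.
  move=> x bx; have [f1 f2] := fM x bx; have [g1 g2] := gM x bx.
  split=> [|i]; first by apply: le_trans g1 _; rewrite lerDl mulr_ge0.
  by rewrite normrM; apply: le_trans (ler_pM _ _ g2 (f2 i)) _ => //; rewrite lerDr.
have [C C0 [q0 q00 HC]] := UC1_lipschitz Uf.
move=> e e0; pose e' := e / (2 * M + C + 1).
have c1 : 0 < 2 * M + C + 1 by lra.
have e'0 : 0 < e' by rewrite divr_gt0.
have e'e : e' * (2 * M + C + 1) = e by rewrite divfK// gt_eqF.
have [q1 q10 H1] := Hf _ e'0; have [q2 q20 H2] := Hg _ e'0.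
have q22 : 0 < q2 / 2 by rewrite divr_gt0.
have [q3 q30 H3] := UC1_unif Uf q22.
exists (Num.min (Num.min q1 q0) q3); first by rewrite !lt_min q10 q00 q30.
move=> x x' bx bx' d.
have [h1 k1] := H1 x x' bx bx' (fun i => lt_le_trans (d i) (le_trans (minr_lel _ _) (minr_lel _ _))).
have {}HC := HC x x' bx bx' (fun i => lt_le_trans (d i) (le_trans (minr_lel _ _) (minr_ler _ _))).
have {}H3 := H3 x x' bx bx' (fun i => lt_le_trans (d i) (minr_ler _ _)).
have [|h2 k2] := H2 (f x) (f x') (fJ x bx) (fJ x' bx').
  by apply: le_lt_trans H3 _; lra.
have [f1 f2] := fM x bx; have [f1' f2'] := fM x' bx'.
have [g1 g2] := gM x bx.
split=> [|i].
  have hs := sum_ge0 (fun i => x' i - x i).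
  rewrite (_ : \sum_i dg (f x) * Df x i * (x' i - x i) =
     dg (f x) * (\sum_i Df x i * (x' i - x i))); last first.
    by rewrite !mulr_sumr; apply: eq_bigr => i _ /=; ring.
  move: h1 HC hs; move: (\sum_i Df x i * (x' i - x i)) (\sum_i `|x' i - x i|) => a s h1 HC s0.
  rewrite (_ : _ - _ - _ = (g (f x') - g (f x) - dg (f x) * (f x' - f x)) + dg (f x) * (f x' - f x - a)); last by ring.
  apply: le_trans (ler_normD _ _) _.
  rewrite !normrM.
  have t1 := ler_pM (normr_ge0 _) (normr_ge0 _) g2 h1.
  have t2 : e' * `|f x' - f x| <= e' * (C * s) by rewrite ler_wpM2l// ltW.
  apply: le_trans (lerD (le_trans h2 t2) t1) _; rewrite -e'e.
  have : 0 <= e' * M * s by exact: mulr_ge0 (mulr_ge0 (ltW e'0) Mp) s0.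
  have : 0 <= e' * s by exact: mulr_ge0 (ltW e'0) s0.
  lra.
rewrite (_ : _ - _ = (dg (f x') - dg (f x)) * Df x' i + dg (f x) * (Df x' i - Df x i)); last by ring.
apply: le_trans (ler_normD _ _) _.
rewrite !normrM.
have t1 := ler_pM (normr_ge0 _) (normr_ge0 _) k2 (f2' i).
have t2 := ler_pM (normr_ge0 _) (normr_ge0 _) g2 (k1 i).
apply: le_trans (lerD t1 t2) _; rewrite -e'e.
have : 0 <= e' * C by exact: mulr_ge0 (ltW e'0) (ltW C0).
lra.
Qed.

End UC1.
End uniform_C1.

(** * Means over the unit interval depending on parameters *)

Section unit_mean.
Context {R : realType}.
Implicit Types (f g : R -> R) (e q t : R).
Local Notation leb := (@lebesgue_measure R).

Definition unit_mean f : R := \int[leb]_(t in `[0, 1]) f t.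

Definition unit_unif f := forall e, 0 < e -> exists2 q : R, 0 < q & forall t t',
  0 <= t <= 1 -> 0 <= t' <= 1 -> `|t' - t| < q -> `|f t' - f t| <= e.

Lemma unit_unif_continuous f : unit_unif f -> {within `[0, 1], continuous f}.
Proof.
move=> fu; apply/subspace_continuousP => t; rewrite /= in_itv /= => t01.
apply/cvgrPdist_le => e e0; have [q q0 Hq] := fu e e0.
near=> t'; rewrite distrC; apply: Hq => //.
  by have : `[0, 1]%classic t' by near: t'; exact: withinT; rewrite /= in_itv.
near: t'; apply: cvg_within; exists q => // y /=; rewrite distrC; exact.
Unshelve. all: by end_near. Qed.

Lemma unit_unif_integrable f : unit_unif f -> leb.-integrable `[0, 1] (EFin \o f).
Proof.
by move=> /unit_unif_continuous; apply: continuous_compact_integrable; exact: segment_compact.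
Qed.

Lemma Rintegral_unit_cst (c : R) : \int[leb]_(t in `[0, 1]) c = c.
Proof.
rewrite Rintegral_cst// (_ : fine _ = 1) ?mulr1//.
have := @lebesgue_measure_itv R `[0, 1]; rewrite /= lte_fin ltr01 oppr0 adde0 => H.
by rewrite -[RHS]/(fine 1%E) -H.
Qed.

Lemma unit_mean_le f e : unit_unif f -> (forall t, 0 <= t <= 1 -> `|f t| <= e) -> `|unit_mean f| <= e.
Proof.
move=> /unit_unif_integrable fi fe.
have m01 : measurable (`[0, 1]%classic : set (measurableTypeR R)) by [].
apply: le_trans (le_normr_Rintegral m01 fi) _.
apply: le_trans (_ : \int[leb]_(t in `[0, 1]) e <= _).
  apply: le_Rintegral => //; first exact: integrable_norm fi.
    by apply: continuous_compact_integrable; [exact: segment_compact|exact: cst_continuous].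
by rewrite Rintegral_unit_cst.
Qed.

Lemma unit_unifD f g : unit_unif f -> unit_unif g -> unit_unif (fun t => f t + g t).
Proof.
move=> uf ug e e0; have e2 : 0 < e / 2 by rewrite divr_gt0.
have [q q0 Hq] := uf _ e2; have [r r0 Hr] := ug _ e2.
exists (Num.min q r); first by rewrite lt_min q0.
move=> t t' t0 t0' d.
have h1 := Hq t t' t0 t0' (lt_le_trans d (minr_lel _ _)).
have h2 := Hr t t' t0 t0' (lt_le_trans d (minr_ler _ _)).
rewrite opprD addrACA; apply: le_trans (ler_normD _ _) _; lra.
Qed.

Lemma unit_unifZ c f : unit_unif f -> unit_unif (fun t => c * f t).
Proof.
move=> uf e e0; have c1 : 0 < `|c| + 1 by rewrite ltr_wpDl.
have [q q0 Hq] := uf _ (divr_gt0 e0 c1); exists q => // t t' t0 t0' d.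
rewrite -mulrBr normrM; apply: le_trans (_ : (`|c| + 1) * (e / (`|c| + 1)) <= _).
  by apply: ler_pM => //; [rewrite lerDl|exact: Hq].
by rewrite mulrC divfK// gt_eqF.
Qed.

Lemma unit_meanD f g : unit_unif f -> unit_unif g ->
  unit_mean (fun t => f t + g t) = unit_mean f + unit_mean g.
Proof. by move=> uf ug; apply: RintegralD => //; exact: unit_unif_integrable. Qed.

Lemma unit_meanZ c f : unit_unif f -> unit_mean (fun t => c * f t) = c * unit_mean f.
Proof. by move=> uf; apply: RintegralZl => //; exact: unit_unif_integrable. Qed.

Lemma unit_mean_cst (c : R) f : (forall t, 0 <= t <= 1 -> f t = c) -> unit_mean f = c.
Proof.
move=> fc; rewrite /unit_mean (@eq_Rintegral _ _ _ _ _ (cst c)).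
  by rewrite Rintegral_unit_cst.
by move=> t; rewrite inE /= in_itv /=; exact: fc.
Qed.

Lemma unit_mean_derive f g : (forall t, 0 <= t <= 1 -> is_derive t 1 g (f t)) -> unit_unif f ->
  unit_mean f = g 1 - g 0.
Proof.
move=> gf uf.
have gc t : 0 <= t <= 1 -> {for t, continuous g} by move=> /gf; exact: is_derive_continuous.
rewrite /unit_mean /Rintegral (@continuous_FTC2 _ f g) //.
- exact: unit_unif_continuous.
- split=> [t||].
  + by rewrite in_itv /= => /andP[t0 t1]; have [] := gf t (ltac:(by rewrite !ltW)).
  + by apply: cvg_at_right_filter; apply: gc; rewrite lexx ler01.
  + by apply: cvg_at_left_filter; apply: gc; rewrite ler01 lexx.
- move=> t; rewrite in_itv /= => /andP[t0 t1]; rewrite derive1E.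
  by have [] := gf t (ltac:(by rewrite !ltW)).
Qed.

Definition pt4 (t s z y : R) : 'I_4 -> R := fun i => [:: t; s; z; y]`_i.
Definition box4 (r r' Y : R) : set ('I_4 -> R) :=
  [set x | [/\ 0 <= x (inord 0) <= 1, `|x (inord 1)| <= r, `|x (inord 2)| <= r' & `|x (inord 3)| <= Y]].

Lemma sum4 (x : 'I_4 -> R) : \sum_i x i = x (inord 0) + x (inord 1) + x (inord 2) + x (inord 3).
Proof.
rewrite !big_ord_recl big_ord0 addr0 !addrA.
by do ![congr (_ + _)]; congr x; apply: val_inj; rewrite /= inordK.
Qed.

Lemma pt4E t s z y : (pt4 t s z y (inord 0) = t) * (pt4 t s z y (inord 1) = s) *
  (pt4 t s z y (inord 2) = z) * (pt4 t s z y (inord 3) = y).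
Proof. by rewrite /pt4 !inordK. Qed.

Lemma box4E r r' Y t s z y : 0 <= t <= 1 -> `|s| <= r -> `|z| <= r' -> `|y| <= Y -> box4 r r' Y (pt4 t s z y).
Proof. by move=> *; rewrite /box4 /= !pt4E. Qed.

Section parametric_mean.
Variables (r r' Y : R) (p : ('I_4 -> R) -> R) (Dp : ('I_4 -> R) -> 'I_4 -> R).
Hypothesis Up : UC1 (box4 r r' Y) p Dp.
Local Notation P := (fun s z y => unit_mean (fun t => p (pt4 t s z y))).
Local Notation D i := (fun s z y => unit_mean (fun t => Dp (pt4 t s z y) (inord i))).

Let I4P (A : 'I_4 -> Prop) : A (inord 0) -> A (inord 1) -> A (inord 2) -> A (inord 3) -> forall i, A i.
Proof.
move=> h0 h1 h2 h3 [[|[|[|[|//]]]] hi].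
- by rewrite (_ : Ordinal hi = inord 0)//; apply: val_inj; rewrite /= inordK.
- by rewrite (_ : Ordinal hi = inord 1)//; apply: val_inj; rewrite /= inordK.
- by rewrite (_ : Ordinal hi = inord 2)//; apply: val_inj; rewrite /= inordK.
- by rewrite (_ : Ordinal hi = inord 3)//; apply: val_inj; rewrite /= inordK.
Qed.

Let near4 q t s z y t' s' z' y' : `|t' - t| < q -> `|s' - s| < q -> `|z' - z| < q -> `|y' - y| < q ->
  forall i, `|pt4 t' s' z' y' i - pt4 t s z y i| < q.
Proof. by move=> *; apply: (I4P (A := fun i => `|pt4 t' s' z' y' i - pt4 t s z y i| < q)); rewrite !pt4E. Qed.

Let unif_p s z y : `|s| <= r -> `|z| <= r' -> `|y| <= Y -> unit_unif (fun t => p (pt4 t s z y)).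
Proof.
move=> hs hz hy e e0; have [q q0 Hq] := UC1_unif Up e0; exists q => // t t' t0 t0' d.
by apply: Hq; [exact: box4E|exact: box4E|apply: near4; rewrite ?subrr ?normr0].
Qed.

Let unif_D i s z y : `|s| <= r -> `|z| <= r' -> `|y| <= Y -> unit_unif (fun t => Dp (pt4 t s z y) (inord i)).
Proof.
move=> hs hz hy e e0; have [_ /(_ e e0)[q q0 Hq]] := Up; exists q => // t t' t0 t0' d.
have n0 (x : R) : `|x - x| < q by rewrite subrr normr0.
have [_] := Hq _ _ (box4E t0 hs hz hy) (box4E t0' hs hz hy) (near4 d (n0 _) (n0 _) (n0 _)).
exact.
Qed.

(** Differentiation under the integral: the expansion of [p] is uniform in [t], so it can be
    integrated. *)
Lemma unit_mean_C1 e : 0 < e -> exists2 q : R, 0 < q & forall s z y s' z' y',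
  [/\ `|s| <= r, `|z| <= r' & `|y| <= Y] -> [/\ `|s'| <= r, `|z'| <= r' & `|y'| <= Y] ->
  `|s' - s| < q -> `|z' - z| < q -> `|y' - y| < q ->
  [/\ `|P s' z' y' - P s z y - D 1 s z y * (s' - s) - D 2 s z y * (z' - z) - D 3 s z y * (y' - y)| <=
        e * (`|s' - s| + `|z' - z| + `|y' - y|),
      `|D 1 s' z' y' - D 1 s z y| <= e, `|D 2 s' z' y' - D 2 s z y| <= e &
      `|D 3 s' z' y' - D 3 s z y| <= e].
Proof.
move=> e0; have [_ /(_ e e0)[q q0 Hq]] := Up; exists q => // s z y s' z' y' [hs hz hy] [hs' hz' hy'] ds dz dy.
have n0 (x : R) : `|x - x| < q by rewrite subrr normr0.
have H t (t0 : 0 <= t <= 1) := Hq _ _ (box4E t0 hs hz hy) (box4E t0 hs' hz' hy') (near4 (n0 t) ds dz dy).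
have uB f g : unit_unif f -> unit_unif g -> unit_unif (fun t => f t + (-1) * g t).
  by move=> uf ug; apply: unit_unifD => //; exact: unit_unifZ.
have mB f g : unit_unif f -> unit_unif g -> unit_mean (fun t => f t + (-1) * g t) = unit_mean f - unit_mean g.
  by move=> uf ug; rewrite unit_meanD ?unit_meanZ ?mulN1r//; exact: unit_unifZ.
have dD i : `|D i s' z' y' - D i s z y| <= e.
  rewrite -mB; [|exact: unif_D|exact: unif_D].
  apply: unit_mean_le; first by apply: uB; exact: unif_D.
  by move=> t t0; have [_] := H t t0; rewrite mulN1r; exact.
split=> //.
have u1 : unit_unif (fun t => (s' - s) * Dp (pt4 t s z y) (inord 1)) by apply: unit_unifZ; exact: unif_D.
have u2 : unit_unif (fun t => (z' - z) * Dp (pt4 t s z y) (inord 2)) by apply: unit_unifZ; exact: unif_D.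
have u3 : unit_unif (fun t => (y' - y) * Dp (pt4 t s z y) (inord 3)) by apply: unit_unifZ; exact: unif_D.
have up := unif_p hs hz hy; have up' := unif_p hs' hz' hy'.
have v1 := uB _ _ up' up; have v2 := uB _ _ v1 u1; have v3 := uB _ _ v2 u2; have v4 := uB _ _ v3 u3.
have -> : P s' z' y' - P s z y - D 1 s z y * (s' - s) - D 2 s z y * (z' - z) - D 3 s z y * (y' - y) =
    unit_mean (fun t => p (pt4 t s' z' y') + -1 * p (pt4 t s z y) + -1 * ((s' - s) * Dp (pt4 t s z y) (inord 1))
      + -1 * ((z' - z) * Dp (pt4 t s z y) (inord 2)) + -1 * ((y' - y) * Dp (pt4 t s z y) (inord 3))).
  rewrite mB// mB// mB// mB//.
  have w1 := @unif_D 1 _ _ _ hs hz hy; have w2 := @unif_D 2 _ _ _ hs hz hy; have w3 := @unif_D 3 _ _ _ hs hz hy.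
  by rewrite !unit_meanZ//; ring.
apply: unit_mean_le => // t t0; have [+ _] := H t t0.
rewrite !sum4 !pt4E subrr normr0 mulr0 !add0r => h.
by apply: le_trans h; rewrite le_eqVlt; apply/orP; left; apply/eqP; congr `| _ |; ring.
Qed.

Lemma unit_mean_bounded : exists2 M : R, 0 <= M & forall s z y, `|s| <= r -> `|z| <= r' -> `|y| <= Y ->
  [/\ `|P s z y| <= M, `|D 1 s z y| <= M, `|D 2 s z y| <= M & `|D 3 s z y| <= M].
Proof.
have [[M M0 HM] _] := Up; exists M => // s z y hs hz hy.
have H t (t0 : 0 <= t <= 1) := HM _ (box4E t0 hs hz hy).
by split; apply: unit_mean_le => [|t t0]; try (by apply: unif_p); try (by apply: unif_D);
  have [] := H t t0.
Qed.

Lemma unit_mean_FTC G s z y : `|s| <= r -> `|z| <= r' -> `|y| <= Y ->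
  (forall t, 0 <= t <= 1 -> is_derive t 1 G (z * p (pt4 t s z y))) -> z * P s z y = G 1 - G 0.
Proof.
move=> hs hz hy H; rewrite -unit_meanZ; last exact: unif_p.
by apply: unit_mean_derive => //; apply: unit_unifZ; exact: unif_p.
Qed.

End parametric_mean.
End unit_mean.

(** * The homogeneous curve and its increments *)

Section homogeneous_curve.
Context {R : realType}.
Implicit Types (a c e q s t v y z : R).

Lemma UC1_eq n (box : set ('I_n -> R)) f Df g Dg : UC1 box f Df ->
  (forall x : 'I_n -> R, box x -> f x = g x) -> (forall (x : 'I_n -> R) i, box x -> Df x i = Dg x i) -> UC1 box g Dg.
Proof.
move=> [[M M0 HM] H] fg Dfg; split.
  by exists M => // x bx; have [h1 h2] := HM x bx; rewrite -fg//; split=> // i; rewrite -Dfg.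
move=> e e0; have [q q0 Hq] := H e e0; exists q => // x x' bx bx' d.
have [h1 h2] := Hq x x' bx bx' d; rewrite -!fg//; split=> [|i]; last by rewrite -!Dfg.
by under eq_bigr => i _ do rewrite -Dfg//.
Qed.

Lemma UC1_comp_derive n (box : set ('I_n -> R)) f Df (g dg : R -> R) :
  (forall y, is_derive y 1 g (dg y)) -> continuous dg -> UC1 box f Df ->
  UC1 box (fun x : 'I_n -> R => g (f x)) (fun (x : 'I_n -> R) i => dg (f x) * Df x i).
Proof.
move=> gd cdg Uf; have [[M M0 HM] _] := Uf.
apply: (UC1_comp (J := [set y | - M <= y <= M])) => //; first by apply: C1on_derive => y _; split; [exact: gd|exact: cdg].
by move=> x /HM[]; rewrite ler_norml.
Qed.

Lemma UC1_Z n (box : set ('I_n -> R)) f Df c : UC1 box f Df ->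
  UC1 box (fun x : 'I_n -> R => c * f x) (fun (x : 'I_n -> R) i => c * Df x i).
Proof.
move=> Uf; apply: (UC1_eq (UC1_M (UC1_cst box c) Uf)) => //.
by move=> x i _; rewrite mul0r add0r.
Qed.

Variables (Phi : R -> R) (B w Ld : R).
Hypotheses (Phi_cont : continuous Phi) (Phi_C3 : C3_off0 Phi).
Hypothesis Phi_incr : forall s t, 0 <= s -> s <= t -> Phi s <= Phi t.
Hypothesis Phi_neg : forall s, s <= 0 -> Phi s = 0.
Hypotheses (w0 : w < 0) (Ld0 : 0 < Ld).

Local Notation Phi1 := (derive1n 1 Phi).
Local Notation Phi2 := (derive1n 2 Phi).

Lemma Phi_ge0 x : 0 <= Phi x.
Proof.
have [x0|x0] := leP 0 x; last by rewrite Phi_neg// ltW.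
by rewrite -(Phi_neg (lexx 0)); exact: Phi_incr.
Qed.

Lemma Phi_homo : {homo Phi : x y / x <= y}.
Proof.
move=> x y xy; have [x0|x0] := leP 0 x; first exact: Phi_incr.
by rewrite (Phi_neg (ltW x0)) Phi_ge0.
Qed.

Lemma is_derive_Phi (x : R) : 0 < x -> is_derive x 1 Phi (Phi1 x).
Proof.
move=> /lt0r_neq0/Phi_C3[H _]; apply: DeriveDef; first exact: (H 0%N).
by rewrite /derive1n /= derive1E.
Qed.

Lemma is_derive_Phi1 (x : R) : 0 < x -> is_derive x 1 Phi1 (Phi2 x).
Proof.
move=> /lt0r_neq0/Phi_C3[H _]; apply: DeriveDef; first exact: (H 1%N).
by rewrite /derive1n /= derive1E.
Qed.

Lemma continuous_Phi2 (x : R) : 0 < x -> {for x, continuous Phi2}.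
Proof.
move=> /lt0r_neq0/Phi_C3[H _]; apply: differentiable_continuous; exact/derivable1_diffP/(H 2%N).
Qed.

(** [Phi] is only nondecreasing; adding [e t] makes it strictly increasing with derivative
    [Phi1 + e], and [e] is arbitrary. *)
Lemma Phi1_ge0 (x : R) : 0 < x -> 0 <= Phi1 x.
Proof.
move=> x0; apply/ler_addgt0Pl => e e0.
have hd t : 0 < t -> is_derive t 1 (fun t => Phi t + e * t) (Phi1 t + e).
  by move=> t0; apply: (der_ext (der_add (is_derive_Phi t0) (der_mul (der_cst (e : R) t) (der_id t)))) => //; ring.
have := @incr_derive1_ge0_itvy R (fun t => Phi t + e * t) false 0 x.
rewrite derive1E; have [_ ->] := hd x x0; rewrite addrC; apply.
- by move=> t; rewrite inE /= in_itv /= andbT => t0; have [] := hd t t0.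
- by move=> s t _ _ st; rewrite ler_ltD// ?Phi_homo ?ltW// ltr_pM2l.
- by rewrite in_itv /= x0.
Qed.

(* With [a = sqrt (kappa / 2)], [Ld = L ^+ d], the stationary equation at [kappa] is
   [rho = mean_act a (W * rho)], and [mean_gain a] is the derivative of [mean_act a]. *)
Definition mean_act a v : R := gmean (a * Phi (v + B)) / (Ld * a).
Definition mean_gain a v : R := gvar (a * Phi (v + B)) * Phi1 (v + B) / Ld.

Lemma gmean_homo p q : 0 <= p -> p <= q -> gmean p <= gmean q.
Proof.
move=> p0 pq; apply: (@ge0_derive_le _ gmean gvar) => // t; first by move=> _; exact: is_derive_gmean.
by move=> /andP[pt _]; apply: gvar_ge0; exact: le_trans pt.
Qed.

Lemma mean_act_homo a : 0 < a -> {homo mean_act a : v v' / v <= v'}.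
Proof.
move=> a0 v v' vv; rewrite /mean_act ler_pM2r ?invr_gt0 ?mulr_gt0//.
apply: gmean_homo; first by rewrite mulr_ge0 ?Phi_ge0// ltW.
by rewrite ler_pM2l// Phi_homo// lerD2r.
Qed.

Lemma gmean_gt0 q : 0 <= q -> 0 < gmean q.
Proof. by move=> q0; rewrite ltr_wpDl// mills_gt0. Qed.

Lemma mean_act_gt0 a v : 0 < a -> 0 < mean_act a v.
Proof.
by move=> a0; rewrite divr_gt0 ?mulr_gt0// gmean_gt0// mulr_ge0 ?Phi_ge0// ltW.
Qed.

Lemma mean_gain_ge0 a v : 0 < a -> 0 < v + B -> 0 <= mean_gain a v.
Proof.
move=> a0 v0; rewrite mulr_ge0 ?invr_ge0 ?(ltW Ld0)// mulr_ge0 ?Phi1_ge0//.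
by rewrite gvar_ge0// mulr_ge0 ?Phi_ge0// ltW.
Qed.

Lemma is_derive_mean_act a v : a != 0 -> 0 < v + B -> is_derive v 1 (mean_act a) (mean_gain a v).
Proof.
move=> a0 v0.
have h1 := @der_comp _ Phi (fun v => v + B) _ _ _ (is_derive_Phi v0) (der_add (der_id v) (der_cst B v)).
have h2 := der_mul (der_cst a v) h1.
apply: (der_ext (der_mul (@der_comp _ gmean _ _ _ _ (is_derive_gmean _) h2) (der_cst (Ld * a)^-1 v))) => //.
by rewrite /mean_gain; field; rewrite a0 gt_eqF.
Qed.

Lemma continuous_gmean : continuous (@gmean R).
Proof. by move=> q; exact: is_derive_continuous (is_derive_gmean q). Qed.

Lemma continuous_gvar : continuous (@gvar R).
Proof. by move=> q; exact: is_derive_continuous (is_derive_gvar q). Qed.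

Lemma continuous_gdvar : continuous (@gdvar R).
Proof.
move=> q; have hM := der_mul (der_cst 2 q) (is_derive_gmean q).
have h1 := der_sub (der_mul hM (der_sub hM (der_id q))) (der_cst 1 q).
exact: is_derive_continuous (der_mul (der_mul (der_cst 2 q) (is_derive_mills q)) h1).
Qed.

Lemma continuous_mean_act a : continuous (mean_act a).
Proof.
move=> v; apply: cvgM; last exact: cvg_cst.
apply: (@continuous_comp _ _ _ (fun v => a * Phi (v + B)) gmean); last exact: continuous_gmean.
apply: cvgM; first exact: cvg_cst.
apply: (@continuous_comp _ _ _ (fun v => v + B) Phi); last exact: Phi_cont.
by apply: cvgD; [exact: cvg_id|exact: cvg_cst].
Qed.

(** Intermediate values on [[0, mean_act a 0]]: as [w < 0], [mean_act a (w c) <= mean_act a 0] for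
    [c >= 0]. *)
Lemma mean_act_fixpoint a : 0 < a -> exists c, c = mean_act a (w * c).
Proof.
move=> a0; pose M := mean_act a 0; have M0 : 0 < M by exact: mean_act_gt0.
have cf : continuous (fun c => c - mean_act a (w * c)).
  move=> c; apply: cvgB; first exact: cvg_id.
  apply: (@continuous_comp _ _ _ (fun c => w * c) (mean_act a)); last exact: continuous_mean_act.
  by apply: cvgM; [exact: cvg_cst|exact: cvg_id].
have [||c _ /eqP] := @IVT R (fun c => c - mean_act a (w * c)) 0 M 0 (ltW M0).
- exact: continuous_subspaceT.
- rewrite mulr0 sub0r -/M ge_min oppr_le0 (ltW M0) /= le_max subr_ge0 mean_act_homo ?orbT//.
  by rewrite nmulr_rle0// ltW.
- by rewrite subr_eq0 => /eqP; exists c.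
Qed.

Variables (cc : R -> R).
Hypothesis ccE : forall a, 0 < a -> cc a = mean_act a (w * cc a).

(** [c |-> mean_act a (w c)] is nonincreasing, so its fixed point moves no more than the map does at
    a fixed argument. *)
Lemma cc_lipschitz a a' : 0 < a -> 0 < a' ->
  `|cc a' - cc a| <= `|mean_act a' (w * cc a) - mean_act a (w * cc a)|.
Proof.
move=> a0 a'0; rewrite -(ccE a0); have [c1|c1] := leP (cc a) (cc a').
  rewrite ger0_norm ?subr_ge0//; apply: le_trans (ler_norm _); rewrite lerB// {1}(ccE a'0).
  by apply: mean_act_homo => //; rewrite ler_nM2l.
rewrite ltr0_norm ?subr_lt0// -normrN; apply: le_trans (ler_norm _).
rewrite !opprB lerB// [leRHS](ccE a'0); apply: mean_act_homo => //; rewrite ler_nM2l//; exact: ltW.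
Qed.

Definition pt2 a v : 'I_2 -> R := fun i => [:: a; v]`_i.

Lemma pt2E a v : (pt2 a v (inord 0) = a) * (pt2 a v (inord 1) = v).
Proof. by rewrite /pt2 !inordK. Qed.

Lemma sum2 (x : 'I_2 -> R) : \sum_i x i = x (inord 0) + x (inord 1).
Proof.
rewrite !big_ord_recl big_ord0 addr0.
by congr (_ + _); congr x; apply: val_inj; rewrite /= inordK.
Qed.

(** The partial derivative of [mean_act] in [a]. *)
Definition mean_drift a v : R :=
  (gvar (a * Phi (v + B)) * Phi (v + B) * a - gmean (a * Phi (v + B))) / (Ld * a ^+ 2).

Lemma mean_drift_lt0 a v : 0 < a -> mean_drift a v < 0.
Proof.
move=> a0; rewrite /mean_drift pmulr_llt0 ?invr_gt0 ?mulr_gt0 ?exprn_gt0//.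
have q0 : 0 <= a * Phi (v + B) by rewrite mulr_ge0 ?Phi_ge0// ltW.
move: (Phi (v + B)) q0 => p q0.
(* Expanding [gvar] and [gmean], the terms linear in [a p] cancel and a visibly negative product is
   left. *)
rewrite (_ : _ - _ = - (mills (a * p) * (2 * gmean (a * p) * (a * p) + 1))); last first.
  by rewrite /gvar /gmean; ring.
by rewrite oppr_lt0 mulr_gt0 ?mills_gt0// ltr_wpDl// mulr_ge0// mulr_ge0// ltW// gmean_gt0.
Qed.

Variable (a0 : R).
Hypotheses (a0_gt0 : 0 < a0) (vB0 : 0 < w * cc a0 + B).
Local Notation v0 := (w * cc a0).
Variable r : R.
Hypotheses (r_gt0 : 0 < r) (ra : r <= a0 / 2) (rv : r <= (v0 + B) / 2).

(** By [ra] and [rv], here [a >= a0 / 2] and [v + B] is at least half of [v0 + B], away from the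
    possible singularity of [Phi] at 0. *)
Definition box2 : set ('I_2 -> R) := [set x | `|x (inord 0) - a0| <= r /\ `|x (inord 1) - v0| <= r].

Lemma C1on_Phi : C1on [set y | (v0 + B) / 2 <= y <= v0 + B + r] Phi Phi1.
Proof.
apply: C1on_derive => y /andP[y1 _]; have y0 : 0 < y by apply: lt_le_trans y1; rewrite divr_gt0.
by split; [exact: is_derive_Phi|exact: is_derive_continuous (is_derive_Phi1 y0)].
Qed.

Lemma C1on_Phi1 : C1on [set y | (v0 + B) / 2 <= y <= v0 + B + r] Phi1 Phi2.
Proof.
apply: C1on_derive => y /andP[y1 _]; have y0 : 0 < y by apply: lt_le_trans y1; rewrite divr_gt0.
by split; [exact: is_derive_Phi1|exact: continuous_Phi2].
Qed.

Lemma C1on_inv : C1on [set y | a0 / 2 <= y <= a0 + r] (fun y => y^-1) (fun y => - (y ^+ 2)^-1).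
Proof.
apply: C1on_derive => y /andP[y1 _].
have y0 : y != 0 by rewrite gt_eqF//; apply: lt_le_trans y1; rewrite divr_gt0.
split; first by apply: (der_ext (@der_inv _ (fun y => y) y 1 y0 (der_id y))) => //; rewrite mulr1.
have h := @der_inv _ (fun y => y * y) _ _ (mulf_neq0 y0 y0) (der_mul (der_id y) (der_id y)).
rewrite (_ : (fun y => _) = (fun y => - (y * y)^-1)); last by apply/funext => t; rewrite expr2.
exact: is_derive_continuous (der_opp h).
Qed.

Lemma mean_act_UC1 : UC1 box2 (fun x => mean_act (x (inord 0)) (x (inord 1)))
  (fun x i => mean_drift (x (inord 0)) (x (inord 1)) * (i == inord 0)%:R +
     mean_gain (x (inord 0)) (x (inord 1)) * (i == inord 1)%:R).
Proof.
have [ra' rv' r0'] := And3 ra rv r_gt0.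
have near_bound (x y : R) : `|x - y| <= r -> `|x| <= `|y| + r.
  by move=> h; rewrite -[x](subrK y) addrC; apply: le_trans (ler_normD _ _) _; rewrite lerD2l.
have Ua : UC1 box2 (fun x => x (inord 0)) (fun _ i => (i == inord 0)%:R).
  apply: (UC1_coord (M := `|a0| + r)); first by rewrite addr_ge0// ltW.
  by move=> x [h _]; exact: near_bound.
have Uv : UC1 box2 (fun x => x (inord 1)) (fun _ i => (i == inord 1)%:R).
  apply: (UC1_coord (M := `|v0| + r)); first by rewrite addr_ge0// ltW.
  by move=> x [_ h]; exact: near_bound.
have UvB := UC1_D Uv (UC1_cst box2 B).
have UPhi := UC1_comp C1on_Phi UvB.
have {}UPhi : UC1 box2 (fun x => Phi (x (inord 1) + B)) (fun x i => Phi1 (x (inord 1) + B) * ((i == inord 1)%:R + 0)).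
  by apply: UPhi => x [_]; rewrite /= ler_norml => /andP[h1 h2]; apply/andP; split; lra.
have UM := UC1_comp_derive is_derive_gmean continuous_gvar (UC1_M Ua UPhi).
have UI : UC1 box2 (fun x => (x (inord 0))^-1) (fun x i => - (x (inord 0) ^+ 2)^-1 * (i == inord 0)%:R).
  by apply: (UC1_comp C1on_inv Ua) => x [+ _]; rewrite /= ler_norml => /andP[h1 h2]; apply/andP; split; lra.
apply: (UC1_eq (UC1_Z Ld^-1 (UC1_M UM UI))) => [x _|x i [+ _]].
  by rewrite /mean_act invfM; ring.
rewrite ler_norml => /andP[h1 h2]; have x0 : 0 < x (inord 0) by lra.
rewrite /mean_drift /mean_gain; move: (x (inord 0)) (x (inord 1)) x0 => a v a1.
by move: (_%:R) (_%:R) => b b'; field; rewrite !gt_eqF.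
Qed.

(** Implicit differentiation of [c = mean_act a (w c)]; the denominator is at least 1 because
    [w < 0 <= mean_gain]. The bound [r / 2] leaves the other half of the box to the increments
    [z y]. *)
Lemma cc_C1 : exists2 r1 : R, 0 < r1 & [/\ r1 < a0, forall s, `|s| <= r1 -> `|w * (cc (a0 + s) - cc a0)| <= r / 2 &
  C1on [set s | `|s| <= r1] (fun s => cc (a0 + s))
   (fun s => mean_drift (a0 + s) (w * cc (a0 + s)) / (1 - w * mean_gain (a0 + s) (w * cc (a0 + s))))].
Proof.
have [ra' rv' r0' a0' vB'] := And5 ra rv r_gt0 a0_gt0 vB0.
have U := mean_act_UC1.
have nw : 0 < `|w| by rewrite normr_gt0 lt_eqF.
have e0 : 0 < r / (2 * `|w|) by rewrite divr_gt0// mulr_gt0.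
have [q q0 Hq] := UC1_unif U e0.
have [CL CL0 [q' q'0 Hq']] := UC1_lipschitz U.
pose r1 := Num.min (r / 2) (Num.min (q / 2) (q' / 4)).
have r10 : 0 < r1 by rewrite !lt_min !divr_gt0.
have r1r : r1 <= r / 2 := minr_lel _ _.
have r1q : r1 <= q / 2 := le_trans (minr_ler _ _) (minr_lel _ _).
have r1q' : r1 <= q' / 4 := le_trans (minr_ler _ _) (minr_ler _ _).
have ap s : `|s| <= r1 -> 0 < a0 + s.
  by rewrite ler_norml => /andP[h1 h2]; lra.
have near2 qq a v a' v' : `|a' - a| < qq -> `|v' - v| < qq -> forall i, `|pt2 a' v' i - pt2 a v i| < qq.
  by move=> h1 h2 [[|[|//]] hi]; rewrite /pt2.
have cnear s : `|s| <= r1 -> `|w * (cc (a0 + s) - cc a0)| <= r / 2.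
  move=> sr; have h := cc_lipschitz a0_gt0 (ap s sr).
  have := Hq (pt2 a0 v0) (pt2 (a0 + s) v0).
  rewrite /box2 /= !pt2E !subrr normr0 => H.
  have {}H : `|mean_act (a0 + s) v0 - mean_act a0 v0| <= r / (2 * `|w|).
    apply: H; first by rewrite ltW.
      by rewrite addrAC subrr add0r; split; [lra|rewrite ltW].
    apply: near2; rewrite ?subrr ?normr0//.
    by rewrite addrAC subrr add0r; lra.
  rewrite normrM; apply: le_trans (ler_wpM2l (normr_ge0 _) (le_trans h H)) _.
  by rewrite le_eqVlt; apply/orP; left; apply/eqP; field; rewrite gt_eqF.
have bx s : `|s| <= r1 -> box2 (pt2 (a0 + s) (w * cc (a0 + s))).
  move=> sr; rewrite /box2 /= !pt2E addrAC subrr add0r -mulrBr.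
  by split; [lra|apply: le_trans (cnear s sr) _; lra].
have bx' s s' : `|s| <= r1 -> `|s'| <= r1 -> box2 (pt2 (a0 + s') (w * cc (a0 + s))).
  move=> sr sr'; rewrite /box2 /= !pt2E addrAC subrr add0r -mulrBr.
  by split; [lra|apply: le_trans (cnear s sr) _; lra].
exists r1 => //; split=> //; first by lra.
pose g s := mean_drift (a0 + s) (w * cc (a0 + s)); pose h s := mean_gain (a0 + s) (w * cc (a0 + s)).
have [[M M0 HM] HU] := U.
have gb s : `|s| <= r1 -> [/\ `|cc (a0 + s)| <= M, `|g s| <= M & `|h s| <= M].
  move=> sr; have [h1 h2] := HM _ (bx s sr); rewrite !pt2E in h1.
  split; first by rewrite (ccE (ap s sr)).
    have := h2 (inord 0); rewrite !pt2E eqxx (_ : (_ == _) = false); last by rewrite -val_eqE /= !inordK.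
    by rewrite mulr1 mulr0 addr0.
  have := h2 (inord 1); rewrite !pt2E eqxx (_ : (_ == _) = false); last by rewrite -val_eqE /= !inordK.
  by rewrite mulr1 mulr0 add0r.
have h0 s : `|s| <= r1 -> 1 <= 1 - w * h s.
  move=> sr; rewrite lerDl oppr_ge0 nmulr_rle0//; apply: mean_gain_ge0; first exact: ap.
  by have := cnear s sr; rewrite ler_norml => /andP[]; move: (cc (a0 + s)) => c; lra.
have quo (x y : R) : 1 <= y -> `|x / y| <= `|x|.
  move=> y1; have y0 : 0 < y by exact: lt_le_trans y1.
  by rewrite normrM ler_piMr// normrV ?unitfE ?gt_eqF// gtr0_norm// invf_le1.
have cl s s' : `|s| <= r1 -> `|s'| <= r1 -> `|cc (a0 + s') - cc (a0 + s)| <= CL * `|s' - s|.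
  move=> sr sr'; apply: le_trans (cc_lipschitz (ap s sr) (ap s' sr')) _.
  have := Hq' _ _ (bx s sr) (bx' s s' sr sr').
  rewrite sum2 !pt2E !subrr normr0 addr0 (_ : a0 + s' - (a0 + s) = s' - s); last by ring.
  apply; apply: near2; rewrite ?subrr ?normr0//.
  rewrite (_ : a0 + s' - (a0 + s) = s' - s); last by ring.
  by apply: le_lt_trans (ler_normB _ _) _; lra.
split.
  exists M => // s sr; have [b1 b2 b3] := gb s sr; split=> //.
  exact: le_trans (quo _ _ (h0 s sr)) b2.
move=> e e0'; pose K := (1 + `|w|) * (1 + CL) * (1 + M).
have wCL : 0 <= `|w| * CL by rewrite mulr_ge0// ltW.
have wM : 0 <= `|w| * M by rewrite mulr_ge0.
have K0 : 0 < K by rewrite !mulr_gt0 ?ltr_wpDr// ltW.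
have [p p0 Hp] := HU _ (divr_gt0 e0' K0).
pose c := 1 + `|w| * CL.
have c0 : 0 < c by rewrite ltr_wpDr.
exists (p / c); first by rewrite divr_gt0.
move=> s s' sr sr' d.
have d1 : c * `|s' - s| < p by rewrite -ltr_pdivlMl// mulrC.
have ds0 := normr_ge0 (s' - s).
have cl1 := cl s s' sr sr'.
have wcl : `|w * (cc (a0 + s') - cc (a0 + s))| <= `|w| * CL * `|s' - s|.
  by rewrite normrM -mulrA ler_wpM2l.
have wcs : 0 <= `|w| * CL * `|s' - s| by rewrite mulr_ge0.
have [|H1 H2] := Hp _ _ (bx s sr) (bx s' sr').
  apply: near2; first by rewrite (_ : a0 + s' - (a0 + s) = s' - s); [apply: le_lt_trans d1; rewrite /c mulrDl mul1r lerDl|ring].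
  by rewrite -mulrBr; apply: le_lt_trans wcl (le_lt_trans _ d1); rewrite /c mulrDl mul1r lerDr.
have ne01 : (inord 0 == inord 1 :> 'I_2) = false by rewrite -val_eqE /= !inordK.
have ne10 : (inord 1 == inord 0 :> 'I_2) = false by rewrite -val_eqE /= !inordK.
have G1 : `|g s' - g s| <= e / K.
  by have := H2 (inord 0); rewrite !pt2E eqxx ne01 !mulr1 !mulr0 !addr0.
have G2 : `|h s' - h s| <= e / K.
  by have := H2 (inord 1); rewrite !pt2E eqxx ne10 !mulr1 !mulr0 !add0r.
have m1 := h0 s sr; have m1' := h0 s' sr'.
have [gb1 gb2 gb3] := gb s sr; have [gb1' gb2' gb3'] := gb s' sr'.
have eK0 : 0 < e / K by rewrite divr_gt0.
have eKK : e / K * K = e by rewrite divfK// gt_eqF.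
clear Hp HU HM Hq Hq' U H2.
have w0' := normr_ge0 w.
split.
  move: H1; rewrite !sum2 !pt2E !eqxx ne01 ne10 !mulr1 !mulr0 !addr0 !add0r -!ccE ?ap//.
  rewrite (_ : a0 + s' - (a0 + s) = s' - s); last by ring.
  rewrite -mulrBr -/(g s) -/(h s) => H1.
  set D := cc (a0 + s') - cc (a0 + s) in wcl H1 *.
  (* Both ends being fixed points, [D] is [g (s' - s) + h w D] up to the expansion error; solving
     for [D] divides that error by [1 - w h]. *)
  have -> : D - g s / (1 - w * h s) * (s' - s) = (D - (g s * (s' - s) + h s * (w * D))) / (1 - w * h s).
    by field; rewrite gt_eqF// (lt_le_trans ltr01 m1).
  apply: le_trans (quo _ _ m1) (le_trans H1 _).
  move: (e / K) eK0 eKK => k k0 kK; rewrite -kK -mulrA ler_pM2l//.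
  apply: le_trans (_ : (1 + `|w| * CL) * `|s' - s| <= _); first by rewrite mulrDl mul1r lerD2l.
  rewrite ler_wpM2r// /K; apply: le_trans (_ : (1 + `|w|) * (1 + CL) <= _).
    rewrite (_ : (1 + `|w|) * (1 + CL) = (1 + `|w| * CL) + (`|w| + CL)); last by ring.
    by rewrite lerDl addr_ge0// ltW.
  by rewrite ler_peMr ?lerDl// mulr_ge0// addr_ge0// ltW.
have -> : g s' / (1 - w * h s') - g s / (1 - w * h s) =
   ((g s' - g s) + g s' / (1 - w * h s') * (w * (h s' - h s))) / (1 - w * h s).
  by field; rewrite !gt_eqF ?(lt_le_trans ltr01 m1) ?(lt_le_trans ltr01 m1').
apply: le_trans (quo _ _ m1) (le_trans (ler_normD _ _) _).
have t1 := ler_pM (normr_ge0 _) (mulr_ge0 (normr_ge0 _) (normr_ge0 _)) (le_trans (quo _ _ m1') gb2')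
  (ler_wpM2l (normr_ge0 w) G2).
rewrite -!normrM in t1.
apply: le_trans (lerD G1 t1) _.
move: (e / K) eK0 eKK => k k0 kK; rewrite -kK /K.
rewrite (_ : k + _ = k * (1 + M * `|w|)); last by ring.
rewrite ler_pM2l//; apply: le_trans (_ : (1 + `|w|) * (1 + M) <= _).
  rewrite (_ : (1 + `|w|) * (1 + M) = (1 + M * `|w|) + (`|w| + M)); last by ring.
  by rewrite lerDl addr_ge0.
rewrite mulrAC ler_peMr ?lerDl//; first by rewrite mulr_ge0// addr_ge0.
exact: ltW.
Qed.

End homogeneous_curve.

(** * Divided increments of the activation *)

Section increments.
Context {R : realType}.
Implicit Types (a c e q s t v y z : R).
Variables (Phi : R -> R) (B w Ld : R).
Hypothesis Phi_C3 : C3_off0 Phi.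
Hypothesis Phi_incr : forall s t, 0 <= s -> s <= t -> Phi s <= Phi t.
Hypothesis Phi_neg : forall s, s <= 0 -> Phi s = 0.
Hypotheses (w0 : w < 0) (Ld0 : 0 < Ld).
Local Notation Phi1 := (derive1n 1 Phi).
Local Notation Phi2 := (derive1n 2 Phi).
Local Notation act := (mean_act Phi B Ld).
Local Notation gain := (mean_gain Phi B Ld).
Variables (cc : R -> R).
Hypothesis ccE : forall a, 0 < a -> cc a = act a (w * cc a).
Variable (a0 : R).
Hypotheses (a0_gt0 : 0 < a0) (vB0 : 0 < w * cc a0 + B).
Local Notation v0 := (w * cc a0).

Let inord4E i j : (i < 4)%N -> (j < 4)%N -> (inord i == inord j :> 'I_4) = (i == j).
Proof. by move=> i4 j4; rewrite -val_eqE /= !inordK. Qed.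

(** The quotient is the mean over [t] of [y] times the gain at [w cc + t z y], hence regular at
    [z = 0]. One derivative is spent on the division, so [Phi2] enters the partial derivatives of
    [P]. *)
Theorem mean_act_increments Y : 1 <= Y -> gain a0 v0 != 0 -> 0 <= Phi2 (v0 + B) ->
  exists (r0 K1 CP : R) (dC : R -> R) (P Ps Pz Py : R -> R -> R -> R),
  [/\ 0 < r0 < a0, 0 < K1, 0 <= CP, C1on [set s | `|s| <= r0] (fun s => cc (a0 + s)) dC &
  [/\ forall e, 0 < e -> exists2 q : R, 0 < q & forall s z y s' z' y',
       [/\ `|s| <= r0, `|z| <= r0 & `|y| <= Y] -> [/\ `|s'| <= r0, `|z'| <= r0 & `|y'| <= Y] ->
       `|s' - s| < q -> `|z' - z| < q -> `|y' - y| < q ->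
       [/\ `|P s' z' y' - P s z y - Ps s z y * (s' - s) - Pz s z y * (z' - z) - Py s z y * (y' - y)| <=
             e * (`|s' - s| + `|z' - z| + `|y' - y|),
           `|Ps s' z' y' - Ps s z y| <= e, `|Pz s' z' y' - Pz s z y| <= e &
           `|Py s' z' y' - Py s z y| <= e],
     forall s z y, [/\ `|s| <= r0, `|z| <= r0 & `|y| <= Y] ->
       [/\ `|P s z y| <= CP, `|Ps s z y| <= CP, `|Pz s z y| <= CP & `|Py s z y| <= CP],
     [/\ forall y, P 0 0 y = gain a0 v0 * y, forall y, Ps 0 0 y = K1 * y & forall y, Py 0 0 y = gain a0 v0] &
     forall s z y, `|s| <= r0 -> `|z| <= r0 -> `|y| <= Y ->
       z * P s z y = act (a0 + s) (w * cc (a0 + s) + z * y) - cc (a0 + s)]].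
Proof.
move=> Y1 K0n Phi20.
have Y0 : 0 < Y by exact: lt_le_trans Y1.
pose r := Num.min (a0 / 2) ((v0 + B) / 2).
have r_gt0 : 0 < r by rewrite lt_min !divr_gt0.
have ra : r <= a0 / 2 := minr_lel _ _.
have rv : r <= (v0 + B) / 2 := minr_ler _ _.
clearbody r.
have [r1 r10 [r1a ccr]] := cc_C1 Phi_C3 Phi_incr Phi_neg w0 Ld0 ccE a0_gt0 vB0 r_gt0 ra rv.
set dC := (fun s => _ / _) => C1c.
(* Thus [|t z y| <= r / 2]; with the [r / 2] granted to [w (cc (a0 + s) - cc a0)], the argument of
   [Phi] stays in the smooth range. *)
pose r0 := Num.min r1 (r / (2 * Y)).
have r00 : 0 < r0 by rewrite lt_min r10 divr_gt0// mulr_gt0.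
have r01 : r0 <= r1 := minr_lel _ _.
have r0Y : r0 * Y <= r / 2.
  have : r0 <= r / (2 * Y) := minr_ler _ _.
  move=> h; rewrite (_ : r / 2 = r / (2 * Y) * Y); first by rewrite ler_pM2r.
  by field; rewrite gt_eqF.
clearbody r0.
pose box := box4 r0 r0 Y.
have U0 : UC1 box (fun x => x (inord 0)) (fun _ i => (i == inord 0)%:R).
  by apply: (UC1_coord (M := 1)) => // x [/andP[h0 h1] _ _ _]; rewrite ger0_norm.
have U1 : UC1 box (fun x => x (inord 1)) (fun _ i => (i == inord 1)%:R).
  by apply: (UC1_coord (M := r0)) => [|x []//]; exact: ltW.
have U2 : UC1 box (fun x => x (inord 2)) (fun _ i => (i == inord 2)%:R).
  by apply: (UC1_coord (M := r0)) => [|x []//]; exact: ltW.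
have U3 : UC1 box (fun x => x (inord 3)) (fun _ i => (i == inord 3)%:R).
  by apply: (UC1_coord (M := Y)) => [|x []//]; exact: ltW.
have Ucc : UC1 box (fun x => cc (a0 + x (inord 1))) (fun x i => dC (x (inord 1)) * (i == inord 1)%:R).
  by apply: (UC1_comp C1c U1) => x [_ h _ _]; exact: le_trans r01.
have UvB := UC1_D (UC1_D (UC1_Z w Ucc) (UC1_M U0 (UC1_M U2 U3))) (UC1_cst box B).
have vJ x : box x -> (v0 + B) / 2 <= w * cc (a0 + x (inord 1)) + x (inord 0) * (x (inord 2) * x (inord 3)) + B <= v0 + B + r.
  move=> [/andP[x0 x1] h1 h2 h3].
  have k1 : `|w * (cc (a0 + x (inord 1)) - cc a0)| <= r / 2 by apply: ccr; exact: le_trans r01.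
  have k2 : `|x (inord 0) * (x (inord 2) * x (inord 3))| <= r / 2.
    rewrite !normrM (ger0_norm x0); apply: le_trans r0Y.
    by apply: le_trans (ler_pM _ _ h2 h3) => //; rewrite ler_piMl// mulr_ge0.
  move: k1 k2; rewrite mulrBr !ler_norml => /andP[k1 k2] /andP[k3 k4].
  by apply/andP; split; lra.
have UPhi := UC1_comp (C1on_Phi Phi_C3 vB0 r) UvB vJ.
have UPhi1 := UC1_comp (C1on_Phi1 Phi_C3 vB0 r) UvB vJ.
have Ua := UC1_D (UC1_cst box a0) U1.
have Ugv := UC1_comp_derive is_derive_gvar continuous_gdvar (UC1_M Ua UPhi).
have Up0 := UC1_M U3 (UC1_Z Ld^-1 (UC1_M Ugv UPhi1)).
pose p (x : 'I_4 -> R) := x (inord 3) * gain (a0 + x (inord 1)) (w * cc (a0 + x (inord 1)) + x (inord 0) * (x (inord 2) * x (inord 3))).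
pose V (x : 'I_4 -> R) := w * cc (a0 + x (inord 1)) + x (inord 0) * (x (inord 2) * x (inord 3)) + B.
pose dV (x : 'I_4 -> R) (i : 'I_4) := w * (dC (x (inord 1)) * (i == inord 1)%:R) +
   ((i == inord 0)%:R * (x (inord 2) * x (inord 3)) + x (inord 0) * ((i == inord 2)%:R * x (inord 3) + x (inord 2) * (i == inord 3)%:R)).
pose Dp (x : 'I_4 -> R) (i : 'I_4) := (i == inord 3)%:R * gain (a0 + x (inord 1)) (V x - B) +
  x (inord 3) * (Ld^-1 * (gdvar ((a0 + x (inord 1)) * Phi (V x)) *
      ((i == inord 1)%:R * Phi (V x) + (a0 + x (inord 1)) * (Phi1 (V x) * dV x i)) * Phi1 (V x) +
      gvar ((a0 + x (inord 1)) * Phi (V x)) * (Phi2 (V x) * dV x i))).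
have Up : UC1 box p Dp.
  apply: (UC1_eq Up0) => [x _|x i _]; first by rewrite /p /mean_gain; ring.
  rewrite /Dp /mean_gain /V /dV addrK.
  set T := gdvar _; set T1 := gvar _; set T2 := derive1n 1 Phi _; set T3 := derive1n 2 Phi _; set T4 := Phi _.
  by move: T T1 T2 T3 T4 => T T1 T2 T3 T4; ring.
have q00 : 0 <= a0 * Phi (v0 + B) by rewrite mulr_ge0 ?(Phi_ge0 Phi_incr Phi_neg)// ltW.
(* The derivative at [s = 0] of the gain along the homogeneous curve, where [a] acts both directly
   and through [cc]. *)
pose K1 := Ld^-1 * (gdvar (a0 * Phi (v0 + B)) * (Phi (v0 + B) + a0 * (Phi1 (v0 + B) * (w * dC 0))) * Phi1 (v0 + B) +
   gvar (a0 * Phi (v0 + B)) * (Phi2 (v0 + B) * (w * dC 0))).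
(* A nonzero gain forces [Phi1 > 0], and [w dC 0 > 0] since the drift and [w] are negative; the
   first summand is then positive and the one in [Phi2] nonnegative. *)
have K1p : 0 < K1.
  have P1 : 0 < Phi1 (v0 + B).
    rewrite lt_neqAle (Phi1_ge0 Phi_C3 Phi_incr Phi_neg vB0) andbT eq_sym.
    by apply: contra_neq K0n => h; rewrite /mean_gain h mulr0 mul0r.
  have wdC : 0 < w * dC 0.
    rewrite nmulr_rgt0// /dC addr0 ltr_pdivrMr ?mul0r; first exact: mean_drift_lt0.
    rewrite subr_gt0; apply: le_lt_trans ltr01; rewrite nmulr_rle0//.
    exact: (mean_gain_ge0 Phi_C3 Phi_incr Phi_neg).
  rewrite /K1 pmulr_rgt0 ?invr_gt0//; apply: ltr_wpDr.
    by rewrite mulr_ge0 ?gvar_ge0// mulr_ge0// ltW.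
  rewrite mulr_gt0// mulr_gt0 ?gdvar_gt0// ltr_wpDl ?(Phi_ge0 Phi_incr Phi_neg)//.
  by rewrite mulr_gt0// mulr_gt0.
have [CP CP0 Pb] := unit_mean_bounded Up.
exists r0, K1, CP, dC, (fun s z y => unit_mean (fun t => p (pt4 t s z y))),
  (fun s z y => unit_mean (fun t => Dp (pt4 t s z y) (inord 1))),
  (fun s z y => unit_mean (fun t => Dp (pt4 t s z y) (inord 2))),
  (fun s z y => unit_mean (fun t => Dp (pt4 t s z y) (inord 3))).
split=> //; first by rewrite r00 (le_lt_trans r01).
  move: C1c => [[M M0 HM] HC]; split; first by exists M => // s sr; apply: HM; exact: le_trans r01.
  move=> e /HC[q q0 Hq]; exists q => // s s' sr sr'; apply: Hq; exact: le_trans r01.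
split.
- by move=> e /(unit_mean_C1 Up).
- by move=> s z y [hs hz hy]; exact: Pb.
- split=> y; apply: unit_mean_cst => t _.
  + by rewrite /p !pt4E addr0 mul0r mulr0 addr0 mulrC.
  + rewrite /Dp /dV /V !pt4E !inord4E//= !(addr0, mul0r, mulr0, mulr1, add0r) /K1 /=.
    by ring.
  + rewrite /Dp /V !pt4E addr0 mul0r mulr0 addr0 addrK eqxx mul1r.
    by rewrite /dV !pt4E !inord4E//= !(mul0r, mulr0, addr0).
- move=> s z y hs hz hy.
  have as0 : 0 < a0 + s.
    by move: (le_trans hs r01); rewrite ler_norml => /andP[h _]; move: r1a h a0_gt0; lra.
  apply: etrans (unit_mean_FTC Up (G := fun t => act (a0 + s) (w * cc (a0 + s) + t * (z * y))) hs hz hy _) _; last first.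
    by rewrite mul1r mul0r addr0 -ccE.
  move=> t t01.
  have := vJ _ (box4E t01 hs hz hy); rewrite !pt4E => /andP[vp _].
  have {}vp : 0 < w * cc (a0 + s) + t * (z * y) + B by apply: lt_le_trans vp; rewrite divr_gt0.
  have h := der_add (der_cst (w * cc (a0 + s)) t) (der_mul (der_id t) (der_cst (z * y) t)).
  apply: (der_ext (@der_comp _ (act (a0 + s)) (fun t => w * cc (a0 + s) + t * (z * y)) _ _ _
    (is_derive_mean_act Phi_C3 Ld0 (lt0r_neq0 as0) vp) h)) => //.
  by rewrite /p !pt4E; ring.
Qed.

End increments.

(** * Stationary states of the model *)

Section L2_representatives.
Context {R : realType} {L : R} {d : nat} (L0 : 0 < L).
Implicit Types (u v : 'rV[R]_d -> R) (e M : R).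
Local Notation mu := (torus_measure L d).

Lemma Lnorm2E u : ('N[mu]_2%:E[EFin \o u] = (\int[mu]_x ((u x) ^+ 2)%:E) `^ 2^-1)%E.
Proof.
rewrite unlock /Lnorm; congr (_ `^ _)%E; apply: eq_integral => x _ /=.
by rewrite powR_mulrn// -normrX ger0_norm// sqr_ge0.
Qed.

Lemma sq_integrable_Lfun u : u \in Lfun mu 2%:E <-> sq_integrable L u.
Proof.
split=> [/andP[]|[mu_ iu]].
  rewrite !inE /= => mu_; rewrite /finite_norm Lnorm2E => lu; split=> //.
  apply/integrableP; split; first exact/measurable_EFinP/measurable_funX.
  under eq_integral => x _ do rewrite /= ger0_norm ?sqr_ge0//.
  by rewrite ltNge leye_eq; apply/negP => /eqP h; move: lu; rewrite h poweRyr ?ltxx// invr_neq0.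
apply/andP; split; rewrite !inE//= /finite_norm Lnorm2E.
have := integrable_lty measurableT iu.
rewrite -(@fineK _ (\int[mu]_x ((u x) ^+ 2)%:E)%E) ?poweR_EFin ?ltry//.
exact: integrable_fin_num iu.
Qed.

Lemma L2norm_sqr u : sq_integrable L u -> L2norm L u ^+ 2 = \int[mu]_x (u x ^+ 2).
Proof.
move=> [mu_ iu]; rewrite /L2norm Lnorm2E.
have i0 : 0 <= \int[mu]_x (u x ^+ 2) by apply: Rintegral_ge0 => x _; exact: sqr_ge0.
rewrite -(@fineK _ (\int[mu]_x ((u x) ^+ 2)%:E)%E) ?poweR_EFin /=; last exact: integrable_fin_num iu.
by rewrite -/(Rintegral mu setT (fun x => u x ^+ 2)) powR12_sqrt// sqr_sqrtr.
Qed.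

Lemma L2norm_ge0 u : 0 <= L2norm L u.
Proof. by rewrite fine_ge0// Lnorm_ge0. Qed.

Lemma L2norm_bounded u M : measurable_fun setT u -> bounded_by u M -> L2norm L u <= M * Num.sqrt (L ^+ d).
Proof.
move=> mu_ uM; have M0 : 0 <= M := le_trans (normr_ge0 _) (uM 0).
have V0 : 0 <= L ^+ d by rewrite exprn_ge0// ltW.
rewrite -(@ler_pXn2r _ 2)// ?nnegrE ?L2norm_ge0// ?mulr_ge0 ?sqrtr_ge0//.
rewrite L2norm_sqr; last exact: sq_integrable_bounded uM.
rewrite exprMn sqr_sqrtr// -(Rintegral_torus_cst L0).
have [_ iu] := @sq_integrable_bounded R L d u M mu_ uM.
apply: le_Rintegral => //; first by apply: (nice_integrable1 (nice_cst L (M ^+ 2))).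
by move=> x _; rewrite -real_normK ?num_real// lerXn2r// ?nnegrE.
Qed.

Lemma L2norm_eq0 u : sq_integrable L u -> L2norm L u = 0 -> u = cst 0 %[ae mu].
Proof.
move=> su u0; have [mu_ iu] := su.
have : ('N[mu]_2%:E[EFin \o u] = 0)%E.
  have /sq_integrable_Lfun/andP[_] := su; rewrite inE /= /finite_norm => lu.
  by rewrite -(@fineK _ ('N[mu]_2%:E[EFin \o u])%E) ?ge0_fin_numE ?Lnorm_ge0//; congr EFin; exact: u0.
have mEu : measurable_fun setT (EFin \o u) by exact/measurable_EFinP.
have two0 : (0 < 2%:E :> \bar R)%E by rewrite lte_fin.
move=> /(Lnorm_eq0_eq0 mEu two0).
by apply: filterS => x /= h _; have [] := h I.
Qed.

Lemma Rintegral_ae_eq u v : measurable_fun setT u -> measurable_fun setT v -> u = v %[ae mu] ->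
  \int[mu]_x u x = \int[mu]_x v x.
Proof.
move=> mu_ mv uv; congr fine; apply: ae_eq_integral => //; try exact/measurable_EFinP.
by apply: filterS uv => x /= h xT; rewrite h.
Qed.

Lemma nice_L2S u : nice L u -> L2S L u.
Proof.
move=> [mu_ [M uM] uL ue]; split=> //; split=> //.
by apply/sq_integrable_Lfun; exact: sq_integrable_bounded uM.
Qed.

Lemma ae_cst_eq (c c' : R) : cst c = cst c' %[ae mu] -> c = c'.
Proof.
move=> h; have /(congr1 (fun t => t / L ^+ d)) : \int[mu]_x c = \int[mu]_x c'.
  exact: Rintegral_ae_eq (measurable_cst _) (measurable_cst _) h.
by rewrite !(Rintegral_torus_cst L0) !mulfK// expf_neq0// gt_eqF.
Qed.

Section convolution_L2.
Variables (W : 'rV[R]_d -> R).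
Hypotheses (sW : sq_integrable L W) (WL : Defs.periodic L W) (We : even_coords W).

Lemma sq_integrable_sub x : sq_integrable L (fun y => W (x - y)).
Proof.
have [mW iW] := sW; split.
  exact: (measurable_funE_comp mW (measurable_sub x)).
apply: (@integrable_torus_sub _ _ _ _ x (fun y => W y ^+ 2)) => //.
by move=> i y; rewrite WL.
Qed.

Lemma convB_sq u v x : sq_integrable L u -> sq_integrable L v ->
  Defs.conv L W (fun x => u x - v x) x = Defs.conv L W u x - Defs.conv L W v x.
Proof.
move=> su sv; rewrite /Defs.conv -RintegralB//; last 2 first.
- exact: sq_integrableM (sq_integrable_sub x) su.
- exact: sq_integrableM (sq_integrable_sub x) sv.
by apply: eq_Rintegral => y _; rewrite mulrBr.
Qed.

Lemma conv_ae_eq u v : measurable_fun setT u -> measurable_fun setT v -> u = v %[ae mu] ->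
  Defs.conv L W u = Defs.conv L W v.
Proof.
move=> mu_ mv uv; apply/funext => x; have [mW _] := sq_integrable_sub x.
apply: Rintegral_ae_eq; try exact: measurable_funM.
by apply: filterS uv => y /= h yT; rewrite h.
Qed.

(** Truncations of [u] converge in L^2, which [conv_small] turns into uniform convergence of the
    convolutions. This is how L^2 solutions reach the space of nice functions. *)
Lemma nice_conv_sq u : sq_integrable L u -> Defs.periodic L u -> even_coords u -> nice L (Defs.conv L W u).
Proof.
move=> su uL ue; have [mu_ _] := su.
pose T (n : nat) x := Num.max (- n%:R) (Num.min n%:R (u x)).
have n0 n : 0 <= n%:R :> R by [].
have Tb n x : `|T n x| <= n%:R.
  rewrite /T ler_norml le_max lexx /= ge_max ge_min lexx /= andbT.
  by rewrite -subr_ge0 opprK addr_ge0.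
have Tu n x : `|T n x| <= `|u x|.
  rewrite /T; have nn := n0 n; have [un|un] := leP n%:R (u x); last first.
    have [un'|un'] := leP (- n%:R) (u x) => //.
    by rewrite normrN ger0_norm// ltr0_norm; lra.
  rewrite (_ : Num.max _ _ = n%:R); last by apply/max_idPr; lra.
  by rewrite !ger0_norm//; lra.
have mT n : measurable_fun setT (T n).
  by apply: measurable_maxr; [exact: measurable_cst|apply: measurable_minr => //; exact: measurable_cst].
have nT n : nice L (T n).
  by split=> //; [exists n%:R|move=> i x; rewrite /T uL|move=> i x; rewrite /T ue].
have sT n : sq_integrable L (T n) by exact: sq_integrable_bounded (mT n) (Tb n).
have su' : sq_integrable L (fun x => `|u x|).
  have [_ iu] := su; split; first exact: measurableT_comp.
  by rewrite (_ : (fun x => _) = (fun x => u x ^+ 2))//; apply/funext => x; rewrite real_normK ?num_real.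
have Tc x : T n x @[n --> \oo] --> u x.
  apply/cvgrPdist_lt => e e0; near=> n; rewrite (_ : T n x = u x) ?subrr ?normr0//.
  have : `|u x| <= n%:R by near: n; exact: nbhs_infty_ger.
  by rewrite ler_norml /T => /andP[h1 h2]; rewrite (min_idPr h2) (max_idPr h1).
apply: nice_closed => e e0; have [r r0 Hr] := conv_small L0 sW WL e0.
have [|n hn] := sqdist_dominated su mT su' Tu _ r0; first exact: nearW.
exists (Defs.conv L W (T n)); split; first exact: (nice_conv L0 sW WL We).
by move=> x; rewrite -convB_sq//; apply: Hr => //; exact: sq_integrableB.
Unshelve. all: by end_near. Qed.

End convolution_L2.
End L2_representatives.

Section approximate_inverse.
Context {R : realType} {L : R} {d : nat} (L0 : 0 < L).
Implicit Types (u v r : 'rV[R]_d -> R) (M : R) (k j : {ffun 'I_d -> nat}).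
Local Notation mu := (torus_measure L d).

Lemma mode_sum (S : seq {ffun 'I_d -> nat}) (c : {ffun 'I_d -> nat} -> R) j : uniq S ->
  mode L (fun x => \sum_(k <- S) c k * chi L k x) j = (j \in S)%:R * (c j * chi_sqnorm L j).
Proof.
elim: S => [_|k S IH /= /andP[kS uS]].
  rewrite mul0r (_ : (fun x => _) = (fun x => 0 * chi L j x)); last first.
    by apply/funext => x; rewrite big_nil mul0r.
  by rewrite modeZ ?mul0r//; exact: nice_chi.
rewrite (_ : (fun x => _) = (fun x => c k * chi L k x + \sum_(k <- S) c k * chi L k x)); last first.
  by apply/funext => x; rewrite big_cons.
have nS : nice L (fun x => \sum_(k <- S) c k * chi L k x).
  by apply: nice_sum => i; apply: niceZ; exact: nice_chi.
rewrite modeD//; last by apply: niceZ; exact: nice_chi.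
rewrite modeZ ?IH//; last exact: nice_chi.
rewrite in_cons; have [->|jk] := eqVneq j k.
  by rewrite (negbTE kS) /= mul0r addr0 mul1r.
by rewrite chi_ortho 1?eq_sym// mulr0 add0r.
Qed.

Lemma bounded_by_sum (S : seq {ffun 'I_d -> nat}) (c : {ffun 'I_d -> nat} -> R) :
  bounded_by (fun x => \sum_(k <- S) c k * chi L k x) (\sum_(k <- S) `|c k|).
Proof.
move=> x; apply: le_trans (ler_norm_sum _ _ _) _; apply: ler_sum => k _.
by rewrite normrM ler_piMr// chi_bounded.
Qed.

Variables (W : 'rV[R]_d -> R) (K0 : R) (ks : {ffun 'I_d -> nat}).
Hypotheses (sW : sq_integrable L W) (WL : Defs.periodic L W) (We : even_coords W).
Hypothesis K0ks : forall k, mode L W k * K0 = 1 <-> k = ks.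
Local Notation G := (Defs.conv L W).
Local Notation n := (chi_sqnorm L).

(** On the modes in [S] other than [ks], [A] inverts [1 - K0 G] exactly, and it is the identity on
    the modes outside [S]. The defect is [K0] times the part of [G] discarded by [conv_finite_rank],
    whose tolerance yields the quarter. *)
Lemma approximate_inverse : exists (A : ('rV[R]_d -> R) -> 'rV[R]_d -> R) (CA : R),
  [/\ 0 < CA, forall u, nice L u -> nice L (A u),
    forall u v, nice L u -> nice L v -> A (fun x => u x + v x) = (fun x => A u x + A v x),
    forall c u, nice L u -> A (fun x => c * u x) = (fun x => c * A u x) &
  [/\ forall u M, nice L u -> bounded_by u M -> bounded_by (A u) (CA * M),
    forall u, nice L u -> mode L (A u) ks = 0,
    A (chi L ks) = (fun=> 0),
    forall u, nice L u -> A u = (fun=> 0) -> mode L u ks = 0 -> u = (fun=> 0) &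
    forall w M, nice L w -> mode L w ks = 0 -> bounded_by w M ->
      bounded_by (fun x => w x - A (fun x => w x - K0 * G w x) x) (M / 4)]].
Proof.
have K0n : K0 != 0.
  have /eqP := (K0ks ks).2 erefl; apply: contraTneq => ->.
  by rewrite mulr0 eq_sym oner_neq0.
have K04 : 0 < (4 * `|K0|)^-1 by rewrite invr_gt0 mulr_gt0// normr_gt0.
have [S [uS ksS HS]] := conv_finite_rank L0 sW WL We ks K04.
have n0 k : n k != 0 by rewrite gt_eqF// chi_sqnorm_gt0.
have lam1 k : k != ks -> 1 - mode L W k * K0 != 0.
  by move=> kks; rewrite subr_eq0 eq_sym; apply: contra_neq kks => /K0ks.
(* [A] multiplies the mode [k] of [S] by [1 + b k n k], which is the inverse of [1 - mode L W k K0],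
   or 0 at [ks]. *)
pose b k := if k == ks then - (n ks)^-1 else mode L W k * K0 / (1 - mode L W k * K0) / n k.
pose A r x := r x + \sum_(k <- S) (b k * mode L r k) * chi L k x.
have nice_S (c : {ffun 'I_d -> nat} -> R) : nice L (fun x => \sum_(k <- S) c k * chi L k x).
  by apply: nice_sum => i; apply: niceZ; exact: nice_chi.
have modeA r k : nice L r -> mode L (A r) k = mode L r k * (1 + (k \in S)%:R * (b k * n k)).
  by move=> nr; rewrite /A modeD// mode_sum//; ring.
pose CA := 1 + \sum_(k <- S) `|b k| * L ^+ d.
have V0 : 0 <= L ^+ d by rewrite exprn_ge0// ltW.
have CA0 : 0 < CA by rewrite ltr_wpDr// sumr_ge0// => k _; rewrite mulr_ge0.
exists A, CA; split=> //.
- by move=> u nu; apply: niceD.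
- move=> u v nu nv; apply/funext => x; rewrite /A -!addrA; congr (_ + _).
  rewrite addrCA; congr (_ + _); rewrite -big_split; apply: eq_bigr => k _ /=.
  by rewrite modeD//; ring.
- move=> c u nu; apply/funext => x; rewrite /A mulrDr; congr (_ + _).
  by rewrite mulr_sumr; apply: eq_bigr => k _; rewrite modeZ//; ring.
split.
- move=> u M nu uM x; have M0 : 0 <= M := le_trans (normr_ge0 _) (uM x).
  rewrite /CA mulrDl mul1r; apply: le_trans (ler_normD _ _) (lerD (uM x) _).
  apply: le_trans (bounded_by_sum _ _ x) _; rewrite mulr_suml; apply: ler_sum => k _.
  by rewrite normrM -mulrA ler_wpM2l// mode_bounded.
- by move=> u nu; rewrite modeA// ksS mul1r /b eqxx mulNr mulVf// subrr mulr0.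
- apply/funext => x; rewrite /A (bigD1_seq ks)//= big1; last first.
    by move=> k kks; rewrite chi_ortho 1?eq_sym// mulr0 mul0r.
  by rewrite /b eqxx -/(n ks) mulNr mulVf// mulN1r addr0 subrr.
- move=> u nu Au u0; have mu0 k : k \in S -> mode L u k = 0.
    move=> kS; have [->//|kks] := eqVneq k ks.
    have := modeA u k nu; rewrite Au kS mul1r /b (negbTE kks) divfK//.
    rewrite (_ : (fun=> 0) = (fun x => 0 * u x)) ?modeZ// ?mul0r; last by apply/funext => x; rewrite mul0r.
    move=> /esym/eqP; rewrite mulf_eq0 => /orP[/eqP//|].
    rewrite (_ : 1 + _ = (1 - mode L W k * K0)^-1); last by field; exact: lam1.
    by rewrite invr_eq0 (negbTE (lam1 _ kks)).
  apply/funext => x; have := congr1 (@^~ x) Au; rewrite /A big_seq big1 ?addr0// => k kS.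
  by rewrite mu0// mulr0 mul0r.
- move=> w M nw w0 wM x.
  have nG := nice_conv L0 sW WL We nw.
  have nr : nice L (fun x => w x - K0 * G w x).
    have := niceD nw (niceZ (- K0) nG); congr nice.
    by apply/funext => y; rewrite mulNr.
  have mr k : mode L (fun x => w x - K0 * G w x) k = (1 - mode L W k * K0) * mode L w k.
    rewrite (_ : (fun x => _) = (fun x => w x + (- K0) * G w x)); last first.
      by apply/funext => y; rewrite mulNr.
    rewrite modeD ?modeZ// ?(mode_conv L0 sW WL We)//; last exact: niceZ.
    by ring.
  rewrite (_ : _ - _ = K0 * (G w x - \sum_(k <- S) mode L W k * (mode L w k / n k) * chi L k x)); last first.
    rewrite /A mulrBr mulr_sumr opprD addrA opprB addrCA subrr addr0; congr (_ - _).
    apply: eq_bigr => k _; rewrite mr /b; have [->|kks] := eqVneq k ks.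
      by rewrite w0; ring.
    by field; rewrite n0 lam1.
  rewrite normrM; have := HS w M nw wM x => /(ler_wpM2l (normr_ge0 K0))/le_trans; apply.
  by rewrite le_eqVlt; apply/orP; left; apply/eqP; field; rewrite normr_eq0.
Qed.

(** [phi] is controlled on [[- Y, Y]] only. Composing with the clipping to it gives a continuous
    function with the same values on [u], hence measurability and, by the extreme value theorem, a
    bound. *)
Lemma nice_comp (phi : R -> R) u Y : nice L u -> bounded_by u Y ->
  (forall e, 0 < e -> exists2 q, 0 < q & forall a b, `|a| <= Y -> `|b| <= Y -> `|b - a| < q ->
     `|phi b - phi a| <= e) -> nice L (fun x => phi (u x)).
Proof.
move=> [mu_ _ uL ue] uY H.
have Y0 : 0 <= Y := le_trans (normr_ge0 _) (uY 0).
pose clip y : R := Num.max (- Y) (Num.min Y y).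
have clipY y : `|clip y| <= Y.
  rewrite /clip ler_norml le_max lexx /= ge_max ge_min lexx /= andbT.
  by rewrite -subr_ge0 opprK addr_ge0.
have clip_id y : `|y| <= Y -> clip y = y.
  by rewrite ler_norml /clip => /andP[h1 h2]; rewrite (min_idPr h2) (max_idPr h1).
have NYY : - Y <= Y by rewrite -subr_ge0 opprK addr_ge0.
have clip1 y y' : `|clip y' - clip y| <= `|y' - y|.
  rewrite /clip; have [h1|h1] := leP Y y; have [h2|h2] := leP Y y'.
  - by rewrite subrr normr0.
  - rewrite (max_idPr NYY); have [h3|h3] := leP (- Y) y'; rewrite !ler0_norm; lra.
  - rewrite (max_idPr NYY); have [h3|h3] := leP (- Y) y; rewrite !ger0_norm; lra.
  - have [h3|h3] := leP (- Y) y'; have [h4|h4] := leP (- Y) y => //.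
    + by rewrite !ger0_norm; lra.
    + by rewrite !ler0_norm; lra.
    + by rewrite subrr normr0.
have cphi : continuous (phi \o clip).
  move=> y; apply/cvgrPdist_le => e e0; have [q q0 Hq] := H e e0.
  exists q => //= y' yy; rewrite distrC; apply: Hq => //; apply: le_lt_trans (clip1 _ _) _.
  by rewrite distrC.
have E : (fun x => phi (u x)) = (fun x => (phi \o clip) (u x)).
  by apply/funext => x /=; rewrite clip_id.
split.
- by rewrite E; apply: measurableT_comp => //; exact: continuous_measurable_fun.
- have cn : {within `[- Y, Y], continuous (fun y => `|(phi \o clip) y|)}.
    by apply: continuous_subspaceT => y; apply: cvg_norm; exact: cphi.
  have [c _ Hc] := EVT_max NYY cn.
  exists `|(phi \o clip) c| => x; rewrite -{1}(clip_id _ (uY x)).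
  by apply: (Hc (u x)); rewrite in_itv /= -ler_norml.
- by move=> i x; rewrite uL.
- by move=> i x; rewrite ue.
Qed.

End approximate_inverse.

Lemma omega_chi (R : realType) (L : R) (d : nat) (k : {ffun 'I_d -> nat}) x :
  omega L k x = Theta k / L `^ (d%:R / 2) * chi L k x.
Proof.
rewrite /omega; congr (_ * _).
by apply: eq_bigr => i _; rewrite /= addr0 -pmulrn.
Qed.

Lemma Theta_gt0 (R : realType) (d : nat) (k : {ffun 'I_d -> nat}) : 0 < Theta k :> R.
Proof.
rewrite /Theta prodr_gt0// => i _; rewrite sqrtr_gt0.
by case: eqP => _ /=; [rewrite subr_gt0 ltr1n|rewrite subr0].
Qed.

Section stationary_states.
Context {R : realType} {L : R} {d : nat} (L0 : 0 < L).
Variables (W : 'rV[R]_d -> R) (Phi : R -> R) (B : R).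
Hypotheses (sW : sq_integrable L W) (WL : Defs.periodic L W) (We : even_coords W).
Hypotheses (Phi_cont : continuous Phi) (B0 : 0 < B) (w0 : W0 L W < 0).
Hypothesis Phi_incr : forall s t, 0 <= s -> s <= t -> Phi s <= Phi t.
Hypothesis Phi_neg : forall s, s <= 0 -> Phi s = 0.
Local Notation mu := (torus_measure L d).
Local Notation w := (W0 L W).
Local Notation act := (mean_act Phi B (L ^+ d)).
Local Notation gain := (mean_gain Phi B (L ^+ d)).

Let V0 : 0 < L ^+ d. Proof. by rewrite exprn_gt0. Qed.

Lemma Gbar_mean_act (a : R) rho x : 0 < a ->
  Gbar L W Phi B rho (2 * a ^+ 2) x = rho x - act a (Defs.conv L W rho x).
Proof.
move=> a0; rewrite /Gbar /mean_act.
have := gauss_mean (Phi (Defs.conv L W rho x + B)) a0.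
set I1 := Rintegral _ _ _; set I0 := Rintegral _ _ _ => H.
rewrite (_ : I1 / (L ^+ d * I0) = (I1 / I0) / L ^+ d); last by rewrite invfM; ring.
by rewrite H invfM; ring.
Qed.

Lemma solution_act (a : R) rho : 0 < a -> L2S L rho ->
  solution L W Phi B rho (2 * a ^+ 2) <-> L2eq L rho (fun x => act a (Defs.conv L W rho x)).
Proof.
move=> a0 Lrho; have k0 : 0 < 2 * a ^+ 2 by rewrite mulr_gt0// exprn_gt0.
split=> [[_ _]|h].
  by apply: filterS => x /= h xT; have := h xT; rewrite Gbar_mean_act// => /eqP; rewrite subr_eq0 => /eqP.
split=> //; apply: filterS h => x /= h xT.
by rewrite Gbar_mean_act// -h// subrr.
Qed.

Lemma solution_cst (a c : R) : 0 < a ->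
  solution L W Phi B (cst c) (2 * a ^+ 2) <-> c = act a (w * c).
Proof.
move=> a0; rewrite solution_act//; last exact: (nice_L2S (nice_cst L c)).
rewrite (_ : (fun x => _) = cst (act a (w * c))); last first.
  by apply/funext => x; rewrite (conv_cst L0 sW WL).
by split=> [/(ae_cst_eq L0)//|h]; rewrite {1}h; apply: nearW.
Qed.

Lemma rho_infE (a : R) : 0 < a ->
  rho_inf L W Phi B (2 * a ^+ 2) = act a (w * rho_inf L W Phi B (2 * a ^+ 2)).
Proof.
move=> a0; apply/solution_cst => //; rewrite /rho_inf; case: xgetP => //= H.
(* A constant solution exists, so the default 0 of [xget] never arises. *)
have [c hc] := @mean_act_fixpoint _ Phi B w (L ^+ d) Phi_cont Phi_incr Phi_neg w0 V0 a a0.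
by exfalso; apply: (H c) => /=; exact/solution_cst.
Qed.

(** Otherwise [Phi] vanishes at the argument and the constant is explicitly [mills 0 / (L ^ d a)];
    [B <= |w| c] with [mills 0 ^ 2 = 1 / pi] contradicts the bound on [kappa]. *)
Lemma threshold (a : R) : 0 < a -> 2 * `|w| ^+ 2 / (L ^+ (2 * d) * pi * B ^+ 2) < 2 * a ^+ 2 ->
  0 < w * rho_inf L W Phi B (2 * a ^+ 2) + B.
Proof.
move=> a0 ka; rewrite ltNge; apply/negP => vB.
have := rho_infE a0; set c := rho_inf _ _ _ _ _ in vB *.
rewrite /mean_act Phi_neg// mulr0 /gmean add0r => cE.
have m0 := mills_gt0 (0 : R).
have c0 : 0 < c by rewrite cE; exact: divr_gt0 m0 (mulr_gt0 V0 a0).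
have wc : B <= `|w| * c by rewrite ltr0_norm// mulNr; move: vB; lra.
have : B ^+ 2 <= (`|w| * c) ^+ 2 by rewrite lerXn2r// ?nnegrE ?(ltW B0)// mulr_ge0// ltW.
rewrite cE exprMn expr_div_n mills0 => H.
have P0 := @pi_gt0 R.
move: ka; rewrite ltr_pdivrMr; last by rewrite !mulr_gt0// ?exprn_gt0.
apply/negP; rewrite -leNgt.
have e1 : `|w| ^+ 2 * (pi^-1 / (L ^+ d * a) ^+ 2) * (pi * (L ^+ d * a) ^+ 2) = `|w| ^+ 2.
  rewrite -mulrA (_ : pi^-1 / _ * _ = 1) ?mulr1//.
  by move: (L ^+ d) V0 (pi : R) P0 => V V0' p p0; field; rewrite gt_eqF ?gt_eqF.
have : B ^+ 2 * (pi * (L ^+ d * a) ^+ 2) <= `|w| ^+ 2.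
  by rewrite -[leRHS]e1 ler_pM2r// mulr_gt0// exprn_gt0// mulr_gt0.
rewrite (_ : L ^+ (2 * d) = (L ^+ d) ^+ 2); last by rewrite mulnC exprM.
move: (L ^+ d) (pi : R) => V p; move: (`|w| ^+ 2) => W2; lra.
Qed.

(** For [rho_inf = gmean q / (L ^ d a)] and [kappa = 2 a ^ 2] the bracket is
    [(1 - 2 mills q gmean q) / L ^ d], that is [gvar q / L ^ d]. *)
Lemma bif_denominatorE (a : R) : 0 < a ->
  bif_denominator L W Phi B (2 * a ^+ 2) = L `^ (d%:R / 2) * gain a (w * rho_inf L W Phi B (2 * a ^+ 2)).
Proof.
move=> a0; rewrite /bif_denominator /Phi0; have := rho_infE a0; set c := rho_inf _ _ _ _ _.
rewrite /mean_gain /mean_act; set v := w * c + B => cE.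
have -> : derive1n 0 Phi v = Phi v by [].
move: (derive1n 1 Phi v) => P1.
have Vn : L ^+ d != 0 by rewrite expf_neq0// gt_eqF.
rewrite cE /gvar /gmean; move: (mills (a * Phi v)) (Phi v) (L ^+ d) Vn (L `^ _) => m p V Vn P.
by field; rewrite Vn gt_eqF.
Qed.

(** [Theta] cancels, so the hypothesis on [kstar] becomes a condition on the eigenvalues
    [mode L W k] of the convolution. *)
Lemma cos_coef_mode k : cos_coef L W k / Theta k = mode L W k / L `^ (d%:R / 2).
Proof.
have T0 : Theta k != 0 :> R by rewrite gt_eqF// Theta_gt0.
have P0 : L `^ (d%:R / 2) != 0 by rewrite gt_eqF// powR_gt0.
rewrite /cos_coef (@eq_Rintegral _ _ _ _ _ (fun x => Theta k / L `^ (d%:R / 2) * (W x * chi L k x))).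
  rewrite RintegralZl//; last exact: sq_integrableM sW (chi_sq_integrable L k).
  by rewrite -/(mode L W k); field; rewrite T0 P0.
by move=> x _; rewrite omega_chi mulrCA.
Qed.

End stationary_states.

(** * Regularity of curves of functions *)

Section curves.
Context {R : realType}.
Implicit Types (e q z s delta : R).

(** Taking [T = unit] covers scalar curves as well. *)
Definition unif_C1 (T : Type) delta (f f' : R -> T -> R) :=
  forall e, 0 < e -> exists2 q : R, 0 < q & forall z z', `|z| < delta -> `|z'| < delta -> `|z' - z| < q ->
    bounded_by (fun t => f z' t - f z t - (z' - z) * f' z t) (e * `|z' - z|) /\
    bounded_by (fun t => f' z' t - f' z t) e.

Lemma near_interval delta z : `|z| < delta -> \forall y \near z, `|y| < delta.
Proof.
move=> zd; exists (delta - `|z|); first by rewrite /= subr_gt0.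
move=> y /= h; rewrite -[y](subrK z); apply: le_lt_trans (ler_normD _ _) _.
by rewrite -ltrBrDr distrC.
Qed.

Lemma unif_C1_derive (f f' : R -> R) delta : unif_C1 delta (fun z (_ : unit) => f z) (fun z _ => f' z) ->
  forall z, `|z| < delta -> is_derive z 1 f (f' z) /\ {for z, continuous f'}.
Proof.
move=> H z zd; split.
  have cv : (fun h => h^-1 *: (f (h *: 1 + z) - f z)) @ 0^' --> f' z.
    apply/cvgrPdist_le => e e0; have [q q0 Hq] := H e e0.
    have [r /= r0 Hr] := near_interval zd.
    near=> h.
    have h0 : h != 0 by near: h; exact: nbhs_dnbhs_neq.
    have hq : `|h| < Num.min q r.
      near: h; apply: nbhs_dnbhs; exists (Num.min q r); first by rewrite /= lt_min q0.
      by move=> y /=; rewrite sub0r normrN.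
    move: hq; rewrite lt_min => /andP[hq hr].
    have zh : `|h + z| < delta by apply: Hr; rewrite /= opprD addrCA subrr addr0 normrN.
    have [|/(_ tt) h1 _] := Hq z (h + z) zd zh; first by rewrite addrK.
    rewrite addrK in h1; rewrite -[h *: 1]/(h * 1) mulr1 -[h^-1 *: _]/(h^-1 * _).
    rewrite (_ : f' z - _ = - (h^-1 * (f (h + z) - f z - h * f' z))); last by field.
    by rewrite normrN normrM normfV mulrC ler_pdivrMr ?normr_gt0.
  by apply: DeriveDef; [exact: cvgP cv|exact: cvg_lim cv].
apply/cvgrPdist_le => e e0; have [q q0 Hq] := H e e0.
near=> y; rewrite distrC; have [||_ /(_ tt)//] := Hq z y zd; last first.
  by near: y; exists q => // y /=; rewrite distrC.
by near: y; exact: near_interval.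
Unshelve. all: by end_near. Qed.

Lemma unif_C1_scale (T : Type) delta th (f f' : R -> T -> R) : 0 < th -> unif_C1 delta f f' ->
  unif_C1 (delta / th) (fun z => f (th * z)) (fun z t => th * f' (th * z) t).
Proof.
move=> th0 H e e0; have [q q0 Hq] := H (e / th) (divr_gt0 e0 th0).
have sc z : `|th * z| = `|z| * th by rewrite normrM gtr0_norm// mulrC.
exists (q / th); first exact: divr_gt0.
move=> z z'; rewrite !ltr_pdivlMr// -!sc => zd zd' dz.
have [|h1 h2] := Hq (th * z) (th * z') zd zd'; first by rewrite -mulrBr.
have th1 : e / th * (`|z' - z| * th) = e * `|z' - z| by field; rewrite gt_eqF.
split=> t.
  have := h1 t; rewrite -mulrBr sc th1 => /(le_trans _); apply.
  by rewrite le_eqVlt; apply/orP; left; apply/eqP; congr `| _ |; ring.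
by rewrite -mulrBr mulrC normrM (gtr0_norm th0) -ler_pdivlMr//; exact: h2.
Qed.

Lemma curve_C1 (T : Type) (delta r0 C : R) (g dg S S' : R -> R) (V V' : R -> T -> R) :
  C1on [set s | `|s| <= r0] g dg -> 0 < delta -> 0 <= C ->
  (forall z, `|z| < delta -> `|S z| <= r0 /\ `|S' z| <= C) ->
  (forall z, `|z| < delta -> bounded_by (V' z) C) ->
  unif_C1 delta (fun z (_ : unit) => S z) (fun z _ => S' z) -> unif_C1 delta V V' ->
  unif_C1 delta (fun z t => g (S z) + z * V z t) (fun z t => dg (S z) * S' z + (V z t + z * V' z t)).
Proof.
move=> [[N N0 gN] Hg] delta0 C0 SC VC HS HV e e0.
pose K := 2 + 3 * C + N + delta.
have K0 : 0 < K by rewrite /K; lra.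
pose e1 := Num.min 1 (e / K).
have e10 : 0 < e1 by rewrite lt_min ltr01 divr_gt0.
have e11 : e1 <= 1 := minr_lel _ _.
have e1K : e1 * K <= e by rewrite -ler_pdivlMr//; exact: minr_ler.
clearbody e1; rewrite /K in e1K.
have [q1 q10 H1] := Hg _ e10; have [q2 q20 H2] := HS _ e10; have [q3 q30 H3] := HV _ e10.
pose q := Num.min (Num.min q2 q3) (Num.min e1 (q1 / (2 * (1 + C)))).
have c1 : 0 < 2 * (1 + C) by lra.
exists q; first by rewrite !lt_min q20 q30 e10 divr_gt0.
move=> z z' zd zd' dz.
have d2 := lt_le_trans dz (le_trans (minr_lel _ _) (minr_lel _ _)).
have d3 := lt_le_trans dz (le_trans (minr_lel _ _) (minr_ler _ _)).
have de := lt_le_trans dz (le_trans (minr_ler _ _) (minr_lel _ _)).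
have dq := lt_le_trans dz (le_trans (minr_ler _ _) (minr_ler _ _)).
have [/(_ tt) a1 /(_ tt) a2] := H2 z z' zd zd' d2; have [b1 b2] := H3 z z' zd zd' d3.
have [Sr SCz] := SC z zd; have [Sr' SCz'] := SC z' zd'.
rewrite ltr_pdivlMr// in dq.
move: a1 b1 de dq; set D := `|z' - z| => a1 b1 de dq.
have D0 : 0 <= D by exact: normr_ge0.
have lip (x x' y c : R) : `|x' - x - (z' - z) * y| <= e1 * D -> `|y| <= c -> `|x' - x| <= e1 * D + c * D.
  move=> h1 h2; rewrite -[x' - x](subrK ((z' - z) * y)); apply: le_trans (ler_normD _ _) (lerD h1 _).
  by rewrite normrM -/D mulrC ler_wpM2r.
have SS := lip _ _ _ _ a1 SCz.
have e1D : e1 * D <= D by rewrite ler_piMl.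
have [|c2 c3] := H1 (S z) (S z') Sr Sr'.
  apply: le_lt_trans SS _; move: dq; have : 0 <= C * D by rewrite mulr_ge0.
  move: e1D D0; clear; lra.
have [gz dgz] := gN _ Sr; have [gz' dgz'] := gN _ Sr'.
split=> t.
  have VC1 := VC z zd t.
  rewrite (_ : _ - _ - _ = (g (S z') - g (S z) - dg (S z) * (S z' - S z)) +
     dg (S z) * (S z' - S z - (z' - z) * S' z) + z' * (V z' t - V z t - (z' - z) * V' z t) +
     (z' - z) * ((z' - z) * V' z t)); last by ring.
  apply: le_trans (ler_normD _ _) _.
  apply: le_trans (lerD (ler_normD _ _) (lexx _)) _.
  apply: le_trans (lerD (lerD (ler_normD _ _) (lexx _)) (lexx _)) _.
  rewrite !normrM -/D.
  have t1 : e1 * `|S z' - S z| <= e1 * (e1 * D + C * D) by rewrite ler_pM2l.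
  have t2 := ler_pM (normr_ge0 _) (normr_ge0 _) dgz a1.
  have t3 := ler_pM (normr_ge0 _) (normr_ge0 _) (ltW zd') (b1 t).
  have t4 : D * (D * `|V' z t|) <= D * (e1 * C) by rewrite ler_wpM2l// ler_pM// ltW.
  apply: le_trans (lerD (lerD (lerD (le_trans c2 t1) t2) t3) t4) _.
  apply: le_trans (_ : e1 * (2 + 3 * C + N + delta) * D <= _); last by rewrite ler_wpM2r.
  have : e1 * (e1 * D) <= e1 * D by rewrite ler_pM2l.
  have : 0 <= e1 * C * D by rewrite mulr_ge0// mulr_ge0// ltW.
  have : 0 <= e1 * D by rewrite mulr_ge0// ltW.
  clear; lra.
have VV := lip _ _ _ _ (b1 t) (VC z zd t).
rewrite (_ : _ - _ = (dg (S z') - dg (S z)) * S' z' + dg (S z) * (S' z' - S' z) + (V z' t - V z t) +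
  (z' * (V' z' t - V' z t) + (z' - z) * V' z t)); last by ring.
apply: le_trans (ler_normD _ _) _.
apply: le_trans (lerD (ler_normD _ _) (ler_normD _ _)) _.
apply: le_trans (lerD (lerD (ler_normD _ _) (lexx _)) (lexx _)) _.
rewrite !normrM -/D.
have t1 := ler_pM (normr_ge0 _) (normr_ge0 _) c3 SCz'.
have t2 := ler_pM (normr_ge0 _) (normr_ge0 _) dgz a2.
have t3 := ler_pM (normr_ge0 _) (normr_ge0 _) (ltW zd') (b2 t).
have t4 := ler_pM (normr_ge0 _) (normr_ge0 _) (ltW de) (VC z zd t).
apply: le_trans (lerD (lerD (lerD t1 t2) VV) (lerD t3 t4)) _.
apply: le_trans e1K.
have : C * D <= C * e1 by rewrite ler_wpM2l// ltW.
have : 0 <= e1 * C by rewrite mulr_ge0// ltW.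
move: de e1D; move: D0; clear; lra.
Qed.

(** The L^2 norm is at most [sqrt (L ^ d)] times a uniform bound. *)
Lemma L2S_C1_sup (L : R) (L0 : 0 < L) (d : nat) delta (rho drho : R -> 'rV[R]_d -> R) :
  (forall z, `|z| < delta -> nice L (rho z) /\ nice L (drho z)) -> unif_C1 delta rho drho ->
  L2S_C1_on L delta rho drho.
Proof.
move=> nr H z zd; have [n1 n2] := nr z zd.
have v0 : 0 < Num.sqrt (L ^+ d) by rewrite sqrtr_gt0 exprn_gt0.
have bound e (u : 'rV[R]_d -> R) : bounded_by u e -> nice L u -> L2norm L u <= e * Num.sqrt (L ^+ d).
  by move=> ub [mu_ _ _ _]; exact: L2norm_bounded.
have nB (u v : 'rV[R]_d -> R) : nice L u -> nice L v -> nice L (fun x => u x - v x).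
  move=> nu nv; have := niceD nu (niceZ (-1) nv); congr nice.
  by apply/funext => x; rewrite mulN1r.
split; [exact: nice_L2S|exact: nice_L2S| |].
  apply/eqoP => e e0; have [q q0 Hq] := H _ (divr_gt0 e0 v0).
  have [r /= r0 Hr] := near_interval zd.
  near=> h.
  have hq : `|h| < Num.min q r.
    near: h; exists (Num.min q r); first by rewrite /= lt_min q0.
    by move=> y /=; rewrite sub0r normrN.
  move: hq; rewrite lt_min => /andP[hq hr].
  have zh : `|z + h| < delta by apply: Hr; rewrite /= opprD addNKr normrN.
  have [|h1 _] := Hq z (z + h) zd zh; first by rewrite addrAC subrr add0r.
  rewrite addrAC subrr add0r in h1.
  have [n3 _] := nr _ zh.
  rewrite ger0_norm ?L2norm_ge0//.
  apply: le_trans (bound _ _ h1 _) _; first by apply: (nB) (niceZ _ n2); exact: nB.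
  by rewrite mulrAC divfK// gt_eqF.
apply/cvgrPdist_le => e e0; have [q q0 Hq] := H _ (divr_gt0 e0 v0).
near=> y.
have yd : `|y| < delta by near: y; exact: near_interval.
have yz : `|y - z| < q by near: y; exists q => // y /=; rewrite distrC.
have [_ h2] := Hq z y zd yd yz; have [_ n3] := nr y yd.
rewrite sub0r normrN ger0_norm ?L2norm_ge0//.
by apply: le_trans (bound _ _ h2 _) _; [exact: nB|rewrite divfK// gt_eqF].
Unshelve. all: by end_near. Qed.

End curves.

(** * All solutions near the bifurcation point *)

Section local_branch.
Context {R : realType} {L : R} {d : nat} (L0 : 0 < L).
Implicit Types (s z e M : R) (u v : 'rV[R]_d -> R).
Variables (W : 'rV[R]_d -> R) (Phi : R -> R) (B : R) (kstar : {ffun 'I_d -> nat}).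
Hypotheses (sW : sq_integrable L W) (WL : Defs.periodic L W) (We : even_coords W).
Hypotheses (Phi_C3 : C3_off0 Phi) (w0 : W0 L W < 0).
Hypothesis Phi_incr : forall s t, 0 <= s -> s <= t -> Phi s <= Phi t.
Hypothesis Phi_neg : forall s, s <= 0 -> Phi s = 0.
Local Notation mu := (torus_measure L d).
Local Notation w := (W0 L W).
Local Notation act := (mean_act Phi B (L ^+ d)).
Local Notation gain := (mean_gain Phi B (L ^+ d)).
Local Notation G := (Defs.conv L W).
Local Notation om := (chi L kstar).
Local Notation l := (fun u => mode L u kstar / chi_sqnorm L kstar).
Variables (cc : R -> R) (a0 : R).
Hypotheses (ccE : forall a, 0 < a -> cc a = act a (w * cc a)) (a0_gt0 : 0 < a0).
Hypothesis vB : 0 < w * cc a0 + B.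
Hypothesis gain_kstar : forall k, mode L W k * gain a0 (w * cc a0) = 1 <-> k = kstar.
Hypothesis Phi2_ge0 : 0 <= derive1n 2 Phi (w * cc a0 + B).

(** The last clause asks for smallness of [W * v] and not of [v], because this is what L^2 nearness
    controls uniformly. *)
Lemma local_branch :
  exists (r0 eta delta C : R) (dC S S' : R -> R) (V V' : R -> 'rV[R]_d -> R),
  [/\ 0 < r0 < a0 /\ 0 < eta <= r0, 0 < delta, 0 <= C, V 0 = om /\ S 0 = 0 &
  [/\ C1on [set s | `|s| <= r0] (fun s => cc (a0 + s)) dC,
    forall z, `|z| < delta -> [/\ nice L (V z), l (V z) = 1, `|S z| <= eta &
      forall x, cc (a0 + S z) + z * V z x = act (a0 + S z) (w * cc (a0 + S z) + z * G (V z) x)],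
    forall z, `|z| < delta -> [/\ nice L (V' z), l (V' z) = 0, bounded_by (V' z) C & `|S' z| <= C],
    unif_C1 delta V V' /\ unif_C1 delta (fun z (_ : unit) => S z) (fun z _ => S' z) &
    exists2 e0, 0 < e0 & forall s v, `|s| <= e0 -> nice L v -> bounded_by (G v) e0 ->
      (forall x, cc (a0 + s) + v x = act (a0 + s) (w * cc (a0 + s) + G v x)) ->
      v = (fun=> 0) \/ exists z, [/\ `|z| < delta, s = S z & v = (fun x => z * V z x)]]].
Proof.
have V0 : 0 < L ^+ d by rewrite exprn_gt0.
pose K0 := gain a0 (w * cc a0).
pose lam := mode L W kstar.
have lamK0 : lam * K0 = 1 by exact/gain_kstar.
have K0n : K0 != 0 by apply: contra_eq_neq lamK0 => ->; rewrite mulr0 eq_sym oner_neq0.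
have [A [CA [CA0 DA AD AZ [Ab lA' Aom A_inj' A_inv']]]] := approximate_inverse L0 sW WL We gain_kstar.
pose CG := \int[mu]_x `|W x| + 1.
have CG0 : 0 < CG by rewrite ltr_wpDl// Rintegral_ge0.
pose n := chi_sqnorm L kstar.
have n0 : 0 < n by exact: chi_sqnorm_gt0.
have nn : n != 0 by rewrite gt_eqF.
(* The 1 gives the strict bound of the abstract theorem and [1 <= Y], so that [y = 1] is admissible
   in [P]. *)
pose Y := CG + `|lam| + 1.
have Y1 : 1 <= Y by rewrite lerDr addr_ge0// ltW.
have Y0 : CG + `|lam| < Y by rewrite ltrDl.
have [r0 [K1 [CP [dC [P [Ps [Pz [Py [r0b K10 CP0 C1c [P_C1 P_b [P00 Ps00 Py00] PE]]]]]]]]]] :=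
  mean_act_increments Phi_C3 Phi_incr Phi_neg w0 V0 ccE a0_gt0 vB Y1 K0n Phi2_ge0.
have /andP[r00 r0a] := r0b.
have GD u v : nice L u -> nice L v -> G (fun x => u x + v x) = (fun x => G u x + G v x).
  by move=> nu nv; apply/funext => x; exact: convD.
have GZ c u : nice L u -> G (fun x => c * u x) = (fun x => c * G u x).
  by move=> nu; apply/funext => x; exact: convZ.
have Gb u M : nice L u -> bounded_by u M -> bounded_by (G u) (CG * M).
  move=> [mu_ _ _ _] uM x; have M0 : 0 <= M := le_trans (normr_ge0 _) (uM 0).
  apply: le_trans (conv_bounded L0 sW WL mu_ uM x) _.
  by rewrite ler_wpM2r// lerDl.
have Gom : G om = (fun x => lam * om x) by apply/funext => x; exact: conv_chi.
have lD u v : nice L u -> nice L v -> l (fun x => u x + v x) = l u + l v.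
  by move=> nu nv; rewrite /= modeD// mulrDl.
have lZ c u : nice L u -> l (fun x => c * u x) = c * l u.
  by move=> nu; rewrite /= modeZ// mulrA.
have lb u M : nice L u -> bounded_by u M -> `|l u| <= L ^+ d / n * M.
  move=> nu uM; rewrite normrM normfV (gtr0_norm n0) mulrAC ler_pM2r ?invr_gt0//.
  exact: mode_bounded.
have Cl0 : 0 < L ^+ d / n by rewrite divr_gt0.
have lom : l om = 1 by rewrite /= divff.
have lG u : nice L u -> l (G u) = lam * l u by move=> nu; rewrite /= mode_conv// mulrA.
have lA u : nice L u -> l (A u) = 0 by move=> nu; rewrite /= lA'// mul0r.
have l0 u : l u = 0 -> mode L u kstar = 0.
  by move=> /eqP; rewrite mulf_eq0 invr_eq0 (negbTE nn) orbF => /eqP.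
have A_inj u : nice L u -> A u = (fun=> 0) -> l u = 0 -> u = (fun=> 0).
  by move=> nu Au /l0; exact: A_inj'.
have A_inv u M : nice L u -> l u = 0 -> bounded_by u M ->
    bounded_by (fun x => u x - A (fun x => u x - K0 * G u x) x) (M / 4).
  by move=> nu /l0; exact: A_inv'.
have nom : nice L om by exact: nice_chi.
have omb : bounded_by om 1 by exact: chi_bounded.
have nG u : nice L u -> nice L (G u) by exact: nice_conv.
have K1n : K1 != 0 by rewrite gt_eqF.
have niceDl u v : nice L u -> nice L v -> nice L (fun x => u x + v x) by exact: niceD.
have niceZl c u : nice L u -> nice L (fun x => c * u x) by exact: niceZ.
have niceMl u v : nice L u -> nice L v -> nice L (fun x => u x * v x) by exact: niceM.
have [delta [eta [V [V' [S [S' [C [/andP[delta0 deltar] etab VS0 VP [Vuniq V'P VC1 SC1]]]]]]]]] :=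
  simple_eigenvalue_branch (nice_cst L 0) niceDl niceZl niceMl (@nice_closed R L d)
    (fun phi u nu uY H => nice_comp nu uY H) nG GD GZ Gb DA AD AZ Ab lD lZ lb CG0 CA0 Cl0 nom omb lom Gom lG lamK0
    K1n lA Aom A_inj A_inv Y0 r00 P_C1 CP0 P_b P00 Ps00 Py00.
have /andP[eta0 etar] := etab.
have d00 : `|0 : R| < delta by rewrite normr0.
have C0 : 0 <= C by have [_ _ _ h] := V'P 0 d00; exact: le_trans h.
exists r0, eta, delta, C, dC, S, S', V, V'; split=> //; split=> //.
- move=> z zd; have [nV lV Sz _ [GY VE]] := VP z zd; split=> // x.
  have := PE (S z) z (G (V z) x) (le_trans Sz etar) (ltW (lt_le_trans zd deltar)) (GY x).
  by rewrite -VE => ->; rewrite addrC subrK.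
- split=> // e /SC1[q q0 Hq]; exists q => // z z' zd zd' dz; have [h1 h2] := Hq z z' zd zd' dz.
  by split=> _.
pose eta' := Num.min eta 1.
have eta'0 : 0 < eta' by rewrite lt_min eta0 ltr01.
have [e1 e10 cone] := kernel_cone niceDl niceZl nG GD GZ Gb Ab lD lZ CG0 CA0 nom omb lom Gom lamK0 A_inv eta'0.
have [q q0 Hq] := P_C1 1 ltr01.
pose Cl := L ^+ d / n.
(* In order: uniqueness ball, modulus of [P], tolerance [e1] of the cone, and [|l v| < delta]. *)
pose e0 := Num.min (Num.min eta (q / 2)) (Num.min (e1 / (2 * (1 + CP))) (delta / (2 * (Cl * CP + 1)))).
have CP1 : 0 < 2 * (1 + CP) by rewrite mulr_gt0// ltr_wpDr.
have ClCP : 0 <= Cl * CP by rewrite mulr_ge0// ltW.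
have ClP1 : 0 < 2 * (Cl * CP + 1) by rewrite mulr_gt0// ltr_wpDl.
have e00 : 0 < e0 by rewrite !lt_min eta0 !divr_gt0.
have e0eta : e0 <= eta := le_trans (minr_lel _ _) (minr_lel _ _).
have e0q : e0 <= q / 2 := le_trans (minr_lel _ _) (minr_ler _ _).
have e0e1 : e0 * (2 * (1 + CP)) <= e1.
  by rewrite -ler_pdivlMr//; exact: le_trans (minr_ler _ _) (minr_lel _ _).
have e0delta : e0 * (2 * (Cl * CP + 1)) <= delta.
  by rewrite -ler_pdivlMr//; exact: le_trans (minr_ler _ _) (minr_ler _ _).
clearbody e0; exists e0 => // s v sb nv Gvb vE.
have e0r : e0 <= r0 by exact: le_trans etar.
have sr : `|s| <= r0 by exact: le_trans e0r.
have Gr x : `|G v x| <= r0 by exact: le_trans e0r.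
(* The increment formula at each point with [z = G v x] and [y = 1]: [P] is the difference quotient
   of the activation there, close to [K0]. *)
have vP x : v x = G v x * P s (G v x) 1.
  rewrite PE ?normr1// mulr1 -vE.
  by rewrite addrAC subrr add0r.
have box0 : [/\ `|0 : R| <= r0, `|0 : R| <= r0 & `|1 : R| <= Y].
  by rewrite normr0 normr1; split=> //; exact: ltW.
have boxx x : [/\ `|s| <= r0, `|G v x| <= r0 & `|1 : R| <= Y] by rewrite normr1.
have e0q' : e0 < q by apply: le_lt_trans e0q _; rewrite ltr_pdivrMr// ltr_pMr// ltr1n.
have vK x : `|v x - K0 * G v x| <= e1 * `|G v x|.
  rewrite vP mulrC -mulrBl normrM ler_wpM2r//.
  have [|||h _ _ _] := Hq _ _ _ _ _ _ box0 (boxx x).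
  - by rewrite subr0; exact: le_lt_trans e0q'.
  - by rewrite subr0; exact: le_lt_trans e0q'.
  - by rewrite subrr normr0.
  rewrite subrr normr0 mulr0 !subr0 addr0 mul1r P00 mulr1 -/K0 in h.
  have [_ p1 p2 _] := P_b 0 0 1 box0.
  have {}sb := sb; have gb := Gvb x.
  rewrite -[P s _ _ - K0](subrK (Ps 0 0 1 * s + Pz 0 0 1 * G v x)).
  apply: le_trans (ler_normD _ _) _.
  rewrite opprD addrA; apply: le_trans (lerD h (ler_normD _ _)) _; rewrite !normrM.
  have t1 := ler_pM (normr_ge0 _) (normr_ge0 _) p1 sb.
  have t2 := ler_pM (normr_ge0 _) (normr_ge0 _) p2 gb.
  apply: le_trans (lerD (lerD sb gb) (lerD t1 t2)) _.
  by apply: le_trans e0e1; rewrite le_eqVlt; apply/orP; left; apply/eqP; ring.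
have vb : bounded_by v (e0 * CP).
  move=> x; rewrite vP normrM; have [p _ _ _] := P_b s (G v x) 1 (boxx x).
  by apply: ler_pM.
have vcone := cone v nv (ex_intro _ _ vb) vK.
(* If [l v = 0] the cone forces [v = 0]. Otherwise [v] divided by [z = l v] is normalised and close
   to [om], so uniqueness on the branch applies. *)
have [lv0|lvn] := eqVneq (l v) 0.
  left; apply/funext => x; have := vcone x.
  by rewrite lv0 normr0 mulr0 mul0r subr0 normr_le0 => /eqP.
right; exists (l v).
have lvd : `|l v| < delta.
  apply: le_lt_trans (lb _ _ nv vb) _; rewrite -/Cl.
  apply: lt_le_trans e0delta; rewrite mulrCA ltr_pM2l// mulrDr mulr1.
  by rewrite mulr2n mulrDl mul1r -addrA ltrDl ltr_wpDl.
pose u x := (l v)^-1 * v x.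
have nu : nice L u by exact: niceZl.
have lu : l u = 1 by rewrite lZ// mulVf.
have vu : v = (fun x => l v * u x) by apply/funext => x; rewrite /u mulrA divff// mul1r.
have ub : bounded_by (fun x => u x - om x) eta'.
  move=> x; have := vcone x; rewrite {1}vu -mulrBr normrM mulrC.
  by rewrite ler_pM2r// normr_gt0.
have Gu x : `|G u x| <= Y.
  have nuo : nice L (fun x => u x + (-1) * om x) by apply: niceDl => //; exact: niceZl.
  have hb : bounded_by (fun x => u x + (-1) * om x) 1.
    by move=> y; rewrite mulN1r; apply: le_trans (ub y) _; exact: minr_ler.
  have := Gb _ _ nuo hb x; rewrite (GD _ _ nu (niceZl (-1) _ nom)) (GZ (-1) _ nom) Gom.
  rewrite mulr1 mulN1r => h; rewrite -[G u x](subrK (lam * om x)).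
  apply: le_trans (ler_normD _ _) (le_trans (lerD h _) (ltW Y0)).
  by rewrite normrM ler_piMr.
have [|||uV sS] := Vuniq (l v) s u lvd nu lu.
- exact: le_trans e0eta.
- by move=> x; apply: le_trans (ub x) _; exact: minr_lel.
- move=> x; apply: (mulfI lvn); rewrite PE//; last exact: ltW (lt_le_trans lvd deltar).
  have GvE : l v * G u x = G v x.
    by have := congr1 (fun f => G f x) vu; rewrite /= (GZ _ _ nu).
  rewrite GvE -vE addrAC subrr add0r.
  by rewrite [in RHS]vu.
by split=> //; rewrite {1}vu uV.
Qed.

End local_branch.

Theorem theorem2p2 (R : realType) (d : nat) (L B kappas : R)
    (W : 'rV[R]_d -> R) (Phi : R -> R) (kstar : {ffun 'I_d -> nat})
    (hd : (1 <= d)%N) (hL : 0 < L)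
    (hW : exists m : nat, (d < 2 * m)%N /\ SobolevS L m W)
    (hPhi_cont : continuous Phi)
    (hPhi_C3 : C3_off0 Phi)
    (hPhi_incr : forall s t, 0 <= s -> s <= t -> Phi s <= Phi t)
    (hPhi_neg : forall s, s <= 0 -> Phi s = 0)
    (hB : 0 < B)
    (hW0 : W0 L W < 0)
    (hkappas : 2 * `|W0 L W| ^+ 2 / (L ^+ (2 * d) * pi * B ^+ 2) < kappas)
    (hden : bif_denominator L W Phi B kappas != 0)
    (hkstar : forall k : {ffun 'I_d -> nat},
       cos_coef L W k / Theta k = 1 / bif_denominator L W Phi B kappas
       <-> k = kstar)
    (hPhi2 : 0 <= Phi0 L W Phi B 2 kappas) :
  bifurcation_point L W Phi B (cst (rho_inf L W Phi B kappas)) kappas /\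
  exists (r eps delta : R) (rho : R -> 'rV[R]_d -> R) (kappa : R -> R),
    [/\ 0 < r, 0 < eps < kappas,
        nontrivial_branch L W Phi B
          (cst (rho_inf L W Phi B kappas)) kappas delta rho kappa,
        forall (u : 'rV[R]_d -> R) (k : R),
          solution L W Phi B u k ->
          L2norm L (u \- cst (rho_inf L W Phi B kappas)) < r ->
          `|k - kappas| < eps ->
          homogeneous L W Phi B u k \/
          exists z, [/\ `|z| < delta, L2eq L u (rho z) & k = kappa z] &
        (fun z => L2norm L
           (rho z \- cst (rho_inf L W Phi B (kappa z)) \- z \*: omega L kstar))
          =o_ (0 : R) (fun z => z)].
Proof.
have [m [_ [[[WL /sq_integrable_Lfun sW] _] [_ We]]]] := hW.
have V0 : 0 < L ^+ d by rewrite exprn_gt0.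
have k0 : 0 < kappas.
  apply: le_lt_trans hkappas; rewrite divr_ge0 ?mulr_ge0 ?exprn_ge0 ?pi_ge0//; exact: ltW.
(* With [kappa = 2 a ^ 2] the exponent is [- (a (s - p)) ^ 2], as in [gauss_fun]. *)
pose a0 := Num.sqrt (kappas / 2).
have a00 : 0 < a0 by rewrite sqrtr_gt0 divr_gt0.
have kE : kappas = 2 * a0 ^+ 2 by rewrite sqr_sqrtr ?divr_ge0 ?(ltW k0)// mulrC divfK.
clearbody a0; subst kappas.
pose w := W0 L W.
pose cc a := rho_inf L W Phi B (2 * a ^+ 2).
have ccE a : 0 < a -> cc a = mean_act Phi B (L ^+ d) a (w * cc a).
  exact: (rho_infE hL B sW WL hPhi_cont hW0 hPhi_incr hPhi_neg).
have vB : 0 < w * cc a0 + B := threshold hL sW WL hPhi_cont hB hW0 hPhi_incr hPhi_neg a00 hkappas.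
have gain_kstar k : mode L W k * mean_gain Phi B (L ^+ d) a0 (w * cc a0) = 1 <-> k = kstar.
  move: hden; have := hkstar k; rewrite (cos_coef_mode hL sW).
  rewrite (bif_denominatorE hL B sW WL hPhi_cont hW0 hPhi_incr hPhi_neg a00) -/w -/(cc a0).
  have : L `^ (d%:R / 2) != 0 by rewrite gt_eqF// powR_gt0.
  move: (L `^ _) (mean_gain _ _ _ _ _) => p g p0 <-.
  rewrite mulf_eq0 negb_or => /andP[_ g0]; split=> h.
    rewrite (_ : mode L W k = g^-1); last by rewrite -[LHS](mulfK g0) h div1r.
    by field; rewrite p0 g0.
  rewrite -[mode L W k](divfK p0) h; field; by rewrite p0 g0.
have [r0 [eta [delta [C [dC [S [S' [V [V' [[/andP[r00 r0a] /andP[eta0 etar]] delta0 C0 [V0E S0E]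
  [C1c VP V'P [VC1 SC1] [e0 e00 uniq]]]]]]]]]]]] :=
  local_branch hL sW WL We hPhi_C3 hW0 hPhi_incr hPhi_neg ccE a00 vB gain_kstar hPhi2.
(* [omega] is [th] times [chi]; replacing [z] by [th z] gives the first-order term [z omega]. *)
pose th : R := Theta kstar / L `^ (d%:R / 2).
have th0 : 0 < th by rewrite divr_gt0 ?Theta_gt0// powR_gt0.
pose delta' := delta / th.
have delta'0 : 0 < delta' by rewrite divr_gt0.
have thd (z : R) : `|z| < delta' -> `|th * z| < delta.
  by rewrite ltr_pdivlMr// normrM (gtr0_norm th0) mulrC.
pose rho z (x : 'rV[R]_d) := cc (a0 + S (th * z)) + th * z * V (th * z) x.
pose kappa z := 2 * (a0 + S (th * z)) ^+ 2.
pose drho z (x : 'rV[R]_d) := th * (dC (S (th * z)) * S' (th * z) + (V (th * z) x + th * z * V' (th * z) x)).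
have ap (z : R) : `|z| < delta' -> 0 < a0 + S (th * z).
  move=> /thd/VP[_ _ + _]; rewrite ler_norml => /andP[h _].
  by move: h r0a etar; move: a00; clear; lra.
have n0 := chi_sqnorm_gt0 hL kstar.
have modeV (z : R) : `|z| < delta' -> mode L (V (th * z)) kstar != 0.
  move=> /thd/VP[_ + _ _]; apply: contra_eq_neq => ->.
  by rewrite mul0r eq_sym oner_neq0.
have nice_rho (z : R) : `|z| < delta' -> nice L (rho z).
  by move=> /thd/VP[nV _ _ _]; apply: niceD; [exact: nice_cst|exact: niceZ].
have nice_drho (z : R) : `|z| < delta' -> nice L (drho z).
  move=> /thd zd; have [nV _ _ _] := VP _ zd; have [nV' _ _ _] := V'P _ zd.
  by apply: niceZ; apply: niceD; [exact: nice_cst|apply: niceD => //; exact: niceZ].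
have rho_sol (z : R) : `|z| < delta' -> solution L W Phi B (rho z) (kappa z).
  move=> zd; have [nV _ _ VE] := VP _ (thd z zd).
  apply/solution_act; [exact: ap|exact: nice_L2S (nice_rho z zd)|].
  apply: nearW => x _; rewrite /rho VE; congr mean_act.
  rewrite (convD hL sW WL); [|exact: nice_cst|exact: niceZ].
  by rewrite (convZ hL sW WL)// (conv_cst hL sW WL).
have C1rho : unif_C1 delta' rho drho.
  apply: (unif_C1_scale th0 (curve_C1 C1c delta0 C0 _ _ SC1 VC1)) => z zd.
    by have [_ _ h _] := VP z zd; have [_ _ _ h'] := V'P z zd; split=> //; exact: le_trans etar.
  by have [] := V'P z zd.
have Sder (z : R) : `|z| < delta' -> is_derive z 1 (fun z => S (th * z)) (th * S' (th * z)) /\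
    {for z, continuous (fun z => th * S' (th * z))}.
  exact: (unif_C1_derive (unif_C1_scale th0 SC1)).
pose dkappa z := 2 * (2 * ((a0 + S (th * z)) * (th * S' (th * z)))).
have kder (z : R) : `|z| < delta' -> is_derive z 1 kappa (dkappa z).
  move=> zd; have [hS _] := Sder z zd.
  have h := der_add (der_cst a0 z) hS.
  by apply: (der_ext (der_mul (der_cst 2 z) (der_mul h h))) => [t|]; rewrite /kappa /dkappa; ring.
have derkE (z : R) : `|z| < delta' -> derive1 kappa z = dkappa z.
  by move=> /kder[_ <-]; rewrite derive1E.
have mode_ae (u : 'rV[R]_d -> R) : nice L u -> L2eq L u (cst 0) -> mode L u kstar = 0.
  move=> nu u0; rewrite /mode (@Rintegral_ae_eq _ _ _ _ (cst 0)).
  - by rewrite (Rintegral_torus_cst hL) mul0r.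
  - by case: nu => mu_ _ _ _; apply: measurable_funM => //; exact: measurable_chi.
  - exact: measurable_cst.
  - by apply: filterS u0 => x /= h xT; rewrite h// mul0r.
have branch : nontrivial_branch L W Phi B (cst (rho_inf L W Phi B (2 * a0 ^+ 2))) (2 * a0 ^+ 2) delta' rho kappa.
  split=> //.
  - rewrite /rho /kappa mulr0 S0E addr0; split=> //.
    by apply: nearW => x _; rewrite mul0r addr0.
  (* After subtracting the constant, the mode [kstar] of [rho z] is [th z] times a nonzero
     number. *)
  - move=> z zd zn hom; have [nV _ _ _] := VP _ (thd z zd).
    have tz : th * z != 0 by rewrite mulf_neq0// gt_eqF.
    have := mode_ae (fun x => th * z * V (th * z) x) (niceZ _ nV).
    rewrite modeZ// => H; have /eqP := modeV z zd; apply; apply: (mulfI tz).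
    rewrite mulr0; apply: H; apply: filterS hom => x /= h xT.
    by have := h xT; rewrite /rho /= -/(cc (a0 + S (th * z))) => /eqP; rewrite -subr_eq0 addrAC subrr add0r => /eqP.
  - exists drho; split.
      by apply: (L2S_C1_sup hL) C1rho => z zd; split; [exact: nice_rho|exact: nice_drho].
    move=> z zd; split.
    + by have [] := kder z zd.
    + have [hS cS'] := Sder z zd.
      have cd : {for z, continuous dkappa}.
        apply: cvgM; first exact: cvg_cst.
        apply: cvgM; first exact: cvg_cst.
        apply: cvgM; last exact: cS'.
        by apply: cvgD; [exact: cvg_cst|exact: is_derive_continuous hS].
      suff : derive1 kappa y @[y --> z] --> dkappa z by rewrite -derkE.
      apply: cvg_trans cd; apply: near_eq_cvg.
      near=> y; rewrite derkE//; near: y; exact: near_interval.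
    (* If the derivative of [kappa] vanishes, so does [S'], and then the mode [kstar] of [drho] is
       [th] times that of [V], not 0. *)
    + move=> [d0]; rewrite derkE// => dk.
      have c0 : 4 * ((a0 + S (th * z)) * th) != 0 by rewrite gt_eqF// mulr_gt0// mulr_gt0// ap.
      have S'0 : S' (th * z) = 0.
        by apply: (mulfI c0); rewrite mulr0 -dk /dkappa; ring.
      have [nV _ _ _] := VP _ (thd z zd); have [nV' lV' _ _] := V'P _ (thd z zd).
      have sd : sq_integrable L (drho z).
        by have [md [M dM] _ _] := nice_drho z zd; exact: sq_integrable_bounded dM.
      have /mode_ae : L2eq L (drho z) (cst 0) by exact: L2norm_eq0.
      move=> /(_ (nice_drho z zd)); rewrite /drho S'0 mulr0.
      rewrite (_ : (fun x => _) = (fun x => th * (V (th * z) x + th * z * V' (th * z) x))); last first.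
        by apply/funext => x; rewrite add0r.
      have nZ := niceZ (th * z) nV'.
      rewrite modeZ ?modeD ?modeZ//; last exact: niceD.
      move: lV' => /eqP; rewrite mulf_eq0 invr_eq0 (gt_eqF n0) orbF => /eqP ->.
      rewrite mulr0 addr0 => h; have /eqP := modeV z zd; apply.
      by apply: (mulfI (lt0r_neq0 th0)); rewrite h mulr0.
split.
  split=> //; last by exists delta', rho, kappa.
  by apply: nearW.
have [[M M0 HM] HC] := C1c.
have [q1 q10 Hq1] := HC 1 ltr01.
pose K := `|w| * (1 + M).
have K0 : 0 <= K by rewrite mulr_ge0// addr_ge0.
(* The terms serve the expansion of [cc] at [a0], the uniqueness clause, and the bound
   [|w (cc a - cc a0)| <= e0 / 2]; the other half of [e0] goes to the convolution of [u - cc a0]. *)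
pose q := Num.min (Num.min q1 r0) (Num.min e0 (e0 / (2 * (K + 1)))).
have K1 : 0 < 2 * (K + 1) by rewrite mulr_gt0// ltr_wpDl.
have q0 : 0 < q by rewrite !lt_min q10 r00 e00 divr_gt0.
have e02 : 0 < e0 / 2 by rewrite divr_gt0.
have [r' r'0 Hr'] := conv_small hL sW WL e02.
(* [a0 ^ 2] keeps [eps] below [kappas]; since [|k - kappas| = 2 |s| (a + a0) >= 2 a0 |s|], the other
   bound gives [|s| < q]. *)
pose eps := Num.min (a0 ^+ 2) (2 * a0 * q).
have eps0 : 0 < eps by rewrite lt_min exprn_gt0//= !mulr_gt0.
exists (Num.sqrt r'), eps, delta', rho, kappa; split=> //.
- by rewrite sqrtr_gt0.
- rewrite eps0 /=; apply: le_lt_trans (minr_lel _ _) _.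
  by rewrite mulr2n mulrDl mul1r ltrDl exprn_gt0.
- move=> u k sol ur keps.
  have [[[uL /sq_integrable_Lfun su] ue] kp _] := sol.
  have [mu_ _] := su.
  pose a := Num.sqrt (k / 2).
  have a1 : 0 < a by rewrite sqrtr_gt0 divr_gt0.
  have kE : k = 2 * a ^+ 2 by rewrite sqr_sqrtr ?divr_ge0 ?(ltW kp)// mulrC divfK.
  clearbody a; subst k.
  pose s := a - a0.
  have aE : a = a0 + s by rewrite /s addrC subrK.
  have sq : `|s| < q.
    have : `|s| * (2 * a0) < 2 * a0 * q.
      apply: le_lt_trans (_ : _ <= `|2 * a ^+ 2 - 2 * a0 ^+ 2|) (lt_le_trans keps (minr_ler _ _)).
      rewrite (_ : 2 * a ^+ 2 - 2 * a0 ^+ 2 = s * (2 * (a + a0))); last by rewrite /s; ring.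
      rewrite normrM ler_wpM2l// ger0_norm; last by rewrite mulr_ge0// addr_ge0// ltW.
      by rewrite ler_pM2l// lerDr ltW.
    by rewrite mulrC ltr_pM2l// mulr_gt0.
  have sq1 := lt_le_trans sq (le_trans (minr_lel _ _) (minr_lel _ _)).
  have sr0 := ltW (lt_le_trans sq (le_trans (minr_lel _ _) (minr_ler _ _))).
  have se0 := ltW (lt_le_trans sq (le_trans (minr_ler _ _) (minr_lel _ _))).
  have seK := lt_le_trans sq (le_trans (minr_ler _ _) (minr_ler _ _)).
  have wcc : `|w * (cc a - cc a0)| <= e0 / 2.
    have r00' : `|0 : R| <= r0 by rewrite normr0 ltW.
    have [|h _] := Hq1 0 s r00' sr0; first by rewrite subr0.
    have [_ dC0] := HM 0 r00'.
    rewrite subr0 addr0 -aE mul1r in h.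
    have h2 : `|cc a - cc a0| <= (1 + M) * `|s|.
      rewrite -[cc a - cc a0](subrK (dC 0 * s)) mulrDl mul1r.
      by apply: le_trans (ler_normD _ _) (lerD h _); rewrite normrM ler_wpM2r.
    rewrite normrM; apply: le_trans (ler_wpM2l (normr_ge0 _) h2) _.
    rewrite mulrA -/K; move: (ltW seK); rewrite ler_pdivlMr// => h3.
    rewrite ler_pdivlMr//; apply: le_trans h3.
    rewrite (_ : K * `|s| * 2 = `|s| * (2 * K)); last by ring.
    by rewrite ler_wpM2l// ler_pM2l// lerDl.
  have nGu := nice_conv_sq hL sW WL We su uL ue.
  have [_ [Y GuY] _ _] := nGu.
  (* [u] is only an L^2 representative; [u'] equals it almost everywhere, is nice and has the same
     convolution, hence solves the equation at every point. *)
  pose u' x := mean_act Phi B (L ^+ d) a (Defs.conv L W u x).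
  have nu' : nice L u'.
    apply: (nice_comp nGu GuY) => e e1.
    have [t t0 Ht] := @Heine_Cantor _ (- Y) Y (mean_act Phi B (L ^+ d) a)
      (fun y _ => @continuous_mean_act R Phi B (L ^+ d) hPhi_cont a y) e e1.
    exists t => // y y' yY _ yy; apply: ltW; apply: Ht => //.
    by rewrite -ler_norml.
  have uu' : L2eq L u u'.
    by have [Lu _ _] := sol; exact: (solution_act W Phi B a1 Lu).1.
  have su' : sq_integrable L u' by have [mu' [M' uM'] _ _] := nu'; exact: sq_integrable_bounded uM'.
  have sc (c : R) : sq_integrable L (cst c : 'rV[R]_d -> R).
    by have [mc [M' cM'] _ _] := @nice_cst R L d c; exact: sq_integrable_bounded cM'.
  have Guu' : Defs.conv L W u = Defs.conv L W u'.
    by apply: (conv_ae_eq hL sW WL) => //; case: su'.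
  pose v x := u' x - cc a.
  have nv : nice L v.
    by have := niceD nu' (nice_cst L (- cc a)); congr nice.
  have GvE x : Defs.conv L W v x = Defs.conv L W u x - w * cc a.
    by rewrite (convB_sq hL sW WL x su' (sc (cc a))) (conv_cst hL sW WL) Guu'.
  have Gvb : bounded_by (Defs.conv L W v) e0.
    move=> x; rewrite GvE.
    have := Hr' (fun x => u x - cc a0) (sq_integrableB su (sc (cc a0))).
    rewrite -L2norm_sqr; last exact: sq_integrableB su (sc (cc a0)).
    have ur2 : L2norm L (fun x => u x - cc a0) ^+ 2 <= r'.
      rewrite -[leRHS]sqr_sqrtr; last exact: ltW.
      by rewrite lerXn2r// ?nnegrE ?L2norm_ge0 ?sqrtr_ge0//; exact: ltW ur.
    move=> /(_ ur2 x); rewrite (convB_sq hL sW WL x su (sc (cc a0))) (conv_cst hL sW WL) -/w => h.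
    move: (Defs.conv L W u x) (cc a) (cc a0) h wcc => g c c' h wcc.
    rewrite (_ : g - w * c = (g - w * c') - w * (c - c')); last by ring.
    by apply: le_trans (ler_normB _ _) (le_trans (lerD h wcc) _); rewrite -splitr.
  have vE x : cc (a0 + s) + v x = mean_act Phi B (L ^+ d) (a0 + s) (W0 L W * cc (a0 + s) + Defs.conv L W v x).
    by rewrite -aE GvE /v addrC subrK addrC subrK.
  have [v0|[z [zd sS vz]]] := uniq s v se0 nv Gvb vE.
    left; apply: filterS uu' => x /= h xT; rewrite h//.
    by have /eqP := congr1 (@^~ x) v0; rewrite /v subr_eq0 => /eqP.
  right; exists (z / th).
  have thz : th * (z / th) = z by rewrite mulrC divfK// gt_eqF.
  split.
  + by rewrite normrM normfV (gtr0_norm th0) ltr_pM2r// invr_gt0.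
  + apply: filterS uu' => x /= h xT; rewrite h// /rho thz -sS -aE.
    by have := congr1 (@^~ x) vz; rewrite /= /v => <-; rewrite addrC subrK.
  + by rewrite /kappa thz -sS -aE.
(* The remainder is exactly [th z (V (th z) - chi)]; [V] is differentiable at 0 uniformly in [x], so
   this is of order [z ^ 2]. *)
- apply/eqoP => e e1.
  have [q2 q20 Hq2] := VC1 1 ltr01.
  have sV : 0 < Num.sqrt (L ^+ d) by rewrite sqrtr_gt0.
  pose K2 := (1 + C) * th ^+ 2 * Num.sqrt (L ^+ d).
  have C1p : 0 < 1 + C by rewrite ltr_wpDr.
  have K20 : 0 < K2 by exact: mulr_gt0 (mulr_gt0 C1p (exprn_gt0 2 th0)) sV.
  near=> z.
  have zb : `|z| < Num.min (Num.min delta' (q2 / th)) (e / K2).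
    near: z; exists (Num.min (Num.min delta' (q2 / th)) (e / K2)); first by rewrite /= !lt_min delta'0 (divr_gt0 q20 th0) (divr_gt0 e1 K20).
    by move=> y /=; rewrite sub0r normrN.
  have zd := lt_le_trans zb (le_trans (minr_lel _ _) (minr_lel _ _)).
  have zq := lt_le_trans zb (le_trans (minr_lel _ _) (minr_ler _ _)).
  have ze := ltW (lt_le_trans zb (minr_ler _ _)).
  have d00 : `|0 : R| < delta by rewrite normr0.
  have zt : `|th * z| = `|z| * th by rewrite normrM (gtr0_norm th0) mulrC.
  have [|h _] := Hq2 0 (th * z) d00 (thd z zd); first by rewrite subr0 zt -ltr_pdivlMr.
  have [_ _ V'0 _] := V'P 0 d00.
  have [nV _ _ _] := VP _ (thd z zd).
  have Vb : bounded_by (fun x => V (th * z) x - chi L kstar x) ((1 + C) * `|th * z|).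
    move=> x; rewrite -V0E; have := h x; rewrite subr0 mul1r => hx.
    rewrite -[_ - _](subrK (th * z * V' 0 x)) mulrDl mul1r.
    by apply: le_trans (ler_normD _ _) (lerD hx _); rewrite normrM mulrC ler_wpM2r.
  rewrite ger0_norm ?L2norm_ge0//.
  have -> : rho z \- cst (rho_inf L W Phi B (kappa z)) \- z \*: omega L kstar =
     (fun x => th * z * (V (th * z) x + -1 * chi L kstar x)).
    apply/funext => x; rewrite /rho /= omega_chi -/th -/(cc (a0 + S (th * z))).
    by rewrite -[z *: _]/(z * _); ring.
  have nn : nice L (fun x => th * z * (V (th * z) x + -1 * chi L kstar x)).
    by apply: niceZ; apply: niceD => //; apply: niceZ; exact: nice_chi.
  have [mn _ _ _] := nn.
  apply: le_trans (@L2norm_bounded _ _ _ hL _ ((`|z| * th) * ((1 + C) * (`|z| * th))) mn _) _.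
    by move=> x; rewrite normrM zt -zt mulN1r ler_wpM2l.
  rewrite (_ : _ * Num.sqrt _ = `|z| * K2 * `|z|); last by rewrite /K2; ring.
  by rewrite ler_wpM2r// -ler_pdivlMr.
Unshelve. all: by end_near. Qed.
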